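(* Let $\{\gamma_1(u),\gamma_2(v)\}$, $\gamma_1,\gamma_2:\mathbb{R}\to\mathbb{H}^2$, be an admissible front pair in $\mathbb{H}^2$ (with Legendrian lifts $\alpha_i=(\gamma_i,\nu_i)$, $\nu_i$ the positive unit normal), parametrized so that $2u$ (resp. $2v$) is an arc-length parameter of $\alpha_1$ (resp. $\alpha_2$) with respect to the metric $\langle\ ,\ \rangle_{\mathcal S}$, i.e. $\langle\alpha_i',\alpha_i'\rangle_{\mathcal S}\equiv 4$. Let $k_1(u),k_2(v):\mathbb{R}\to\mathbb{R}P^1$ and $a_1(u),a_2(v):\mathbb{R}\to\mathbb{H}^3_1$ denote, respectively, the geodesic curvatures and asymptotic lifts of $\gamma_1$ and $\gamma_2$ with respect to their positive unit normals. Put $\omega_1(u):=\cot^{-1}(k_1(u))$ and $\omega_2(v):=\pi-\cot^{-1}(k_2(v))$, and assume that the map $(u,v)\mapsto(x(u,v),y(u,v))$, $$x(u,v)=\int_0^u\cos\omega_1+\int_0^v\cos\omega_2,\qquad y(u,v)=\int_0^u\sin\omega_1-\int_0^v\sin\omega_2,$$ is a global diffeomorphism of $\mathbb{R}^2$. Then $f:\mathbb{R}^2\to\mathbb{H}^3_1$ given by $f(u,v)=a_1(u)\,\overline{a_2(v)}$ is an isometric immersion of $\mathbb{L}^2$ into $\mathbb{H}^3_1$ (that is, $f$ is an immersion and $\mathbb{R}^2$ with the induced metric is isometric to $\mathbb{L}^2$), and $(u,v)$ are global characteristic parameters of $f$ with angle functions $\omega_1,\omega_2$. Conversely, up to an isometry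 of $\mathbb{H}^3_1$ and a reparametrization, every isometric immersion of $\mathbb{L}^2$ into $\mathbb{H}^3_1$ can be recovered by this process from an admissible front pair in $\mathbb{H}^2$.
   Context: $\mathbb{L}^2$ is $\mathbb{R}^2$ with the metric $-dx^2+dy^2$. $\mathbb{R}^4_2$ is $\mathbb{R}^4$ with the metric $\langle\ ,\ \rangle=-dx_0^2-dx_1^2+dx_2^2+dx_3^2$, identified with the associative algebra $\{x_0+x_1i+x_2j+x_3k\}$ with unit $1$ and products $i^2=-1$, $j^2=k^2=1$, $ij=k$, $ji=-k$, $ik=-j$, $ki=j$, $jk=-i$, $kj=i$. Conjugation is $\overline{x_0+x_1i+x_2j+x_3k}=x_0-x_1i-x_2j-x_3k$. The anti-de Sitter space is $\mathbb{H}^3_1=\{z\in\mathbb{R}^4_2:\langle z,z\rangle=-1\}=\{z: z\bar z=1\}$, a Lie group. Put $\mathbb{H}^2=\{x: x_0=0,\ \langle x,x\rangle=-1,\ x_1>0\}$ and $\mathbb{S}^2_1=\{x: x_0=0,\ \langle x,x\rangle=1\}$. $TU(\mathbb{H}^2)=\{(x,y):x\in\mathbb{H}^2,y\in\mathbb{S}^2_1,\langle x,y\rangle=0\}$ is the unit tangent bundle, and $\pi:\mathbb{H}^3_1\to TU(\mathbb{H}^2)$, $\pi(z)=(z\,i\,\bar z,\;z\,k\,\bar z)$, is a double covering with $\pi(-z)=\pi(z)$. Fronts. A Legendrian curve is an immersion $\alpha=(\gamma,\nu):I\subset\mathbb{R}\to TU(\mathbb{H}^2)$ with $\langle\gamma',\nu\rangle=0$.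 It carries the metric $\langle\alpha',\alpha'\rangle_{\mathcal S}=\langle\gamma',\gamma'\rangle+\langle\nu',\nu'\rangle>0$. A front in $\mathbb{H}^2$ is a smooth map $\gamma:I\to\mathbb{H}^2$ which is the first component of a Legendrian curve $\alpha=(\gamma,\nu)$; $\nu$ is then called a unit normal of $\gamma$. The geodesic curvature of $\gamma$ with respect to $\nu$ is $k_g:I\to\mathbb{R}\cup\{\infty\}\equiv\mathbb{R}P^1$, with $k_g=\langle\gamma'',\nu\rangle/\|\gamma'\|^2$ where $\gamma'\ne0$ and $k_g=\infty$ where $\gamma'=0$. An asymptotic lift of $\gamma$ (with respect to $\nu$) is a regular curve $a:I\to\mathbb{H}^3_1$ with $\pi\circ a=(\gamma,\nu)$; it is unique up to sign. Angle function. An asymptotic lift satisfies $\langle a',a\,j\rangle=0$, so $\bar a a'=\lambda i+\mu k$. The parameter is called asymptotic if $\lambda^2+\mu^2=1$, and then one writes $\bar a a'=\cos(\omega^a)\,i+\sin(\omega^a)\,k$ with $\omega^a$ smooth, unique up to adding a constant in $2\pi\mathbb{Z}$. The parameter of $\gamma$ is asymptotic for $a$ exactly when $\langle\alpha',\alpha'\rangle_{\mathcal S}\equiv4$. In general, $\omega^a$ is computed after an orientation-preserving reparametrization by the asymptotic parameter. Positive unit normal. Let $\gamma$ be a front whose geodesic curvature is not surjective onto $\mathbb{R}P^1$. A unit normal $\nu$ of $\gamma$ is called positive if the corresponding asymptotic lift $a$ satisfies: (1) if $\gamma$ is regular, $\sin(\omega^a)>0$ everywhere; (2) if $\gamma$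 is not regular, $\cos(\omega^a(u_0))=-1$ at every point $u_0$ with $\gamma'(u_0)=0$. Admissible front pair. This is a pair of fronts $\gamma_1,\gamma_2:\mathbb{R}\to\mathbb{H}^2$ with positive unit normals $\nu_1,\nu_2$, such that $\gamma_1(0)=\gamma_2(0)=i$, $\nu_1(0)=\nu_2(0)=k$, $\gamma_1$ is a regular curve, and the geodesic curvatures $k_1,k_2$ with respect to $\nu_1,\nu_2$ satisfy $k_1(u)\neq k_2(v)$ for all $(u,v)\in\mathbb{R}^2$, and moreover $k_1(u)>k_2(v)$ for all $(u,v)$ if $\gamma_2$ is also regular. Convention for $\cot^{-1}$. $\cot:\mathbb{R}\to\mathbb{R}P^1$ is a $\pi$-periodic covering. For $A\subsetneq\mathbb{R}P^1$ (here $A=k_i(\mathbb{R})$), $\cot^{-1}$ denotes the continuous determination on $A$ with $\cot^{-1}(A)\subset(0,\pi)$ if $\infty\notin A$, and $\cot^{-1}(A)\subset(\pi-c,2\pi-c)$ for some $c\in(0,\pi)$ if $\infty\in A$. Global characteristic parameters. $(u,v)\in\mathbb{R}^2$ are global characteristic parameters of an immersion $f(u,v)$ into $\mathbb{H}^3_1$, with angle functions $\omega_1(u),\omega_2(v)$, if $\omega_1(u)+\omega_2(v)\in(0,\pi)$ for all $(u,v)$ and, for a unit normal $N$, the forms $I=\langle df,df\rangle$, $II=-\langle df,dN\rangle$, $III=\langle dN,dN\rangle$ are $$I=-\cos(2\omega_1)du^2-2\cos(\omega_1-\omega_2)dudv-\cos(2\omega_2)dv^2,\quad II=2\sin(\omega_1+\omega_2)dudv,$$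 $$III=\cos(2\omega_1)du^2-2\cos(\omega_1-\omega_2)dudv+\cos(2\omega_2)dv^2.$$ *)

(* Defs.v *)
From Stdlib Require Import Reals ClassicalEpsilon.
From Coquelicot Require Import Coquelicot.
Open Scope R_scope.

(* (((x0, x1), x2), x3) stands for x0 + x1 i + x2 j + x3 k. *)
Notation R4 := (R * R * R * R)%type.

Definition x0 (z : R4) : R := fst (fst (fst z)).
Definition x1 (z : R4) : R := snd (fst (fst z)).
Definition x2 (z : R4) : R := snd (fst z).
Definition x3 (z : R4) : R := snd z.

Definition q0 : R4 := (0, 0, 0, 0).
Definition qi : R4 := (0, 1, 0, 0).
Definition qk : R4 := (0, 0, 0, 1).

Definition inner (z w : R4) : R :=
  - x0 z * x0 w - x1 z * x1 w + x2 z * x2 w + x3 z * x3 w.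

(* i^2 = -1, j^2 = k^2 = 1, ij = k = -ji, ki = j = -ik, kj = i = -jk. *)
Definition qmul (z w : R4) : R4 :=
  (x0 z * x0 w - x1 z * x1 w + x2 z * x2 w + x3 z * x3 w,
   x0 z * x1 w + x1 z * x0 w - x2 z * x3 w + x3 z * x2 w,
   x0 z * x2 w + x2 z * x0 w - x1 z * x3 w + x3 z * x1 w,
   x0 z * x3 w + x3 z * x0 w + x1 z * x2 w - x2 z * x1 w).

Definition qconj (z : R4) : R4 := (x0 z, - x1 z, - x2 z, - x3 z).

Definition in_H31 (z : R4) : Prop := inner z z = -1.
Definition in_H2 (z : R4) : Prop := x0 z = 0 /\ inner z z = -1 /\ 0 < x1 z.
Definition in_S21 (z : R4) : Prop := x0 z = 0 /\ inner z z = 1.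
Definition in_TUH2 (x y : R4) : Prop := in_H2 x /\ in_S21 y /\ inner x y = 0.

Definition proj (z : R4) : R4 * R4 :=
  (qmul (qmul z qi) (qconj z), qmul (qmul z qk) (qconj z)).

(* Amounts to smoothness when required at every t of an open interval. *)
Definition smooth1_at (g : R -> R) (t : R) : Prop :=
  forall n : nat, ex_derive_n g n t.
Definition smooth1 (g : R -> R) : Prop := forall t, smooth1_at g t.

Definition smooth_curve_at (c : R -> R4) (t : R) : Prop :=
  smooth1_at (fun s => x0 (c s)) t /\ smooth1_at (fun s => x1 (c s)) t /\
  smooth1_at (fun s => x2 (c s)) t /\ smooth1_at (fun s => x3 (c s)) t.
Definition smooth_curve (c : R -> R4) : Prop := forall t, smooth_curve_at c t.

Definition velocity (c : R -> R4) (t : R) : R4 :=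
  (Derive (fun s => x0 (c s)) t, Derive (fun s => x1 (c s)) t,
   Derive (fun s => x2 (c s)) t, Derive (fun s => x3 (c s)) t).

Definition dirder {V : NormedModule R_AbsRing} (F : V -> R) (p X : V) : R :=
  Derive (fun t : R => F (plus p (scal t X))) 0.

(* For V of finite dimension (here R^2 and R^4): F is C^(n+1) iff it has
   directional derivatives in all directions and these are C^n. *)
Fixpoint Ck {V : NormedModule R_AbsRing} (n : nat) (F : V -> R) : Prop :=
  (forall p, continuous F p) /\
  match n with
  | O => True
  | S m => forall X : V,
      (forall p, ex_derive (fun t : R => F (plus p (scal t X))) 0) /\
      Ck m (fun p => dirder F p X)
  end.

Definition smooth {V : NormedModule R_AbsRing} (F : V -> R) : Prop :=
  forall n, Ck n F.

Definition smooth4 {V : NormedModule R_AbsRing} (F : V -> R4) : Prop :=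
  smooth (fun p => x0 (F p)) /\ smooth (fun p => x1 (F p)) /\
  smooth (fun p => x2 (F p)) /\ smooth (fun p => x3 (F p)).

Definition diff4 {V : NormedModule R_AbsRing} (F : V -> R4) (p X : V) : R4 :=
  (dirder (fun q => x0 (F q)) p X, dirder (fun q => x1 (F q)) p X,
   dirder (fun q => x2 (F q)) p X, dirder (fun q => x3 (F q)) p X).

Definition smooth2 (h : R * R -> R * R) : Prop :=
  smooth (fun p : R * R => fst (h p)) /\ smooth (fun p : R * R => snd (h p)).

Definition diffeo_R2 (h : R * R -> R * R) : Prop :=
  smooth2 h /\
  exists g : R * R -> R * R, smooth2 g /\
    (forall p, g (h p) = p) /\ (forall p, h (g p) = p).

Inductive RP1 : Type :=
| Fin (r : R)
| Inf.

Definition RP1_gt (p q : RP1) : Prop :=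
  match p, q with
  | Fin r, Fin s => r > s
  | _, _ => False
  end.

(* Neighbourhood filters of the one-point compactification of R *)
Definition RP1_locally (p : RP1) (P : RP1 -> Prop) : Prop :=
  match p with
  | Fin r => locally r (fun s => P (Fin s))
  | Inf => P Inf /\ exists M : R, forall s, M < Rabs s -> P (Fin s)
  end.

Definition RP1_continuous_on (A : RP1 -> Prop) (psi : RP1 -> R) : Prop :=
  forall p, A p -> filterlim psi (within A (RP1_locally p)) (locally (psi p)).

Definition cot (t : R) : RP1 :=
  if Req_EM_T (sin t) 0 then Inf else Fin (cos t / sin t).

(* Several c may be possible when oo is in A; on a connected A (the only case
   used) they all give the same values of psi. *)
Definition is_acot (A : RP1 -> Prop) (psi : RP1 -> R) : Prop :=
  (forall p, A p -> cot (psi p) = p) /\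
  RP1_continuous_on A psi /\
  (~ A Inf -> forall p, A p -> 0 < psi p < PI) /\
  (A Inf -> exists c, 0 < c < PI /\
     forall p, A p -> PI - c < psi p < 2 * PI - c).

Definition range (k : R -> RP1) (p : RP1) : Prop := exists u, k u = p.

Definition metricS (gamma nu : R -> R4) (u : R) : R :=
  inner (velocity gamma u) (velocity gamma u) +
  inner (velocity nu u) (velocity nu u).

Definition legendrian (gamma nu : R -> R4) : Prop :=
  smooth_curve gamma /\ smooth_curve nu /\
  (forall u, in_TUH2 (gamma u) (nu u)) /\
  (forall u, (velocity gamma u, velocity nu u) <> (q0, q0)) /\
  (forall u, inner (velocity gamma u) (nu u) = 0).

Definition regular (c : R -> R4) : Prop := forall u, velocity c u <> q0.

Definition geod_curv (gamma nu : R -> R4) (u : R) : RP1 :=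
  if excluded_middle_informative (velocity gamma u = q0) then Inf
  else Fin (inner (velocity (velocity gamma) u) (nu u) /
            inner (velocity gamma u) (velocity gamma u)).

Definition asymptotic_lift (gamma nu a : R -> R4) : Prop :=
  smooth_curve a /\ regular a /\ (forall u, in_H31 (a u)) /\
  (forall u, proj (a u) = (gamma u, nu u)).

(* omega is an angle function of a: here s = s(u) is the asymptotic parameter
   (a change of parameter onto an open interval), and b, theta are the curve and
   its angle as functions of s; b and theta are irrelevant outside the range
   of s. *)
Definition angle_function (a : R -> R4) (omega : R -> R) : Prop :=
  exists (s : R -> R) (b : R -> R4) (theta : R -> R),
    smooth1 s /\ (forall u, 0 < Derive s u) /\
    (forall u, smooth_curve_at b (s u) /\ smooth1_at theta (s u)) /\
    (forall u, b (s u) = a u /\ theta (s u) = omega u) /\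
    (forall u, qmul (qconj (b (s u))) (velocity b (s u)) =
               (0, cos (theta (s u)), 0, sin (theta (s u)))).

Definition positive_unit_normal (gamma nu : R -> R4) : Prop :=
  legendrian gamma nu /\
  (exists p : RP1, ~ range (geod_curv gamma nu) p) /\
  exists (a : R -> R4) (omega : R -> R),
    asymptotic_lift gamma nu a /\ angle_function a omega /\
    (regular gamma -> forall u, 0 < sin (omega u)) /\
    (~ regular gamma -> forall u, velocity gamma u = q0 -> cos (omega u) = -1).

Definition admissible_front_pair (gamma1 nu1 gamma2 nu2 : R -> R4) : Prop :=
  positive_unit_normal gamma1 nu1 /\ positive_unit_normal gamma2 nu2 /\
  gamma1 0 = qi /\ gamma2 0 = qi /\ nu1 0 = qk /\ nu2 0 = qk /\
  regular gamma1 /\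
  (forall u v, geod_curv gamma1 nu1 u <> geod_curv gamma2 nu2 v) /\
  (regular gamma2 ->
   forall u v, RP1_gt (geod_curv gamma1 nu1 u) (geod_curv gamma2 nu2 v)).

Definition immersion (f : R * R -> R4) : Prop :=
  smooth4 f /\ (forall p, in_H31 (f p)) /\
  (forall p X : R * R, diff4 f p X = q0 -> X = (0, 0)).

(* h is an isometry from R^2 with the metric induced by f onto
   L^2 = (R^2, -dx^2 + dy^2). *)
Definition isometric_immersion_L2 (f : R * R -> R4) : Prop :=
  immersion f /\
  exists h : R * R -> R * R, diffeo_R2 h /\
    forall p X Y : R * R,
      inner (diff4 f p X) (diff4 f p Y) =
      - dirder (fun q : R * R => fst (h q)) p X
        * dirder (fun q : R * R => fst (h q)) p Y
      + dirder (fun q : R * R => snd (h q)) p X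
        * dirder (fun q : R * R => snd (h q)) p Y.

Definition unit_normal (f N : R * R -> R4) : Prop :=
  smooth4 N /\
  forall p : R * R, inner (N p) (N p) = 1 /\ inner (N p) (f p) = 0 /\
    forall X : R * R, inner (N p) (diff4 f p X) = 0.

Definition global_characteristic_parameters
    (f : R * R -> R4) (omega1 omega2 : R -> R) : Prop :=
  smooth1 omega1 /\ smooth1 omega2 /\
  (forall u v, 0 < omega1 u + omega2 v < PI) /\
  exists N : R * R -> R4, unit_normal f N /\
    forall u v du dv : R,
      let df := diff4 f (u, v) (du, dv) in
      let dN := diff4 N (u, v) (du, dv) in
      let w1 := omega1 u in
      let w2 := omega2 v in
      inner df df =
        - cos (2 * w1) * du ^ 2 - 2 * cos (w1 - w2) * du * dv
        - cos (2 * w2) * dv ^ 2 /\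
      - inner df dN = 2 * sin (w1 + w2) * du * dv /\
      inner dN dN =
        cos (2 * w1) * du ^ 2 - 2 * cos (w1 - w2) * du * dv
        + cos (2 * w2) * dv ^ 2.

(* Since the anti-de Sitter space is a closed submanifold, its smooth self-maps
   are the restrictions of smooth maps of R^4. *)
Definition isometry_H31 (Phi : R4 -> R4) : Prop :=
  smooth4 Phi /\ (forall z, in_H31 z -> in_H31 (Phi z)) /\
  (exists Psi : R4 -> R4,
     smooth4 Psi /\ (forall z, in_H31 z -> in_H31 (Psi z)) /\
     forall z, in_H31 z -> Psi (Phi z) = z /\ Phi (Psi z) = z) /\
  (forall z X Y : R4, in_H31 z -> inner z X = 0 -> inner z Y = 0 ->
     inner (diff4 Phi z X) (diff4 Phi z Y) = inner X Y).

Definition flat_chart (omega1 omega2 : R -> R) (p : R * R) : R * R :=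
  (RInt (fun t => cos (omega1 t)) 0 (fst p)
     + RInt (fun t => cos (omega2 t)) 0 (snd p),
   RInt (fun t => sin (omega1 t)) 0 (fst p)
     - RInt (fun t => sin (omega2 t)) 0 (snd p)).

Record construction_data (gamma1 nu1 gamma2 nu2 a1 a2 : R -> R4)
    (omega1 omega2 : R -> R) : Prop := {
  cd_admissible : admissible_front_pair gamma1 nu1 gamma2 nu2;
  cd_arclength1 : forall u, metricS gamma1 nu1 u = 4;
  cd_arclength2 : forall v, metricS gamma2 nu2 v = 4;
  cd_lift1 : asymptotic_lift gamma1 nu1 a1;
  cd_lift2 : asymptotic_lift gamma2 nu2 a2;
  cd_omega1 : exists acot : RP1 -> R,
    is_acot (range (geod_curv gamma1 nu1)) acot /\
    forall u, omega1 u = acot (geod_curv gamma1 nu1 u);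
  cd_omega2 : exists acot : RP1 -> R,
    is_acot (range (geod_curv gamma2 nu2)) acot /\
    forall v, omega2 v = PI - acot (geod_curv gamma2 nu2 v);
  cd_diffeo : diffeo_R2 (flat_chart omega1 omega2)
}.

(* Main.v *)
Require Import Defs.
From Stdlib Require Import Reals Lra Lia FunctionalExtensionality ClassicalEpsilon.
From Coquelicot Require Import Coquelicot.
Open Scope R_scope.

(** Both directions rest on one computation. A curve [a] of unit quaternions with
    [conj a a' = l i + m k] moves the frame [gamma = a i conj a], [nu = a k conj a],
    [e = a j conj a] by [gamma' = 2 m e], [nu' = -2 l e]. Hence [l] and [m] can be read
    off the front ([lift_log]), the arc length condition says that [(l, m)] is a unit
    vector, and the geodesic curvature is [l / m], the cotangent of its angle
    ([lift_geod_curv]).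

    From fronts to surfaces. The curvature gives the vector [(l, m)] up to sign, and a
    branch of the inverse cotangent chooses a sign by continuity. Positivity of the
    unit normal is exactly the condition that this is the sign of the lift
    ([th_front]). With the angles known, the differentials of [f = a1 conj a2] and of
    the normal [a1 j conj a2] are translates of explicit combinations of [i] and [k]
    ([diff4_sandwich]), from which the three forms are read. The curvatures of the two
    fronts are different, so [sin (w1 + w2)] does not vanish, and the comparison of one
    pair of values puts [w1 + w2] in [(0, PI)] ([construction_angles]).

    From surfaces to fronts. Let [(x, y)] be coordinates in which the induced metric is
    [- dx^2 + dy^2]. By the Gauss equation the second fundamental form has determinant
    -1 there ([gauss]), so it has two null directions. Measured in the Euclidean metric
    [dx^2 + dy^2] they are spanned by unit vectors at angles [al] and [- be] with
    [0 < al + be < PI], and the Codazzi equations say that [al] is constant along the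
    second family and [be] along the first ([asymptotic_angles]). Equivalently, the two
    unit fields commute: they form a Chebyshev net of the complete Euclidean plane.
    Unit fields have integral curves defined for all times, and the sum of the two
    integral curves through the origin is a global chart of the plane whose inverse is
    given by the potentials of the dual coframe ([net_chart]). This chart is
    [flat_chart], with the angles along the two curves as angle functions.

    The left translates of the tangent frame are constant along the first family and
    the right translates along the second, so the surface is the product of its
    asymptotic curves through the base point ([factorization]), once an ambient
    isometry has moved the base point to [1] and its frame to [i], [j], [k]. The ranges
    of [w1] and [- w2] are disjoint modulo [PI]; exchanging or reversing the families
    brings them to the intervals that positivity requires ([split_data_normalize]), and
    projecting the two asymptotic curves then gives an admissible pair
    ([split_construction]).

    All uniqueness arguments for differential equations use the bound [exp_growth]. *)

(** * Differential calculus *)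

Lemma is_derive_add (f g : R -> R) t a b :
  is_derive f t a -> is_derive g t b -> is_derive (fun s => f s + g s) t (a + b).
Proof. intros Hf Hg. exact (is_derive_plus (V := R_NormedModule) f g t a b Hf Hg). Qed.

Lemma is_derive_sub (f g : R -> R) t a b :
  is_derive f t a -> is_derive g t b -> is_derive (fun s => f s - g s) t (a - b).
Proof. intros Hf Hg. exact (is_derive_minus (V := R_NormedModule) f g t a b Hf Hg). Qed.

Lemma is_derive_mul (f g : R -> R) t a b :
  is_derive f t a -> is_derive g t b ->
  is_derive (fun s => f s * g s) t (a * g t + f t * b).
Proof. intros Hf Hg. exact (is_derive_mult f g t a b Hf Hg Rmult_comm). Qed.

Lemma is_derive_cst (c t : R) : is_derive (fun _ : R => c) t 0.
Proof. exact (is_derive_const (K := R_AbsRing) (V := R_NormedModule) c t). Qed.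

Lemma is_derive_eq (f : R -> R) t a b : is_derive f t a -> a = b -> is_derive f t b.
Proof. intros H <-. exact H. Qed.

Section Calculus.
Context {V : NormedModule R_AbsRing}.
Implicit Types F G : V -> R.

(** Stated for values of [F], because the additions of a module and of its underlying
    group are convertible without being syntactically equal. *)
Lemma line_at_0 F (p X : V) : F (plus p (scal (0 : R) X)) = F p.
Proof.
  f_equal.
  replace (scal (0 : R) X) with (zero : V) by (symmetry; exact (scal_zero_l X)).
  apply plus_zero_r.
Qed.

Lemma Ck_continuous n F : Ck n F -> forall p, continuous F p.
Proof. destruct n; intros [H _]; exact H. Qed.

Lemma Ck_0 F : (forall p, continuous F p) -> Ck 0 F.
Proof. intros H; split; [exact H | exact I]. Qed.

Lemma Ck_S n F (dF : V -> V -> R) :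
  (forall p, continuous F p) ->
  (forall X p, is_derive (fun t : R => F (plus p (scal t X))) 0 (dF X p)) ->
  (forall X, Ck n (dF X)) -> Ck (S n) F.
Proof.
  intros Hc Hd Hk. split; [exact Hc|]. intros X. split.
  - intros p. exists (dF X p). apply Hd.
  - replace (fun p => dirder F p X) with (dF X); [apply Hk|].
    apply functional_extensionality; intros p. symmetry.
    apply is_derive_unique, Hd.
Qed.

Lemma Ck_pred n : forall F, Ck (S n) F -> Ck n F.
Proof.
  induction n as [|n IH]; intros F [Hc Hd].
  - apply Ck_0, Hc.
  - split; [exact Hc|]. intros X. destruct (Hd X) as [H1 H2].
    split; [exact H1|]. apply IH, H2.
Qed.

Lemma Ck_S_dirder n F : Ck (S n) F -> forall X,
  (forall p, is_derive (fun t : R => F (plus p (scal t X))) 0 (dirder F p X)) /\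
  Ck n (fun p => dirder F p X).
Proof.
  intros [_ H] X. destruct (H X) as [H1 H2]. split; [|exact H2].
  intros p. apply Derive_correct, H1.
Qed.

Lemma Ck_const n (c : R) : Ck n (fun _ : V => c).
Proof.
  revert c; induction n as [|n IH]; intros c.
  - apply Ck_0; intros; apply continuous_const.
  - apply Ck_S with (dF := fun _ _ => 0); auto.
    + intros; apply continuous_const.
    + intros; apply (is_derive_const (V := R_NormedModule) c 0).
Qed.

Lemma Ck_linear n (L : V -> R) :
  (forall p X t, L (plus p (scal t X)) = L p + t * L X) ->
  (forall p, continuous L p) -> Ck n L.
Proof.
  intros Hl Hc. destruct n; [apply Ck_0, Hc|].
  apply Ck_S with (dF := fun X _ => L X); auto.
  - intros X p.
    apply (is_derive_ext (fun t : R => L p + t * L X)); [intros; symmetry; apply Hl|].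
    auto_derive; auto; ring.
  - intros; apply Ck_const.
Qed.

Lemma Ck_plus n : forall F G, Ck n F -> Ck n G -> Ck n (fun p => F p + G p).
Proof.
  induction n as [|n IH]; intros F G HF HG.
  - apply Ck_0; intros p.
    apply (continuous_plus F G); eapply Ck_continuous; eauto.
  - apply Ck_S with (dF := fun X p => dirder F p X + dirder G p X).
    + intros p. apply (continuous_plus F G); eapply Ck_continuous; eauto.
    + intros X p.
      apply (is_derive_plus (V := R_NormedModule));
        apply (Ck_S_dirder n); assumption.
    + intros X. apply IH; apply (Ck_S_dirder n); assumption.
Qed.

Lemma Ck_mult n : forall F G, Ck n F -> Ck n G -> Ck n (fun p => F p * G p).
Proof.
  induction n as [|n IH]; intros F G HF HG.
  - apply Ck_0; intros p.
    apply (continuous_mult F G); eapply Ck_continuous; eauto.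
  - apply Ck_S with (dF := fun X p => dirder F p X * G p + F p * dirder G p X).
    + intros p. apply (continuous_mult F G); eapply Ck_continuous; eauto.
    + intros X p.
      pose proof (proj1 (Ck_S_dirder n F HF X) p) as H1.
      pose proof (proj1 (Ck_S_dirder n G HG X) p) as H2.
      rewrite <- (line_at_0 F p X), <- (line_at_0 G p X).
      exact (is_derive_mult _ _ _ _ _ H1 H2 Rmult_comm).
    + intros X. apply Ck_plus; apply IH;
        try (apply (Ck_S_dirder n); assumption); apply Ck_pred; assumption.
Qed.

Lemma continuous_comp_R (g : R -> R) F p :
  ex_derive g (F p) -> continuous F p -> continuous (fun q => g (F q)) p.
Proof.
  intros Hg HF. apply (continuous_comp F g); auto.
  apply (ex_derive_continuous (V := R_NormedModule)); exact Hg.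
Qed.

Lemma Ck_inv n : forall F, Ck n F -> (forall p, F p <> 0) -> Ck n (fun p => / F p).
Proof.
  induction n as [|n IH]; intros F HF Hn;
    assert (Hc : forall p, continuous (fun p => / F p) p)
      by (intros p; apply (continuous_comp_R Rinv);
          [auto_derive; auto | eapply Ck_continuous; eauto]).
  - apply Ck_0; auto.
  - apply Ck_S with (dF := fun X p => - 1 * dirder F p X * (/ F p * / F p)); auto.
    + intros X p.
      pose proof (proj1 (Ck_S_dirder n F HF X) p) as H1.
      assert (Hp : F (plus p (scal (0 : R) X)) <> 0) by (rewrite (line_at_0 F); apply Hn).
      replace (-1 * dirder F p X * (/ F p * / F p)) with (- dirder F p X / F p ^ 2)
        by (field; apply Hn).
      rewrite <- (line_at_0 F p X).
      exact (is_derive_inv _ _ _ H1 Hp).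
    + intros X. apply Ck_mult.
      * apply Ck_mult; [apply Ck_const | apply (Ck_S_dirder n); assumption].
      * apply Ck_mult; apply IH; auto; apply Ck_pred; assumption.
Qed.

Lemma smooth1_ex_derive g : smooth1 g -> forall t, ex_derive g t.
Proof. intros H t. exact (H t 1%nat). Qed.

Lemma smooth1_Derive g : smooth1 g -> smooth1 (Derive g).
Proof.
  intros H t n. destruct n as [|n]; [exact I|].
  apply ex_derive_ext with (f := Derive_n g (S n)); [|exact (H t (S (S n)))].
  clear. induction n as [|n IH]; intros t; [reflexivity|].
  simpl. apply Derive_ext. intros; apply IH.
Qed.

Lemma Ck_comp_R n : forall g F, smooth1 g -> Ck n F -> Ck n (fun p => g (F p)).
Proof.
  induction n as [|n IH]; intros g F Hg HF;
    assert (Hc : forall p, continuous (fun p => g (F p)) p)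
      by (intros p; apply continuous_comp_R;
          [apply smooth1_ex_derive, Hg | eapply Ck_continuous; eauto]).
  - apply Ck_0; auto.
  - apply Ck_S with (dF := fun X p => dirder F p X * Derive g (F p)); auto.
    + intros X p.
      pose proof (proj1 (Ck_S_dirder n F HF X) p) as H1.
      rewrite <- (line_at_0 F p X).
      apply (is_derive_comp g (fun t : R => F (plus p (scal t X)))); auto.
      apply Derive_correct, smooth1_ex_derive, Hg.
    + intros X. apply Ck_mult; [apply (Ck_S_dirder n); assumption|].
      apply IH; [apply smooth1_Derive, Hg | apply Ck_pred, HF].
Qed.

Lemma smooth_continuous F p : smooth F -> continuous F p.
Proof. intros H. apply (Ck_continuous 0), H. Qed.

Lemma smooth_dirder F X : smooth F -> smooth (fun p => dirder F p X).
Proof. intros H n. apply (Ck_S_dirder n), H. Qed.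

Lemma smooth_is_derive F p X : smooth F ->
  is_derive (fun t : R => F (plus p (scal t X))) 0 (dirder F p X).
Proof. intros H. apply (Ck_S_dirder 0), H. Qed.

Lemma smooth_const c : smooth (fun _ : V => c).
Proof. intros n; apply Ck_const. Qed.

Lemma smooth_plus F G : smooth F -> smooth G -> smooth (fun p => F p + G p).
Proof. intros HF HG n; apply Ck_plus; auto. Qed.

Lemma smooth_mult F G : smooth F -> smooth G -> smooth (fun p => F p * G p).
Proof. intros HF HG n; apply Ck_mult; auto. Qed.

Lemma smooth_opp F : smooth F -> smooth (fun p => - F p).
Proof.
  intros HF. replace (fun p => - F p) with (fun p => -1 * F p).
  - apply smooth_mult; [apply smooth_const | exact HF].
  - apply functional_extensionality; intros; ring.
Qed.

Lemma smooth_minus F G : smooth F -> smooth G -> smooth (fun p => F p - G p).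
Proof. intros HF HG. apply smooth_plus; [|apply smooth_opp]; auto. Qed.

Lemma smooth_inv F : smooth F -> (forall p, F p <> 0) -> smooth (fun p => / F p).
Proof. intros HF Hn n; apply Ck_inv; auto. Qed.

Lemma smooth_comp_R g F : smooth1 g -> smooth F -> smooth (fun p => g (F p)).
Proof. intros Hg HF n; apply Ck_comp_R; auto. Qed.

Lemma dirder_plus F G p X : smooth F -> smooth G ->
  dirder (fun q => F q + G q) p X = dirder F p X + dirder G p X.
Proof.
  intros HF HG. apply is_derive_unique, is_derive_add; apply smooth_is_derive; assumption.
Qed.

Lemma dirder_minus F G p X : smooth F -> smooth G ->
  dirder (fun q => F q - G q) p X = dirder F p X - dirder G p X.
Proof.
  intros HF HG. apply is_derive_unique, is_derive_sub; apply smooth_is_derive; assumption.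
Qed.

Lemma dirder_mult F G p X : smooth F -> smooth G ->
  dirder (fun q => F q * G q) p X = dirder F p X * G p + F p * dirder G p X.
Proof.
  intros HF HG. rewrite <- (line_at_0 F p X), <- (line_at_0 G p X).
  apply is_derive_unique, is_derive_mul; apply smooth_is_derive; assumption.
Qed.

Lemma dirder_const (c : R) (p X : V) : dirder (fun _ : V => c) p X = 0.
Proof. exact (Derive_const c 0). Qed.

Lemma dirder_comp_R (g dg : R -> R) F p X : smooth F -> (forall t, is_derive g t (dg t)) ->
  dirder (fun q => g (F q)) p X = dirder F p X * dg (F p).
Proof.
  intros HF Hg. rewrite <- (line_at_0 F p X).
  apply is_derive_unique, (is_derive_comp g (fun t : R => F (plus p (scal t X)))); [apply Hg|].
  apply smooth_is_derive, HF.
Qed.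

Lemma dirder_inv F p X : smooth F -> F p <> 0 ->
  dirder (fun q => / F q) p X = - dirder F p X / F p ^ 2.
Proof.
  intros HF Hn. rewrite <- (line_at_0 F p X) in Hn |- *.
  apply is_derive_unique, is_derive_inv; [apply smooth_is_derive, HF | exact Hn].
Qed.

End Calculus.

Lemma smooth_id : smooth (V := R_NormedModule) (fun t => t).
Proof.
  intros n. apply Ck_linear; [intros; reflexivity | intros; apply continuous_id].
Qed.

(** On the line, directional smoothness and the existence of all iterated
    derivatives agree; this transfers the closure properties above to [smooth1]. *)
Lemma smooth1_iff (g : R -> R) : smooth1 g <-> smooth (V := R_NormedModule) g.
Proof.
  split; intros H.
  - apply (smooth_comp_R (V := R_NormedModule) g (fun x => x)); auto.
    apply smooth_id.
  - assert (Hd : forall h : R -> R, smooth (V := R_NormedModule) h ->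
        forall t, is_derive h t (dirder (V := R_NormedModule) h t 1)).
    { intros h Hh t.
      pose proof (smooth_is_derive (V := R_NormedModule) h t 1 Hh) as H1.
      apply (is_derive_ext (fun s : R => h (t + (s - t) * 1))).
      - intros s. f_equal. ring.
      - rewrite <- (Rmult_1_l (dirder _ _ _)).
        apply (is_derive_comp (fun s : R => h (t + s * 1)) (fun s => s - t)).
        + rewrite Rminus_diag. exact H1.
        + auto_derive; auto. }
    assert (Hn : forall n, smooth (V := R_NormedModule) (Derive_n g n)).
    { induction n as [|n IH]; [exact H|].
      replace (Derive_n g (S n)) with
        (fun t => dirder (V := R_NormedModule) (Derive_n g n) t 1);
        [apply smooth_dirder, IH|].
      apply functional_extensionality; intros t. symmetry.
      apply is_derive_unique, Hd, IH. }
    intros t n. destruct n as [|n]; [exact I|].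
    eexists. apply Hd, Hn.
Qed.

Lemma smooth1_of_Derive (g : R -> R) (dg : R -> R) :
  (forall t, is_derive g t (dg t)) -> smooth1 dg -> smooth1 g.
Proof.
  intros Hd Hs t n. destruct n as [|n]; [exact I|].
  assert (He : forall k r, Derive_n g (S k) r = Derive_n dg k r).
  { induction k as [|k IH]; intros r.
    - apply is_derive_unique, Hd.
    - apply Derive_ext, IH. }
  destruct n as [|n]; [eexists; apply Hd|].
  apply ex_derive_ext with (f := Derive_n dg n); [symmetry; apply He|].
  exact (Hs t (S n)).
Qed.

(** * Smooth functions of two variables *)

(* Equalities between values of smooth functions are often typed in a normed
   module, where [ring] does not see the field of real numbers. *)
Ltac real_eq := match goal with |- @eq _ ?a ?b => change (@eq R a b) end.

Lemma smooth1_continuous g : smooth1 g -> forall t, continuous g t.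
Proof.
  intros H t. apply (ex_derive_continuous (V := R_NormedModule)).
  apply smooth1_ex_derive, H.
Qed.

Lemma smooth_fst : smooth (fun p : R * R => fst p).
Proof.
  intros n. apply Ck_linear; [intros; reflexivity|].
  intros p. apply continuous_fst.
Qed.

Lemma smooth_snd : smooth (fun p : R * R => snd p).
Proof.
  intros n. apply Ck_linear; [intros; reflexivity|].
  intros p. apply continuous_snd.
Qed.

Notation pd1 F p := (dirder (V := prod_NormedModule R_AbsRing R_NormedModule R_NormedModule) F p (1, 0)).
Notation pd2 F p := (dirder (V := prod_NormedModule R_AbsRing R_NormedModule R_NormedModule) F p (0, 1)).

Lemma is_derive_pd1 (F : R * R -> R) x y : Ck 1 F ->
  is_derive (fun t => F (t, y)) x (pd1 F (x, y)).
Proof.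
  intros H. pose proof (proj1 (Ck_S_dirder 0 F H (1, 0)) (x, y)) as H1.
  apply (is_derive_ext (fun t => F (x + (t - x) * 1, y + (t - x) * 0))).
  - intros t. f_equal. apply injective_projections; simpl; ring.
  - rewrite <- (Rmult_1_l (pd1 F (x, y))).
    apply (is_derive_comp (fun s : R => F (x + s * 1, y + s * 0)) (fun t => t - x)).
    + rewrite Rminus_diag. exact H1.
    + auto_derive; auto.
Qed.

Lemma is_derive_pd2 (F : R * R -> R) x y : Ck 1 F ->
  is_derive (fun t => F (x, t)) y (pd2 F (x, y)).
Proof.
  intros H. pose proof (proj1 (Ck_S_dirder 0 F H (0, 1)) (x, y)) as H1.
  apply (is_derive_ext (fun t => F (x + (t - y) * 0, y + (t - y) * 1))).
  - intros t. f_equal. apply injective_projections; simpl; ring.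
  - rewrite <- (Rmult_1_l (pd2 F (x, y))).
    apply (is_derive_comp (fun s : R => F (x + s * 0, y + s * 1)) (fun t => t - y)).
    + rewrite Rminus_diag. exact H1.
    + auto_derive; auto.
Qed.

(** Directional derivatives alone give no chain rule along curves; the continuity of
    one partial derivative makes [F] differentiable. *)
Lemma is_derive_partials (F P Q : R * R -> R) :
  (forall x y, is_derive (fun t => F (t, y)) x (P (x, y))) ->
  (forall x y, is_derive (fun t => F (x, t)) y (Q (x, y))) ->
  (forall p, continuous P p) ->
  forall (c1 c2 : R -> R) t l1 l2, is_derive c1 t l1 -> is_derive c2 t l2 ->
  is_derive (fun s => F (c1 s, c2 s)) t (P (c1 t, c2 t) * l1 + Q (c1 t, c2 t) * l2).
Proof.
  intros HP HQ HPc c1 c2 t l1 l2 H1 H2.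
  apply is_derive_Reals.
  apply (derivable_pt_lim_comp_2d (fun x y => F (x, y)) c1 c2);
    try (apply is_derive_Reals; assumption).
  apply filterdiff_differentiable_pt_lim.
  eapply filterdiff_ext_lin.
  - apply (is_derive_filterdiff (fun x y => F (x, y)) (c1 t) (c2 t)
             (fun x y => P (x, y)) (Q (c1 t, c2 t))).
    + apply filter_forall. intros u. apply HP.
    + apply HQ.
    + apply (continuous_ext P); [intros []; reflexivity | apply HPc].
  - intros [u v]. reflexivity.
Qed.

Lemma is_derive_chain (F : R * R -> R) (c1 c2 : R -> R) t l1 l2 : Ck 1 F ->
  is_derive c1 t l1 -> is_derive c2 t l2 ->
  is_derive (fun s => F (c1 s, c2 s)) t
    (pd1 F (c1 t, c2 t) * l1 + pd2 F (c1 t, c2 t) * l2).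
Proof.
  intros H. apply (is_derive_partials F (fun p => pd1 F p) (fun p => pd2 F p)).
  - intros; apply is_derive_pd1, H.
  - intros; apply is_derive_pd2, H.
  - intros p. exact (Ck_continuous 0 _ (proj2 (Ck_S_dirder 0 F H (1, 0))) p).
Qed.

Lemma dirder_partials (F : R * R -> R) p X : smooth F ->
  dirder F p X = fst X * pd1 F p + snd X * pd2 F p.
Proof.
  intros H. destruct p as [x y], X as [a b]. apply is_derive_unique.
  replace (fst (a, b) * pd1 F (x, y) + snd (a, b) * pd2 F (x, y)) with
    (pd1 F (x + 0 * a, y + 0 * b) * a + pd2 F (x + 0 * a, y + 0 * b) * b).
  - apply (is_derive_chain F (fun t => x + t * a) (fun t => y + t * b)).
    + apply H.
    + auto_derive; auto; ring.
    + auto_derive; auto; ring.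
  - rewrite !Rmult_0_l, !Rplus_0_r. real_eq. simpl. ring.
Qed.

Lemma Ck_comp2 {V : NormedModule R_AbsRing} n : forall (F : R * R -> R) (h1 h2 : V -> R),
  Ck n F -> smooth h1 -> smooth h2 -> Ck n (fun p => F (h1 p, h2 p)).
Proof.
  induction n as [|n IH]; intros F h1 h2 HF H1 H2;
    assert (Hc : forall p, continuous (fun p => F (h1 p, h2 p)) p)
      by (intros p; apply (continuous_comp_2 h1 h2 (fun x y => F (x, y)));
          [ apply smooth_continuous, H1 | apply smooth_continuous, H2
          | apply (continuous_ext F); [intros []; reflexivity|];
            exact (Ck_continuous _ F HF (h1 p, h2 p)) ]).
  - apply Ck_0, Hc.
  - apply Ck_S with (dF := fun X p => pd1 F (h1 p, h2 p) * dirder h1 p X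
                                      + pd2 F (h1 p, h2 p) * dirder h2 p X); auto.
    + intros X p. rewrite <- (line_at_0 h1 p X), <- (line_at_0 h2 p X).
      apply (is_derive_chain F (fun t : R => h1 (plus p (scal t X)))
                               (fun t : R => h2 (plus p (scal t X)))).
      * clear -HF. induction n as [|n IH]; [exact HF|]. apply IH, Ck_pred, HF.
      * apply smooth_is_derive, H1.
      * apply smooth_is_derive, H2.
    + intros X. apply Ck_plus; apply Ck_mult.
      * apply (IH (fun q => pd1 F q)); auto. apply (Ck_S_dirder n), HF.
      * apply smooth_dirder, H1.
      * apply (IH (fun q => pd2 F q)); auto. apply (Ck_S_dirder n), HF.
      * apply smooth_dirder, H2.
Qed.

Lemma smooth_comp2 {V : NormedModule R_AbsRing} (F : R * R -> R) (h1 h2 : V -> R) :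
  smooth F -> smooth h1 -> smooth h2 -> smooth (fun p => F (h1 p, h2 p)).
Proof. intros HF H1 H2 n. apply Ck_comp2; auto. Qed.

Lemma dirder_comp2 {V : NormedModule R_AbsRing} (F : R * R -> R) (h1 h2 : V -> R) p X :
  smooth F -> smooth h1 -> smooth h2 ->
  dirder (fun p => F (h1 p, h2 p)) p X =
  pd1 F (h1 p, h2 p) * dirder h1 p X + pd2 F (h1 p, h2 p) * dirder h2 p X.
Proof.
  intros HF H1 H2. apply is_derive_unique.
  rewrite <- (line_at_0 h1 p X), <- (line_at_0 h2 p X).
  apply (is_derive_chain F (fun t : R => h1 (plus p (scal t X)))
                           (fun t : R => h2 (plus p (scal t X)))).
  - apply HF.
  - apply smooth_is_derive, H1.
  - apply smooth_is_derive, H2.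
Qed.

Lemma smooth_of_partials (F P Q : R * R -> R) : smooth P -> smooth Q ->
  (forall x y, is_derive (fun t => F (t, y)) x (P (x, y))) ->
  (forall x y, is_derive (fun t => F (x, t)) y (Q (x, y))) ->
  smooth F /\ (forall p, pd1 F p = P p) /\ (forall p, pd2 F p = Q p).
Proof.
  intros HP HQ Hx Hy.
  assert (Hl : forall a b x y : R, is_derive (fun t : R => F (x + t * a, y + t * b)) 0
                             (P (x, y) * a + Q (x, y) * b)).
  { intros a b x y.
    replace (x, y) with (x + 0 * a, y + 0 * b) by (f_equal; ring).
    apply (is_derive_partials F P Q Hx Hy (fun p => smooth_continuous P p HP)
             (fun t => x + t * a) (fun t => y + t * b)); auto_derive; auto; ring. }
  assert (Hd : forall X p, is_derive (fun t : R => F (plus p (scal t X))) 0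
                             (P p * fst X + Q p * snd X))
    by (intros [a b] [x y]; apply Hl).
  split; [|split].
  - assert (Hc : forall p, continuous F p).
    { intros [x y].
      assert (D : differentiable_pt_lim (fun x y => F (x, y)) x y (P (x, y)) (Q (x, y))).
      { apply filterdiff_differentiable_pt_lim. eapply filterdiff_ext_lin.
        - apply (is_derive_filterdiff (fun x y => F (x, y)) x y
             (fun x y => P (x, y)) (Q (x, y))).
          + apply filter_forall. intros u. apply Hx.
          + apply Hy.
          + apply (continuous_ext P); [intros []; reflexivity|].
            exact (smooth_continuous P (x, y) HP).
        - intros [u v]. reflexivity. }
      apply filterdiff_differentiable_pt_lim in D.
      apply (continuous_ext (fun u : R * R => F (fst u, snd u))); [intros []; reflexivity|].
      apply (filterdiff_continuous _ _ (ex_intro _ _ D)). }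
    intros n. destruct n as [|n]; [apply Ck_0, Hc|].
    apply Ck_S with (dF := fun X p => P p * fst X + Q p * snd X); auto.
    intros X. apply Ck_plus; apply Ck_mult; auto; apply Ck_const.
  - intros p. etransitivity; [apply is_derive_unique, Hd | real_eq; simpl; ring].
  - intros p. etransitivity; [apply is_derive_unique, Hd | real_eq; simpl; ring].
Qed.

Lemma smooth_slice_x (F : R * R -> R) y : smooth F -> smooth1 (fun t => F (t, y)).
Proof.
  intros H. apply smooth1_iff.
  apply (smooth_comp2 F (fun t => t) (fun _ => y)); auto.
  - apply smooth_id.
  - apply smooth_const.
Qed.

Lemma smooth_slice_y (F : R * R -> R) x : smooth F -> smooth1 (fun t => F (x, t)).
Proof.
  intros H. apply smooth1_iff.
  apply (smooth_comp2 F (fun _ => x) (fun t => t)); auto.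
  - apply smooth_const.
  - apply smooth_id.
Qed.

Lemma continuous_continuity_2d (F : R * R -> R) x y :
  continuous F (x, y) -> continuity_2d_pt (fun u v => F (u, v)) x y.
Proof.
  intros H. apply continuity_2d_pt_filterlim.
  eapply filterlim_ext; [|exact H]. intros []; reflexivity.
Qed.

Lemma smooth_schwarz (F : R * R -> R) p : smooth F ->
  pd1 (fun q => pd2 F q) p = pd2 (fun q => pd1 F q) p.
Proof.
  intros H. destruct p as [x y].
  assert (Hx : smooth (fun q => pd1 F q)) by apply smooth_dirder, H.
  assert (Hy : smooth (fun q => pd2 F q)) by apply smooth_dirder, H.
  assert (EX : forall u v, Derive (fun t => F (t, v)) u = pd1 F (u, v))
    by (intros; apply is_derive_unique, is_derive_pd1, H).
  assert (EY : forall u v, Derive (fun t => F (u, t)) v = pd2 F (u, v))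
    by (intros; apply is_derive_unique, is_derive_pd2, H).
  assert (Exy : forall u v, is_derive (fun z => Derive (fun t => F (z, t)) v) u
                  (pd1 (fun q => pd2 F q) (u, v))).
  { intros u v. apply (is_derive_ext (fun z => pd2 F (z, v)));
      [intros; symmetry; apply EY|]. apply (is_derive_pd1 (fun q => pd2 F q)), Hy. }
  assert (Eyx : forall u v, is_derive (fun z => Derive (fun t => F (t, z)) u) v
                  (pd2 (fun q => pd1 F q) (u, v))).
  { intros u v. apply (is_derive_ext (fun z => pd1 F (u, z)));
      [intros; symmetry; apply EX|]. apply (is_derive_pd2 (fun q => pd1 F q)), Hx. }
  etransitivity; [symmetry; exact (is_derive_unique _ _ _ (Exy x y))|].
  etransitivity; [|exact (is_derive_unique _ _ _ (Eyx x y))].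
  apply (Schwarz (fun u v => F (u, v))).
  - exists (mkposreal 1 Rlt_0_1). intros u v _ _. repeat split.
    + eexists; apply is_derive_pd1, H.
    + eexists; apply is_derive_pd2, H.
    + eexists; apply Exy.
    + eexists; apply Eyx.
  - apply (continuity_2d_pt_ext (fun u v => pd1 (fun q => pd2 F q) (u, v))).
    + intros u v. symmetry. apply is_derive_unique, Exy.
    + apply (continuous_continuity_2d (fun q => pd1 (fun q => pd2 F q) q)).
      exact (smooth_continuous _ (x, y) (smooth_dirder _ _ Hy)).
  - apply (continuity_2d_pt_ext (fun u v => pd2 (fun q => pd1 F q) (u, v))).
    + intros u v. symmetry. apply is_derive_unique, Eyx.
    + apply (continuous_continuity_2d (fun q => pd2 (fun q => pd1 F q) q)).
      exact (smooth_continuous _ (x, y) (smooth_dirder _ _ Hx)).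
Qed.

Lemma pd1_unique (F : R * R -> R) x y l : smooth F ->
  is_derive (fun t => F (t, y)) x l -> pd1 F (x, y) = l.
Proof.
  intros HF H. rewrite <- (is_derive_unique _ _ _ H). symmetry.
  apply is_derive_unique, is_derive_pd1, HF.
Qed.

Lemma pd2_unique (F : R * R -> R) x y l : smooth F ->
  is_derive (fun t => F (x, t)) y l -> pd2 F (x, y) = l.
Proof.
  intros HF H. rewrite <- (is_derive_unique _ _ _ H). symmetry.
  apply is_derive_unique, is_derive_pd2, HF.
Qed.

(** * Estimates, potentials and integral curves *)

Lemma derive0_const (f : R -> R) : (forall t, is_derive f t 0) -> forall a b, f a = f b.
Proof.
  intros H.
  assert (Hlt : forall a b, a < b -> f a = f b)
    by (intros a b Hab; apply (eq_is_derive f a b); auto).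
  intros a b. destruct (Rtotal_order a b) as [Hab|[->|Hab]]; auto.
  symmetry; auto.
Qed.

Lemma MVT_bound (f df : R -> R) M a b :
  (forall t, Rmin a b <= t <= Rmax a b -> is_derive f t (df t)) ->
  (forall t, Rmin a b <= t <= Rmax a b -> Rabs (df t) <= M) ->
  Rabs (f b - f a) <= M * Rabs (b - a).
Proof.
  intros Hd Hb.
  destruct (MVT_gen f a b df) as [c [Hc ->]].
  - intros x Hx. apply Hd; lra.
  - intros x Hx. apply continuity_pt_filterlim.
    apply (ex_derive_continuous (V := R_NormedModule)). eexists; apply Hd, Hx.
  - rewrite Rabs_mult. apply Rmult_le_compat_r; [apply Rabs_pos|]. auto.
Qed.

(** Weighting by an exponential makes integration a contraction; iterating this
    bound replaces Gronwall's inequality in all uniqueness arguments below. *)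
Lemma exp_growth (f df : R -> R) K c a : 0 < c -> f 0 = 0 ->
  (forall s, Rabs s <= a -> is_derive f s (df s)) ->
  (forall s, Rabs s <= a -> Rabs (df s) <= K * exp (c * Rabs s)) ->
  forall t, Rabs t <= a -> Rabs (f t) <= K / c * exp (c * Rabs t).
Proof.
  intros Hc H0 Hd Hb t Ht.
  assert (HK : 0 <= K).
  { pose proof (Hb 0) as H. rewrite Rabs_R0, Rmult_0_r, exp_0, Rmult_1_r in H.
    pose proof (Rabs_pos (df 0)). pose proof (Rabs_pos t). lra. }
  assert (Hhalf : forall (g dg : R -> R), g 0 = 0 ->
    (forall s, 0 <= s <= Rabs t -> is_derive g s (dg s)) ->
    (forall s, 0 <= s <= Rabs t -> dg s <= K * exp (c * s)) ->
    g (Rabs t) <= K / c * exp (c * Rabs t)).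
  { intros g dg G0 Gd Gb.
    pose proof (Rabs_pos t) as Hp.
    assert (Gdd : forall x, 0 <= x <= Rabs t ->
      is_derive (fun s => K / c * exp (c * s) - g s) x (K * exp (c * x) - dg x)).
    { intros x Hx.
      apply (is_derive_minus (V := R_NormedModule) (fun s => K / c * exp (c * s)) g).
      - auto_derive; auto. field. lra.
      - apply Gd; lra. }
    destruct (MVT_gen (fun s => K / c * exp (c * s) - g s) 0 (Rabs t)
                (fun s => K * exp (c * s) - dg s)) as [z [Hz Heq]];
      rewrite ?Rmin_left, ?Rmax_right in * by lra.
    - intros x Hx. apply Gdd; lra.
    - intros x Hx. apply continuity_pt_filterlim.
      exact (ex_derive_continuous (V := R_NormedModule) _ x (ex_intro _ _ (Gdd x Hx))).
    - pose proof (Gb z Hz) as Hbz.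
      rewrite Rmult_0_r, exp_0, G0 in Heq.
      assert (0 <= K / c) by (apply Rdiv_le_0_compat; lra).
      assert (0 <= (K * exp (c * z) - dg z) * (Rabs t - 0))
        by (apply Rmult_le_pos; lra).
      lra. }
  assert (Hs : forall sg, Rabs sg = 1 -> sg * f t <= K / c * exp (c * Rabs t)).
  { intros sg Hsg.
    assert (Hsg2 : forall s, 0 <= s <= Rabs t -> forall e, Rabs e = 1 -> Rabs (e * s) = s).
    { intros s Hs e He. rewrite Rabs_mult, He, Rabs_pos_eq; lra. }
    assert (Hex : exists e, Rabs e = 1 /\ t = e * Rabs t).
    { destruct (Rle_dec 0 t).
      - exists 1. rewrite (Rabs_pos_eq t), Rabs_R1 by lra. lra.
      - exists (-1). rewrite (Rabs_left t), Rabs_left by lra. lra. }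
    destruct Hex as [e [He Hte]]. rewrite Hte at 1.
    apply (Hhalf (fun s => sg * f (e * s)) (fun s => sg * (e * df (e * s)))).
    - rewrite Rmult_0_r, H0. ring.
    - intros s Hs. apply (is_derive_scal (fun s => f (e * s))).
      apply (is_derive_comp f (fun s => e * s)).
      + apply Hd. rewrite Hsg2; lra.
      + auto_derive; auto. ring.
    - intros s Hs. eapply Rle_trans; [apply Rle_abs|].
      rewrite !Rabs_mult, Hsg, He, !Rmult_1_l.
      rewrite <- (Hsg2 s Hs e He) at 2. apply Hb. rewrite Hsg2; lra. }
  apply Rabs_le. split.
  - assert (H : Rabs (-1) = 1) by (rewrite Rabs_left; lra). pose proof (Hs (-1) H). lra.
  - pose proof (Hs 1 Rabs_R1). lra.
Qed.

Lemma exp_ge_1 x : 0 <= x -> 1 <= exp x.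
Proof.
  intros [H|<-]; [|rewrite exp_0; lra].
  rewrite <- exp_0. apply Rlt_le, exp_increasing, H.
Qed.

Lemma pow_half_pos n : 0 < (1 / 2) ^ n.
Proof. apply pow_lt; lra. Qed.

Lemma le_pow_half_zero x K : (forall n, Rabs x <= K * (1 / 2) ^ n) -> x = 0.
Proof.
  intros H.
  assert (Hl : is_lim_seq (fun n => K * (1 / 2) ^ n) 0).
  { replace (Finite 0) with (Rbar_mult K 0) by (simpl; f_equal; ring).
    apply is_lim_seq_scal_l, is_lim_seq_geom. rewrite Rabs_pos_eq; lra. }
  assert (Hx : Rbar_le (Rabs x) 0)
    by (apply (is_lim_seq_le (fun _ => Rabs x) _ _ _ H); [apply is_lim_seq_const | exact Hl]).
  simpl in Hx. pose proof (Rabs_pos x). apply Rabs_eq_0. lra.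
Qed.

(** A square is crossed from its center in finitely many steps, each of which changes
    [F] by at most 1 by uniform continuity. *)
Lemma bounded_square (F : R * R -> R) a : (forall p, continuous F p) ->
  exists M, 0 <= M /\ forall x y, Rabs x <= a -> Rabs y <= a -> Rabs (F (x, y)) <= M.
Proof.
  intros Hc.
  destruct (uniform_continuity_2d (fun x y => F (x, y)) (- a) a (- a) a
              (fun x y _ _ => continuous_continuity_2d F x y (Hc (x, y)))
              (mkposreal 1 Rlt_0_1)) as [d Hd]. simpl in Hd.
  destruct (nfloor_ex (Rmax a 0 / d)) as [n [_ Hn]].
  { apply Rdiv_le_0_compat; [apply Rmax_r | apply cond_pos]. }
  pose proof (cond_pos d) as Hdp.
  set (N := INR n + 1) in *.
  assert (HN : 0 < N) by (pose proof (pos_INR n); unfold N; lra).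
  assert (HaN : Rmax a 0 / N < d).
  { apply (Rmult_lt_reg_r N); auto. apply (Rmult_lt_reg_r (/ d)); [apply Rinv_0_lt_compat; auto|].
    replace (Rmax a 0 / N * N * / d) with (Rmax a 0 / d) by (field; lra).
    replace (d * N * / d) with N by (field; lra). exact Hn. }
  exists (Rabs (F (0, 0)) + N). split; [pose proof (Rabs_pos (F (0, 0))); lra|].
  intros x y Hx Hy.
  assert (Ha : 0 <= a) by (pose proof (Rabs_pos x); lra).
  rewrite Rmax_left in HaN by auto.
  assert (Hk : forall k, (k <= S n)%nat ->
     Rabs (F (INR k / N * x, INR k / N * y)) <= Rabs (F (0, 0)) + INR k).
  { induction k as [|k IH]; intros Hk.
    - simpl. unfold Rdiv. rewrite !Rmult_0_l. lra.
    - assert (Hr : forall j, (j <= S n)%nat -> 0 <= INR j / N <= 1).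
      { intros j Hj. apply le_INR in Hj. rewrite S_INR in Hj. fold N in Hj.
        pose proof (pos_INR j). split.
        - apply Rdiv_le_0_compat; auto.
        - apply (Rmult_le_reg_r N); auto. unfold Rdiv.
          rewrite Rmult_assoc, Rinv_l by lra. lra. }
      assert (Hin : forall j z, (j <= S n)%nat -> Rabs z <= a -> - a <= INR j / N * z <= a).
      { intros j z Hj Hz. apply Rabs_le_between. rewrite Rabs_mult.
        pose proof (Hr j Hj). rewrite (Rabs_pos_eq (INR j / N)) by lra.
        pose proof (Rabs_pos z). nra. }
      assert (Hst : forall z, Rabs z <= a -> Rabs (INR (S k) / N * z - INR k / N * z) < d).
      { intros z Hz. rewrite S_INR.
        replace ((INR k + 1) / N * z - INR k / N * z) with (z / N) by (field; lra).
        unfold Rdiv. rewrite Rabs_mult, (Rabs_pos_eq (/ N)) by (apply Rlt_le, Rinv_0_lt_compat; auto).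
        apply Rle_lt_trans with (2 := HaN). apply Rmult_le_compat_r; auto.
        apply Rlt_le, Rinv_0_lt_compat; auto. }
      pose proof (Hd (INR k / N * x) (INR k / N * y) (INR (S k) / N * x) (INR (S k) / N * y)
        (Hin k x ltac:(lia) Hx) (Hin k y ltac:(lia) Hy) (Hin (S k) x Hk Hx) (Hin (S k) y Hk Hy)
        (Hst x Hx) (Hst y Hy)) as Hstep.
      specialize (IH ltac:(lia)).
      pose proof (Rabs_triang (F (INR (S k) / N * x, INR (S k) / N * y) - F (INR k / N * x, INR k / N * y))
                              (F (INR k / N * x, INR k / N * y))) as Ht.
      replace (F (INR (S k) / N * x, INR (S k) / N * y) - F (INR k / N * x, INR k / N * y)
                 + F (INR k / N * x, INR k / N * y))
        with (F (INR (S k) / N * x, INR (S k) / N * y)) in Ht by ring.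
      rewrite (S_INR k) at 3. lra. }
  specialize (Hk (S n) (le_n _)). rewrite S_INR in Hk. fold N in Hk.
  replace (N / N * x) with x in Hk by (field; lra).
  replace (N / N * y) with y in Hk by (field; lra). exact Hk.
Qed.

Lemma bounded_square_list (l : list (R * R -> R)) a :
  (forall F, List.In F l -> forall p, continuous F p) ->
  exists M, 0 < M /\ forall F, List.In F l -> forall x y, Rabs x <= a -> Rabs y <= a ->
    Rabs (F (x, y)) <= M.
Proof.
  induction l as [|F l IH]; intros Hc.
  - exists 1. split; [lra | intros F []].
  - destruct IH as [M [HM H]]; [intros G HG; apply Hc; right; exact HG|].
    destruct (bounded_square F a (Hc F (or_introl eq_refl))) as [M' [HM' H']].
    exists (M + M'). split; [lra|]. intros G [<-|HG] x y Hx Hy.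
    + specialize (H' x y Hx Hy). lra.
    + specialize (H G HG x y Hx Hy). lra.
Qed.

Lemma bounded_interval (f : R -> R) : (forall t, continuous f t) ->
  exists M, 0 <= M /\ forall t, Rabs t <= 1 -> Rabs (f t) <= M.
Proof.
  intros Hf. destruct (bounded_square (fun p => f (fst p)) 1) as [M [HM H]].
  - intros [t t']. apply (continuous_comp (fun p : R * R => fst p) f); [apply continuous_fst | apply Hf].
  - exists M. split; [exact HM|]. intros t Ht. apply (H t 0 Ht). rewrite Rabs_R0. lra.
Qed.

Lemma smooth_lipschitz_square (F : R * R -> R) a : smooth F ->
  exists L, 0 <= L /\ forall x y x' y', Rabs x <= a -> Rabs y <= a ->
    Rabs x' <= a -> Rabs y' <= a ->
    Rabs (F (x, y) - F (x', y')) <= L * (Rabs (x - x') + Rabs (y - y')).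
Proof.
  intros HF.
  destruct (bounded_square (fun p => pd1 F p) a) as [M1 [HM1 H1]];
    [intros p; exact (smooth_continuous _ p (smooth_dirder F (1, 0) HF))|].
  destruct (bounded_square (fun p => pd2 F p) a) as [M2 [HM2 H2]];
    [intros p; exact (smooth_continuous _ p (smooth_dirder F (0, 1) HF))|].
  exists (M1 + M2). split; [lra|]. intros x y x' y' Hx Hy Hx' Hy'.
  set (df := fun t => pd1 F (x' + t * (x - x'), y' + t * (y - y')) * (x - x')
                      + pd2 F (x' + t * (x - x'), y' + t * (y - y')) * (y - y')).
  assert (Hin : forall z z' t, Rabs z <= a -> Rabs z' <= a -> 0 <= t <= 1 ->
            Rabs (z' + t * (z - z')) <= a).
  { intros z z' t Hz Hz' Ht. apply Rabs_le_between in Hz. apply Rabs_le_between in Hz'.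
    apply Rabs_le. nra. }
  pose proof (MVT_bound (fun t => F (x' + t * (x - x'), y' + t * (y - y'))) df
     ((M1 + M2) * (Rabs (x - x') + Rabs (y - y'))) 0 1) as H.
  rewrite Rmin_left, Rmax_right in H by lra.
  replace (x' + 1 * (x - x')) with x in H by ring.
  replace (y' + 1 * (y - y')) with y in H by ring.
  replace (x' + 0 * (x - x')) with x' in H by ring.
  replace (y' + 0 * (y - y')) with y' in H by ring.
  rewrite Rminus_0_r, Rabs_R1, Rmult_1_r in H. apply H.
  - intros t _. apply (is_derive_chain F (fun t => x' + t * (x - x')) (fun t => y' + t * (y - y'))).
    + apply HF.
    + auto_derive; auto; ring.
    + auto_derive; auto; ring.
  - intros t Ht. unfold df.
    pose proof (H1 (x' + t * (x - x')) (y' + t * (y - y')) (Hin _ _ _ Hx Hx' Ht) (Hin _ _ _ Hy Hy' Ht)).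
    pose proof (H2 (x' + t * (x - x')) (y' + t * (y - y')) (Hin _ _ _ Hx Hx' Ht) (Hin _ _ _ Hy Hy' Ht)).
    eapply Rle_trans; [apply Rabs_triang|]. rewrite !Rabs_mult.
    pose proof (Rabs_pos (x - x')). pose proof (Rabs_pos (y - y')).
    cbv beta in *. nra.
Qed.

Lemma is_derive_RInt_continuous (f : R -> R) : (forall t, continuous f t) ->
  forall t, is_derive (fun s => RInt f 0 s) t (f t).
Proof.
  intros Hc t. apply (is_derive_RInt (V := R_NormedModule) f _ 0).
  - apply filter_forall. intros b. apply (RInt_correct (V := R_CompleteNormedModule)).
    apply (ex_RInt_continuous (V := R_CompleteNormedModule)). intros; apply Hc.
  - apply Hc.
Qed.

Lemma RInt_start (f : R -> R) : RInt f 0 0 = 0.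
Proof. exact (RInt_point 0 f). Qed.

Lemma RInt_from_0 (f g : R -> R) : g 0 = 0 -> (forall t, continuous f t) ->
  (forall t, is_derive g t (f t)) -> forall t, RInt f 0 t = g t.
Proof.
  intros Hg Hc Hd t. apply Rminus_diag_uniq.
  rewrite (derive0_const (fun t => RInt f 0 t - g t)) with (b := 0).
  - rewrite RInt_start, Hg. ring.
  - intros s. eapply is_derive_eq; [apply is_derive_sub; [|apply Hd]|apply Rminus_diag].
    apply is_derive_RInt_continuous, Hc.
Qed.

(** A closed form [P dx + Q dy] is integrated along the x-axis and then
    vertically; closedness enters when differentiating under the integral. *)
Lemma poincare (P Q : R * R -> R) : smooth P -> smooth Q ->
  (forall p, pd2 P p = pd1 Q p) ->
  exists U : R * R -> R, smooth U /\ U (0, 0) = 0 /\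
    (forall p, pd1 U p = P p) /\ (forall p, pd2 U p = Q p).
Proof.
  intros HP HQ Hcl.
  set (U := fun p : R * R => RInt (fun t => P (t, 0)) 0 (fst p)
                             + RInt (fun t => Q (fst p, t)) 0 (snd p)).
  assert (HPc : forall y t, continuous (fun t => P (t, y)) t)
    by (intros; apply smooth1_continuous, smooth_slice_x, HP).
  assert (HPcy : forall x t, continuous (fun t => P (x, t)) t)
    by (intros; apply smooth1_continuous, smooth_slice_y, HP).
  assert (HQc : forall x t, continuous (fun t => Q (x, t)) t)
    by (intros; apply smooth1_continuous, smooth_slice_y, HQ).
  assert (EQ : forall x t, is_derive (fun u => Q (u, t)) x (pd1 Q (x, t)))
    by (intros; apply is_derive_pd1, HQ).
  destruct (smooth_of_partials U P Q HP HQ) as [HU [HUx HUy]].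
  - intros x y. unfold U; simpl.
    apply (is_derive_eq _ x (P (x, 0) + RInt (fun t => Derive (fun u => Q (u, t)) x) 0 y)).
    + apply (is_derive_add (fun x => RInt (fun t => P (t, 0)) 0 x)
               (fun x => RInt (fun t => Q (x, t)) 0 y)).
      * apply (is_derive_RInt_continuous (fun t => P (t, 0))), HPc.
      * apply (is_derive_RInt_param (fun x t => Q (x, t))).
        -- apply filter_forall. intros u t _. eexists; apply EQ.
        -- intros t _. apply (continuity_2d_pt_ext (fun u v => pd1 Q (u, v))).
           ++ intros u v. symmetry. apply is_derive_unique, EQ.
           ++ apply (continuous_continuity_2d (fun q => pd1 Q q)).
              exact (smooth_continuous _ (x, t) (smooth_dirder Q (1, 0) HQ)).
        -- apply filter_forall. intros u.
           apply (ex_RInt_continuous (V := R_CompleteNormedModule)). intros; apply HQc.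
    + rewrite (RInt_ext _ (Derive (fun t => P (x, t)))).
      * rewrite (RInt_Derive (fun t => P (x, t))).
        -- apply Rplus_minus.
        -- intros; eexists; apply is_derive_pd2, HP.
        -- intros z _. apply smooth1_continuous, smooth1_Derive, smooth_slice_y, HP.
      * intros t _. etransitivity; [apply is_derive_unique, EQ|]. rewrite <- Hcl.
        symmetry. apply is_derive_unique, is_derive_pd2, HP.
  - intros x y. unfold U; simpl.
    apply (is_derive_eq _ y (0 + Q (x, y))); [|apply Rplus_0_l].
    apply (is_derive_add (fun _ => RInt (fun t => P (t, 0)) 0 x)
               (fun y => RInt (fun t => Q (x, t)) 0 y)).
    + apply is_derive_cst.
    + apply (is_derive_RInt_continuous (fun t => Q (x, t))), HQc.
  - exists U. split; [exact HU|]. split; [|auto].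
    unfold U; simpl. rewrite !RInt_start. ring.
Qed.

Lemma geometric_limit (u : nat -> R) K :
  (forall n, Rabs (u (S n) - u n) <= K * (1 / 2) ^ n) ->
  forall n, Rabs (real (Lim_seq u) - u n) <= 2 * K * (1 / 2) ^ n.
Proof.
  intros H.
  assert (Hk : forall n k, Rabs (u (n + k)%nat - u n) <= 2 * K * (1 / 2) ^ n * (1 - (1 / 2) ^ k)).
  { intros n; induction k as [|k IH].
    - rewrite Nat.add_0_r, Rminus_diag, Rabs_R0. simpl. lra.
    - replace (u (n + S k)%nat - u n)
        with ((u (S (n + k)) - u (n + k)%nat) + (u (n + k)%nat - u n))
        by (rewrite Nat.add_succ_r; ring).
      eapply Rle_trans; [apply Rabs_triang|].
      pose proof (H (n + k)%nat) as H1. rewrite pow_add in H1. simpl. lra. }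
  assert (HK : 0 <= K).
  { pose proof (H 0%nat). pose proof (Rabs_pos (u 1%nat - u 0%nat)). simpl in *. lra. }
  assert (Hb : forall n k, Rabs (u (n + k)%nat - u n) <= 2 * K * (1 / 2) ^ n).
  { intros n k. eapply Rle_trans; [apply Hk|].
    pose proof (pow_half_pos n). pose proof (pow_half_pos k).
    assert (0 <= 2 * K * (1 / 2) ^ n) by nra. nra. }
  assert (Hex : ex_finite_lim_seq u).
  { apply ex_lim_seq_cauchy_corr. intros eps.
    assert (Hl : is_lim_seq (fun n => 4 * K * (1 / 2) ^ n) 0).
    { replace (Finite 0) with (Rbar_mult (4 * K) 0) by (simpl; f_equal; ring).
      apply is_lim_seq_scal_l, is_lim_seq_geom. rewrite Rabs_pos_eq; lra. }
    destruct (proj2 (is_lim_seq_spec _ _) Hl eps) as [N HN].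
    exists N. intros n m Hn Hm.
    specialize (HN N (le_n _)). rewrite Rminus_0_r in HN.
    apply Rle_lt_trans with (2 := Rle_lt_trans _ _ _ (Rle_abs _) HN).
    replace (u n - u m) with ((u n - u N) - (u m - u N)) by ring.
    eapply Rle_trans; [apply Rabs_triang|]. rewrite Rabs_Ropp.
    replace n with (N + (n - N))%nat by lia. replace m with (N + (m - N))%nat by lia.
    pose proof (Hb N (n - N)%nat). pose proof (Hb N (m - N)%nat). lra. }
  intros n. destruct Hex as [l Hl]. rewrite (is_lim_seq_unique _ _ Hl). simpl.
  assert (Hle : Rbar_le (Rabs (l - u n)) (2 * K * (1 / 2) ^ n)); [|exact Hle].
  apply (is_lim_seq_le (fun k => Rabs (u (k + n)%nat - u n)) (fun _ => 2 * K * (1 / 2) ^ n)).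
  - intros k. rewrite Nat.add_comm. apply Hb.
  - apply (is_lim_seq_abs (fun k => u (k + n)%nat - u n) (l - u n)).
    apply (is_lim_seq_minus' (fun k => u (k + n)%nat) (fun _ => u n)).
    + apply is_lim_seq_incr_n, Hl.
    + apply is_lim_seq_const.
  - apply is_lim_seq_const.
Qed.

Lemma continuous_along F (c1 c2 : R -> R) t : smooth F ->
  continuous c1 t -> continuous c2 t -> continuous (fun s => F (c1 s, c2 s)) t.
Proof.
  intros HF H1 H2. apply (continuous_comp_2 c1 c2 (fun x y => F (x, y))); auto.
  apply (continuous_ext F); [intros []; reflexivity|].
  exact (smooth_continuous F (c1 t, c2 t) HF).
Qed.

Lemma lipschitz1_continuous (f : R -> R) :
  (forall s t, Rabs (f t - f s) <= Rabs (t - s)) -> forall t, continuous f t.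
Proof.
  intros H t. apply continuity_pt_filterlim. intros eps He. exists eps. split; auto.
  intros x [_ Hx]. simpl in *. unfold Rdist in *.
  apply Rle_lt_trans with (2 := Hx). apply H.
Qed.

(** Picard iteration. A bounded field keeps all iterates in the square of side
    [2 |t|], so they converge on every compact interval without continuation.
    Booleans index the two coordinates, which are always treated alike. *)
Section IntegralCurve.
Variable X : bool -> R * R -> R.
Hypothesis HX : forall b, smooth (X b).
Hypothesis BX : forall b p, Rabs (X b p) <= 1.

Fixpoint picard (n : nat) (b : bool) (t : R) : R :=
  match n with
  | O => 0
  | S m => RInt (fun s => X b (picard m true s, picard m false s)) 0 t
  end.

Notation point c s := (c true s, c false s).

Lemma picard_lipschitz n b s t : Rabs (picard n b t - picard n b s) <= Rabs (t - s).
Proof.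
  revert b s t. induction n as [|n IH]; intros b s t; simpl.
  - rewrite Rminus_diag, Rabs_R0. apply Rabs_pos.
  - rewrite <- (Rmult_1_l (Rabs (t - s))).
    apply (MVT_bound (fun t => RInt _ 0 t) (fun t => X b (point (picard n) t))); auto.
    intros r _. apply (is_derive_RInt_continuous (fun s => X b (point (picard n) s))).
    intros; apply continuous_along; auto; apply lipschitz1_continuous, IH.
Qed.

Lemma picard_derive n b t : is_derive (picard (S n) b) t (X b (point (picard n) t)).
Proof.
  apply (is_derive_RInt_continuous (fun s => X b (point (picard n) s))).
  intros; apply continuous_along; auto; apply lipschitz1_continuous, picard_lipschitz.
Qed.

Lemma picard_0 n b : picard n b 0 = 0.
Proof. destruct n; [reflexivity | apply RInt_start]. Qed.

Lemma picard_bound n b t : Rabs (picard n b t) <= Rabs t.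
Proof.
  pose proof (picard_lipschitz n b 0 t) as H. rewrite picard_0, !Rminus_0_r in H. exact H.
Qed.

Lemma field_lipschitz a : exists L, 0 < L /\ forall b (c d : bool -> R),
    (forall b, Rabs (c b) <= a) -> (forall b, Rabs (d b) <= a) ->
    Rabs (X b (c true, c false) - X b (d true, d false))
      <= L * (Rabs (c true - d true) + Rabs (c false - d false)).
Proof.
  destruct (smooth_lipschitz_square (X true) a (HX true)) as [L1 [HL1 H1]].
  destruct (smooth_lipschitz_square (X false) a (HX false)) as [L2 [HL2 H2]].
  exists (L1 + L2 + 1). split; [lra|]. intros b c d Hc Hd.
  pose proof (Rabs_pos (c true - d true)). pose proof (Rabs_pos (c false - d false)).
  destruct b; [eapply Rle_trans; [apply H1; auto|] | eapply Rle_trans; [apply H2; auto|]];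
    apply Rmult_le_compat_r; lra.
Qed.

Lemma picard_cauchy a : 0 <= a -> exists K, forall n b t, Rabs t <= a ->
  Rabs (picard (S n) b t - picard n b t) <= K * (1 / 2) ^ n.
Proof.
  intros Ha. destruct (field_lipschitz a) as [L [HL Hlip]].
  (* With this weight, integrating the Lipschitz bound halves the error. *)
  set (c := 4 * L).
  assert (Hc : 0 < c) by (unfold c; lra).
  assert (Hin : forall k s, Rabs s <= a -> forall b, Rabs (picard k b s) <= a)
    by (intros k s Hs b; pose proof (picard_bound k b s); lra).
  assert (H : forall n b t, Rabs t <= a ->
    Rabs (picard (S n) b t - picard n b t) <= a * (1 / 2) ^ n * exp (c * Rabs t)).
  { induction n as [|n IH]; intros b t Ht.
    - pose proof (picard_bound 1 b t).
      assert (1 <= exp (c * Rabs t)) by (apply exp_ge_1, Rmult_le_pos; [lra | apply Rabs_pos]).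
      change (picard 0 b t) with 0. rewrite Rminus_0_r. simpl pow. nra.
    - replace (a * (1 / 2) ^ S n) with (2 * L * a * (1 / 2) ^ n / c)
        by (unfold c; simpl; field; lra).
      apply (exp_growth (fun t => picard (S (S n)) b t - picard (S n) b t)
           (fun s => X b (point (picard (S n)) s) - X b (point (picard n) s))) with (a := a); auto.
      + rewrite !picard_0. ring.
      + intros s _. exact (is_derive_sub _ _ s _ _ (picard_derive (S n) b s) (picard_derive n b s)).
      + intros s Hs. pose proof (IH true s Hs). pose proof (IH false s Hs).
        eapply Rle_trans.
        * exact (Hlip b (fun b => picard (S n) b s) (fun b => picard n b s)
                   (Hin (S n) s Hs) (Hin n s Hs)).
        * apply Rle_trans with (L * (2 * (a * (1 / 2) ^ n * exp (c * Rabs s))));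
            [apply Rmult_le_compat_l; lra | lra]. }
  exists (a * exp (c * a)). intros n b t Ht. eapply Rle_trans; [apply H, Ht|].
  assert (He : exp (c * Rabs t) <= exp (c * a)).
  { destruct (Rle_lt_or_eq_dec _ _ Ht) as [Hlt| ->]; [|lra].
    apply Rlt_le, exp_increasing. nra. }
  pose proof (pow_half_pos n). assert (0 <= a * (1 / 2) ^ n) by nra. nra.
Qed.

Lemma le_of_pow_half x y K : (forall n, x <= y + K * (1 / 2) ^ n) -> x <= y.
Proof.
  intros H. destruct (Rle_dec x y) as [|Hn]; auto. exfalso.
  assert (Hz : x - y = 0); [|lra].
  apply (le_pow_half_zero _ K). intros n. rewrite Rabs_pos_eq by lra. pose proof (H n). lra.
Qed.

Lemma bool_integral_curve : exists A : bool -> R -> R, (forall b, A b 0 = 0) /\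
  forall b t, is_derive (A b) t (X b (A true t, A false t)).
Proof.
  set (A := fun b t => real (Lim_seq (fun n => picard n b t))).
  assert (HA : forall a, 0 <= a -> exists K, forall n b t, Rabs t <= a ->
    Rabs (A b t - picard n b t) <= K * (1 / 2) ^ n).
  { intros a Ha. destruct (picard_cauchy a Ha) as [K HK]. exists (2 * K). intros n b t Ht.
    apply (geometric_limit (fun n => picard n b t)). intros k. apply HK, Ht. }
  assert (Hlip : forall b s t, Rabs (A b t - A b s) <= Rabs (t - s)).
  { intros b s t.
    destruct (HA (Rmax (Rabs s) (Rabs t))) as [K HK];
      [eapply Rle_trans; [apply (Rabs_pos s) | apply Rmax_l]|].
    apply (le_of_pow_half _ _ (2 * K)). intros n.
    pose proof (HK n b s (Rmax_l _ _)) as H1. pose proof (HK n b t (Rmax_r _ _)) as H2.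
    pose proof (picard_lipschitz n b s t) as H3.
    apply Rabs_le_between in H1, H2, H3. apply Rabs_le. lra. }
  assert (HC : forall b t, continuous (A b) t) by (intros b; apply lipschitz1_continuous, Hlip).
  assert (HB : forall b t, Rabs (A b t) <= Rabs t).
  { intros b t. destruct (HA (Rabs t) (Rabs_pos t)) as [K HK].
    apply (le_of_pow_half _ _ K). intros n.
    pose proof (HK n b t (Rle_refl _)) as H1. pose proof (picard_bound n b t) as H2.
    apply Rabs_le_between in H1, H2. apply Rabs_le. lra. }
  assert (HXA : forall b t, continuous (fun s => X b (point A s)) t)
    by (intros; apply continuous_along; auto).
  (* The integral equation holds up to a multiple of (1/2)^n for every n. *)
  assert (HInt : forall b t, A b t = RInt (fun s => X b (point A s)) 0 t).
  { intros b t. set (a := Rabs t).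
    assert (Ha : 0 <= a) by apply Rabs_pos.
    destruct (HA a Ha) as [K HK], (field_lipschitz a) as [L [HL HLip]].
    assert (Hin : forall n s, Rabs s <= a ->
       Rabs (X b (point (picard n) s) - X b (point A s)) <= L * (2 * (K * (1 / 2) ^ n))).
    { intros n s Hs. eapply Rle_trans.
      - apply (HLip b (fun b => picard n b s) (fun b => A b s)); intros b';
          [pose proof (picard_bound n b' s) | pose proof (HB b' s)]; lra.
      - pose proof (HK n true s Hs) as K1. pose proof (HK n false s Hs) as K2.
        rewrite Rabs_minus_sym in K1, K2. apply Rmult_le_compat_l; lra. }
    apply Rminus_diag_uniq. apply (le_pow_half_zero _ (K / 2 + L * (2 * K) * a)). intros n.
    assert (Hd : Rabs ((picard (S n) b t - RInt (fun s => X b (point A s)) 0 t)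
                       - (picard (S n) b 0 - RInt (fun s => X b (point A s)) 0 0))
                 <= L * (2 * (K * (1 / 2) ^ n)) * Rabs (t - 0)).
    { apply (MVT_bound (fun s => picard (S n) b s - RInt (fun s => X b (point A s)) 0 s)
               (fun s => X b (point (picard n) s) - X b (point A s))).
      - intros s _. exact (is_derive_sub _ _ s _ _ (picard_derive n b s)
          (is_derive_RInt_continuous (fun s => X b (point A s)) (HXA b) s)).
      - intros s Hs. apply Hin. unfold a. destruct (Rle_dec 0 t).
        + rewrite Rmin_left, Rmax_right in Hs by lra. rewrite !Rabs_pos_eq; lra.
        + rewrite Rmin_right, Rmax_left in Hs by lra.
          rewrite (Rabs_left t) by lra. rewrite Rabs_left1; lra. }
    rewrite picard_0, RInt_start, !Rminus_0_r in Hd. fold a in Hd.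
    pose proof (HK (S n) b t (Rle_refl _)) as HBn. simpl pow in HBn.
    replace (A b t - RInt (fun s => X b (point A s)) 0 t) with
      ((A b t - picard (S n) b t) + (picard (S n) b t - RInt (fun s => X b (point A s)) 0 t)) by ring.
    eapply Rle_trans; [apply Rabs_triang|]. lra. }
  exists A. split.
  - intros b. rewrite HInt. apply RInt_start.
  - intros b t. apply (is_derive_ext (fun t => RInt (fun s => X b (point A s)) 0 t)).
    + intros s. symmetry. apply HInt.
    + apply (is_derive_RInt_continuous (fun s => X b (point A s))), HXA.
Qed.

End IntegralCurve.

Lemma integral_curve (P Q : R * R -> R) : smooth P -> smooth Q ->
  (forall p, Rabs (P p) <= 1) -> (forall p, Rabs (Q p) <= 1) ->
  exists A1 A2 : R -> R, A1 0 = 0 /\ A2 0 = 0 /\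
    (forall t, is_derive A1 t (P (A1 t, A2 t))) /\
    (forall t, is_derive A2 t (Q (A1 t, A2 t))).
Proof.
  intros HP HQ BP BQ.
  destruct (bool_integral_curve (fun b => if b then P else Q)) as [A [H0 HA]];
    try (intros []; assumption).
  exists (A true), (A false). split; [apply H0|]. split; [apply H0|].
  split; [exact (HA true) | exact (HA false)].
Qed.

(** The derivative of a smooth function along an integral curve is again a smooth
    function along it. *)
Lemma smooth1_along_curve (P Q : R * R -> R) (A1 A2 : R -> R) : smooth P -> smooth Q ->
  (forall t, is_derive A1 t (P (A1 t, A2 t))) ->
  (forall t, is_derive A2 t (Q (A1 t, A2 t))) ->
  forall F : R * R -> R, smooth F -> smooth1 (fun t => F (A1 t, A2 t)).
Proof.
  intros HP HQ H1 H2.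
  assert (Hd : forall F : R * R -> R, smooth F -> forall t,
    is_derive (fun t => F (A1 t, A2 t)) t
      ((fun p => pd1 F p * P p + pd2 F p * Q p) (A1 t, A2 t))).
  { intros F HF t. apply (is_derive_chain F A1 A2); auto. }
  assert (Hs : forall F : R * R -> R, smooth F ->
     smooth (fun p : R * R => pd1 F p * P p + pd2 F p * Q p)).
  { intros F HF. apply smooth_plus; apply smooth_mult; auto; apply smooth_dirder, HF. }
  assert (Hn : forall n (F : R * R -> R), smooth F -> exists G : R * R -> R, smooth G /\
     forall t, Derive_n (fun t => F (A1 t, A2 t)) n t = G (A1 t, A2 t)).
  { induction n as [|n IH]; intros F HF; [exists F; auto|].
    destruct (IH F HF) as [G [HG EG]].
    exists (fun p => pd1 G p * P p + pd2 G p * Q p). split; [apply Hs, HG|].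
    intros t. simpl. rewrite (Derive_ext _ _ _ EG). apply is_derive_unique, Hd, HG. }
  intros F HF t n. destruct n as [|n]; [exact I|].
  destruct (Hn n F HF) as [G [HG EG]].
  apply ex_derive_ext with (f := fun t => G (A1 t, A2 t)); [symmetry; apply EG|].
  eexists. apply Hd, HG.
Qed.

(** * Chebyshev nets of the plane *)

Lemma smooth1_cos : smooth1 cos.
Proof.
  assert (Hd : forall a b s, is_derive (fun s => a * cos s + b * sin s) s (b * cos s + - a * sin s))
    by (intros; auto_derive; auto; ring).
  assert (H : forall n, exists a b, forall s, Derive_n cos n s = a * cos s + b * sin s).
  { intros n. induction n as [|n [a [b IH]]].
    - exists 1, 0. intros; simpl; ring.
    - exists b, (- a). intros s. simpl. rewrite (Derive_ext _ _ _ IH).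
      apply is_derive_unique, Hd. }
  intros t n. destruct n as [|n]; [exact I|]. destruct (H n) as [a [b E]].
  apply ex_derive_ext with (f := fun s => a * cos s + b * sin s); [intros; symmetry; apply E|].
  eexists; apply Hd.
Qed.

Lemma smooth1_sin : smooth1 sin.
Proof.
  apply (smooth1_of_Derive sin cos); [|apply smooth1_cos].
  intros t. auto_derive; auto. ring.
Qed.

Lemma smooth_cos {V : NormedModule R_AbsRing} (F : V -> R) :
  smooth F -> smooth (fun p => cos (F p)).
Proof. apply (smooth_comp_R cos), smooth1_cos. Qed.

Lemma smooth_sin {V : NormedModule R_AbsRing} (F : V -> R) :
  smooth F -> smooth (fun p => sin (F p)).
Proof. apply (smooth_comp_R sin), smooth1_sin. Qed.

Ltac smoothness := repeat first
  [ assumption | apply smooth_const | apply smooth_cos | apply smooth_sin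
  | apply smooth_minus | apply smooth_plus | apply smooth_opp | apply smooth_mult ].

Lemma cos_lipschitz x y : Rabs (cos x - cos y) <= Rabs (x - y).
Proof.
  rewrite <- (Rmult_1_l (Rabs (x - y))).
  apply (MVT_bound cos (fun t => - sin t)).
  - intros; auto_derive; auto; ring.
  - intros t _. rewrite Rabs_Ropp. apply Rabs_le. pose proof (SIN_bound t). lra.
Qed.

Lemma sin_lipschitz x y : Rabs (sin x - sin y) <= Rabs (x - y).
Proof.
  rewrite <- (Rmult_1_l (Rabs (x - y))).
  apply (MVT_bound sin cos).
  - intros; auto_derive; auto; ring.
  - intros t _. apply Rabs_le. pose proof (COS_bound t). lra.
Qed.

Lemma sin2_cos2_mult x : sin x * sin x + cos x * cos x = 1.
Proof. exact (sin2_cos2 x). Qed.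

Lemma dirder_sin {V : NormedModule R_AbsRing} (F : V -> R) p X : smooth F ->
  dirder (fun q => sin (F q)) p X = dirder F p X * cos (F p).
Proof. intros HF. apply (dirder_comp_R sin cos); [exact HF | apply is_derive_sin]. Qed.

Lemma dirder_cos {V : NormedModule R_AbsRing} (F : V -> R) p X : smooth F ->
  dirder (fun q => cos (F q)) p X = dirder F p X * - sin (F p).
Proof. intros HF. apply (dirder_comp_R cos (fun t => - sin t)); [exact HF | apply is_derive_cos]. Qed.

Lemma smooth1_cos_comp w : smooth1 w -> smooth1 (fun t => cos (w t)).
Proof. intros H. apply smooth1_iff, smooth_cos, smooth1_iff, H. Qed.

Lemma smooth1_sin_comp w : smooth1 w -> smooth1 (fun t => sin (w t)).
Proof. intros H. apply smooth1_iff, smooth_sin, smooth1_iff, H. Qed.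

Lemma flat_chart_smooth w1 w2 : smooth1 w1 -> smooth1 w2 ->
  smooth2 (flat_chart w1 w2) /\
  (forall p : R * R, pd1 (fun q => fst (flat_chart w1 w2 q)) p = cos (w1 (fst p)) /\
             pd2 (fun q => fst (flat_chart w1 w2 q)) p = cos (w2 (snd p)) /\
             pd1 (fun q => snd (flat_chart w1 w2 q)) p = sin (w1 (fst p)) /\
             pd2 (fun q => snd (flat_chart w1 w2 q)) p = - sin (w2 (snd p))).
Proof.
  intros H1 H2.
  assert (S1 : smooth (fun p : R * R => w1 (fst p))) by (apply smooth_comp_R; [auto | apply smooth_fst]).
  assert (S2 : smooth (fun p : R * R => w2 (snd p))) by (apply smooth_comp_R; [auto | apply smooth_snd]).
  assert (C1 := smooth1_continuous _ (smooth1_cos_comp w1 H1)).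
  assert (C2 := smooth1_continuous _ (smooth1_cos_comp w2 H2)).
  assert (D1 := smooth1_continuous _ (smooth1_sin_comp w1 H1)).
  assert (D2 := smooth1_continuous _ (smooth1_sin_comp w2 H2)).
  destruct (smooth_of_partials (fun q => fst (flat_chart w1 w2 q))
             (fun p => cos (w1 (fst p))) (fun p => cos (w2 (snd p)))) as [Sx [Xx Xy]].
  - exact (smooth_cos _ S1).
  - exact (smooth_cos _ S2).
  - intros x y. simpl. eapply is_derive_eq; [|apply Rplus_0_r].
    apply is_derive_add; [|apply is_derive_cst].
    apply (is_derive_RInt_continuous (fun t => cos (w1 t))), C1.
  - intros x y. simpl. eapply is_derive_eq; [|apply Rplus_0_l].
    apply is_derive_add; [apply is_derive_cst|].
    apply (is_derive_RInt_continuous (fun t => cos (w2 t))), C2.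
  - destruct (smooth_of_partials (fun q => snd (flat_chart w1 w2 q))
               (fun p => sin (w1 (fst p))) (fun p => - sin (w2 (snd p)))) as [Sy [Yx Yy]].
    + exact (smooth_sin _ S1).
    + exact (smooth_opp _ (smooth_sin _ S2)).
    + intros x y. simpl. eapply is_derive_eq; [|apply Rminus_0_r].
      apply is_derive_sub; [|apply is_derive_cst].
      apply (is_derive_RInt_continuous (fun t => sin (w1 t))), D1.
    + intros x y. simpl. eapply is_derive_eq; [|apply Rminus_0_l].
      apply is_derive_sub; [apply is_derive_cst|].
      apply (is_derive_RInt_continuous (fun t => sin (w2 t))), D2.
    + split; [split; assumption|]. auto.
Qed.

(** [f] varies along the curve only through the deviation of the direction [b] of
    the curve from the direction [g] in which [f] has zero derivative. *)
Lemma defect_step (f g : R * R -> R) (c1 c2 b : R -> R) sg M K k a :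
  smooth f -> 0 < k -> 0 < M -> Rabs sg = 1 ->
  (forall s, Rabs s <= a -> Rabs (pd1 f (c1 s, c2 s)) <= M /\ Rabs (pd2 f (c1 s, c2 s)) <= M) ->
  (forall s, is_derive c1 s (cos (b s))) -> (forall s, is_derive c2 s (sg * sin (b s))) ->
  (forall p : R * R, pd1 f p * cos (g p) = - sg * pd2 f p * sin (g p)) ->
  (forall s, Rabs s <= a -> Rabs (g (c1 s, c2 s) - b s) <= K * exp (k * Rabs s)) ->
  forall t, Rabs t <= a -> Rabs (f (c1 t, c2 t) - f (c1 0, c2 0)) <= 2 * M * K / k * exp (k * Rabs t).
Proof.
  intros Sf Hk HM Hsg HD D1 D2 Hf Hg.
  apply (exp_growth (fun t => f (c1 t, c2 t) - f (c1 0, c2 0))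
    (fun t => pd1 f (c1 t, c2 t) * cos (b t) + pd2 f (c1 t, c2 t) * (sg * sin (b t)))); auto.
  - ring.
  - intros s _. eapply is_derive_eq; [|apply Rminus_0_r].
    apply is_derive_sub; [|apply is_derive_cst]. apply is_derive_chain; auto.
  - intros s Hs. destruct (HD s Hs) as [Hp Hq]. specialize (Hg s Hs). specialize (Hf (c1 s, c2 s)).
    set (p := pd1 f (c1 s, c2 s)) in *. set (q := pd2 f (c1 s, c2 s)) in *. set (z := g (c1 s, c2 s)) in *.
    replace (p * cos (b s) + q * (sg * sin (b s))) with
      (p * - (cos z - cos (b s)) + q * (sg * - (sin z - sin (b s)))) by lra.
    eapply Rle_trans; [apply Rabs_triang|]. rewrite !Rabs_mult, !Rabs_Ropp, Hsg, Rmult_1_l.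
    pose proof (cos_lipschitz z (b s)). pose proof (sin_lipschitz z (b s)).
    pose proof (Rabs_pos p). pose proof (Rabs_pos q).
    pose proof (Rabs_pos (cos z - cos (b s))). pose proof (Rabs_pos (sin z - sin (b s))).
    assert (Rabs p * Rabs (cos z - cos (b s)) <= M * (K * exp (k * Rabs s))) by (apply Rmult_le_compat; lra).
    assert (Rabs q * Rabs (sin z - sin (b s)) <= M * (K * exp (k * Rabs s))) by (apply Rmult_le_compat; lra).
    lra.
Qed.

Section Net.
Variables al be : R * R -> R.
Hypothesis Sal : smooth al.
Hypothesis Sbe : smooth be.
Hypothesis Hsum : forall p, 0 < al p + be p < PI.
Hypothesis Hal : forall p : R * R, pd1 al p * cos (be p) = pd2 al p * sin (be p).
Hypothesis Hbe : forall p : R * R, pd1 be p * cos (al p) = - pd2 be p * sin (al p).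

Lemma sin_sum_pos p : 0 < sin (al p + be p).
Proof. apply sin_gt_0; apply Hsum. Qed.

Lemma smooth_inv_sin_sum : smooth (fun p => / sin (al p + be p)).
Proof.
  apply smooth_inv.
  - exact (smooth_sin _ (smooth_plus _ _ Sal Sbe)).
  - intros p. pose proof (sin_sum_pos p). lra.
Qed.

Lemma dirder_quot (f : R * R -> R) (p X : R * R) : smooth f ->
  dirder (fun q => f q * / sin (al q + be q)) p X =
  (dirder f p X * sin (al p + be p) - f p * cos (al p + be p) * (dirder al p X + dirder be p X))
    * / sin (al p + be p) ^ 2.
Proof.
  intros Hf. pose proof (sin_sum_pos p) as Hp.
  assert (Hs : smooth (fun q => al q + be q)) by (apply smooth_plus; assumption).
  rewrite dirder_mult, dirder_inv, dirder_sin, dirder_plus;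
    try assumption; try (apply smooth_sin, Hs); try exact smooth_inv_sin_sum; [field|]; lra.
Qed.

(** The coframe dual to the two unit fields is closed exactly because each angle
    is constant along the other family. *)
Lemma net_potentials : exists U V : R * R -> R,
  (smooth U /\ U (0, 0) = 0 /\
   (forall p : R * R, pd1 U p = sin (be p) * / sin (al p + be p)) /\
   (forall p : R * R, pd2 U p = cos (be p) * / sin (al p + be p))) /\
  (smooth V /\ V (0, 0) = 0 /\
   (forall p : R * R, pd1 V p = sin (al p) * / sin (al p + be p)) /\
   (forall p : R * R, pd2 V p = (-1 * cos (al p)) * / sin (al p + be p))).
Proof.
  assert (Sca := smooth_cos _ Sal). assert (Ssa := smooth_sin _ Sal).
  assert (Scb := smooth_cos _ Sbe). assert (Ssb := smooth_sin _ Sbe).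
  assert (Snca : smooth (fun p => -1 * cos (al p)))
    by (apply smooth_mult; [apply smooth_const | exact Sca]).
  destruct (poincare (fun p => sin (be p) * / sin (al p + be p))
                     (fun p => cos (be p) * / sin (al p + be p))) as [U HU].
  - exact (smooth_mult _ _ Ssb smooth_inv_sin_sum).
  - exact (smooth_mult _ _ Scb smooth_inv_sin_sum).
  - intros p. rewrite !dirder_quot, dirder_sin, dirder_cos by auto. f_equal. apply Rminus_diag_uniq.
    pose proof (Hal p) as Ea. pose proof (Hbe p) as Eb.
    set (a := al p) in *. set (b := be p) in *.
    set (a1 := pd1 al p) in *. set (a2 := pd2 al p) in *.
    set (b1 := pd1 be p) in *. set (b2 := pd2 be p) in *.
    rewrite sin_plus, cos_plus.
    transitivity ((sin b * sin b + cos b * cos b) * (b1 * cos a - - b2 * sin a)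
      + (cos a * cos b - sin a * sin b) * (a1 * cos b - a2 * sin b)); [ring|].
    rewrite Ea, Eb. ring.
  - destruct (poincare (fun p => sin (al p) * / sin (al p + be p))
                     (fun p => (-1 * cos (al p)) * / sin (al p + be p))) as [V HV].
    + exact (smooth_mult _ _ Ssa smooth_inv_sin_sum).
    + exact (smooth_mult _ _ Snca smooth_inv_sin_sum).
    + intros p. rewrite !dirder_quot, dirder_sin, dirder_mult, dirder_const, dirder_cos
        by (auto; apply smooth_const). f_equal. apply Rminus_diag_uniq.
      pose proof (Hal p) as Ea. pose proof (Hbe p) as Eb.
      set (a := al p) in *. set (b := be p) in *.
      set (a1 := pd1 al p) in *. set (a2 := pd2 al p) in *.
      set (b1 := pd1 be p) in *. set (b2 := pd2 be p) in *.
      rewrite sin_plus, cos_plus.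
      transitivity (- (sin a * sin a + cos a * cos a) * (a1 * cos b - a2 * sin b)
        - (cos a * cos b - sin a * sin b) * (b1 * cos a - - b2 * sin a)); [ring|].
      rewrite Ea, Eb. ring.
    + exists U, V. split; assumption.
Qed.

Section Translation.
Variables A1 A2 B1 B2 : R -> R.
Hypothesis A10 : A1 0 = 0.
Hypothesis A20 : A2 0 = 0.
Hypothesis B10 : B1 0 = 0.
Hypothesis B20 : B2 0 = 0.
Hypothesis DA1 : forall t, is_derive A1 t (cos (al (A1 t, A2 t))).
Hypothesis DA2 : forall t, is_derive A2 t (sin (al (A1 t, A2 t))).
Hypothesis DB1 : forall t, is_derive B1 t (cos (be (B1 t, B2 t))).
Hypothesis DB2 : forall t, is_derive B2 t (-1 * sin (be (B1 t, B2 t))).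

Lemma unit_speed_bound (f df : R -> R) t : f 0 = 0 ->
  (forall t, is_derive f t (df t)) -> (forall t, Rabs (df t) <= 1) -> Rabs (f t) <= Rabs t.
Proof.
  intros H0 Hd Hb. pose proof (MVT_bound f df 1 0 t (fun t _ => Hd t) (fun t _ => Hb t)) as H.
  rewrite H0, !Rminus_0_r in H. lra.
Qed.

Lemma Rabs_cos_le_1 t : Rabs (cos t) <= 1.
Proof. apply Rabs_le, COS_bound. Qed.

Lemma Rabs_sin_le_1 t : Rabs (sin t) <= 1.
Proof. apply Rabs_le, SIN_bound. Qed.

Lemma Rabs_opp_sin_le_1 t : Rabs (-1 * sin t) <= 1.
Proof. rewrite Rabs_mult, (Rabs_left (-1)) by lra. pose proof (Rabs_sin_le_1 t). lra. Qed.

Lemma translate_bound u v a : Rabs u <= a -> Rabs v <= a ->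
  Rabs (A1 u + B1 v) <= 2 * a /\ Rabs (A2 u + B2 v) <= 2 * a.
Proof.
  intros Hu Hv.
  pose proof (unit_speed_bound A1 _ u A10 DA1 (fun t => Rabs_cos_le_1 _)).
  pose proof (unit_speed_bound A2 _ u A20 DA2 (fun t => Rabs_sin_le_1 _)).
  pose proof (unit_speed_bound B1 _ v B10 DB1 (fun t => Rabs_cos_le_1 _)).
  pose proof (unit_speed_bound B2 _ v B20 DB2 (fun t => Rabs_opp_sin_le_1 _)).
  pose proof (Rabs_triang (A1 u) (B1 v)). pose proof (Rabs_triang (A2 u) (B2 v)). lra.
Qed.

(** Moving along the second family changes [al] only as far as [be] at the
    translated point differs from [be] on the curve, and conversely; the two
    discrepancies therefore control each other and both vanish. *)
Lemma net_translation u v :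
  al (A1 u + B1 v, A2 u + B2 v) = al (A1 u, A2 u) /\
  be (A1 u + B1 v, A2 u + B2 v) = be (B1 v, B2 v).
Proof.
  set (a := Rmax (Rabs u) (Rabs v)).
  destruct (bounded_square_list (cons al (cons be (cons (fun p => pd1 al p) (cons (fun p => pd2 al p)
      (cons (fun p => pd1 be p) (cons (fun p => pd2 be p) nil)))))) (2 * a)) as [M [HM HbF]].
  { intros F HF p. revert F HF. apply List.Forall_forall.
    repeat constructor; apply (smooth_continuous _ p); try apply smooth_dirder; assumption. }
  assert (Hbd : forall x y, Rabs x <= 2 * a -> Rabs y <= 2 * a ->
     (Rabs (al (x, y)) <= M /\ Rabs (be (x, y)) <= M) /\
     (Rabs (pd1 al (x, y)) <= M /\ Rabs (pd2 al (x, y)) <= M) /\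
     (Rabs (pd1 be (x, y)) <= M /\ Rabs (pd2 be (x, y)) <= M))
    by (intros x y Hx Hy;
        refine (conj (conj (HbF al _ x y Hx Hy) (HbF be _ x y Hx Hy))
          (conj (conj (HbF (fun p => pd1 al p) _ x y Hx Hy) (HbF (fun p => pd2 al p) _ x y Hx Hy))
                (conj (HbF (fun p => pd1 be p) _ x y Hx Hy) (HbF (fun p => pd2 be p) _ x y Hx Hy))));
        simpl; auto 10).
  assert (Ha : 0 <= a) by (eapply Rle_trans; [apply (Rabs_pos u) | apply Rmax_l]).
  (* With this weight, [defect_step] halves the bound. *)
  set (c := 4 * M). assert (Hc : 0 < c) by (unfold c; lra).
  assert (H : forall n u v, Rabs u <= a -> Rabs v <= a ->
    Rabs (al (A1 u + B1 v, A2 u + B2 v) - al (A1 u, A2 u))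
      <= 2 * M * (1 / 2) ^ n * exp (c * Rabs u) * exp (c * Rabs v) /\
    Rabs (be (A1 u + B1 v, A2 u + B2 v) - be (B1 v, B2 v))
      <= 2 * M * (1 / 2) ^ n * exp (c * Rabs v) * exp (c * Rabs u)).
  { induction n as [|n IH]; intros u' v' Hu Hv.
    - destruct (translate_bound u' v' a Hu Hv) as [Z1 Z2].
      destruct (translate_bound u' 0 a Hu) as [Z3 Z4]; [rewrite Rabs_R0; lra|].
      destruct (translate_bound 0 v' a) as [Z5 Z6]; [rewrite Rabs_R0; lra | auto |].
      rewrite B10, B20, !Rplus_0_r in *. rewrite A10, A20, !Rplus_0_l in *.
      destruct (Hbd _ _ Z1 Z2) as [[Ba Bb] _].
      destruct (Hbd _ _ Z3 Z4) as [[Ba' _] _]. destruct (Hbd _ _ Z5 Z6) as [[_ Bb'] _].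
      assert (E1 : 1 <= exp (c * Rabs u')).
      { apply exp_ge_1, Rmult_le_pos; [lra | apply Rabs_pos]. }
      assert (E2 : 1 <= exp (c * Rabs v')).
      { apply exp_ge_1, Rmult_le_pos; [lra | apply Rabs_pos]. }
      assert (EE : 2 * M <= 2 * M * (exp (c * Rabs u') * exp (c * Rabs v'))).
      { rewrite <- (Rmult_1_r (2 * M)) at 1. apply Rmult_le_compat_l; [lra|].
        rewrite <- (Rmult_1_r 1). apply Rmult_le_compat; lra. }
      simpl pow. rewrite Rmult_1_r.
      split.
      + eapply Rle_trans; [apply Rabs_triang|]. rewrite Rabs_Ropp. lra.
      + eapply Rle_trans; [apply Rabs_triang|]. rewrite Rabs_Ropp. lra.
    - assert (Hp : forall e, 2 * M * (1 / 2) ^ S n * e = 2 * M * (2 * M * (1 / 2) ^ n * e) / c)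
        by (intros e; unfold c; simpl; field; lra).
      assert (H1 : Rabs (-1) = 1) by (rewrite Rabs_left; lra).
      rewrite !Hp. split.
      + pose proof (defect_step al be (fun v => A1 u' + B1 v) (fun v => A2 u' + B2 v)
          (fun v => be (B1 v, B2 v)) (-1) M (2 * M * (1 / 2) ^ n * exp (c * Rabs u')) c a Sal Hc HM H1) as G.
        cbv beta in G. rewrite B10, B20, !Rplus_0_r in G. apply G; auto.
        * intros s Hs. destruct (translate_bound u' s a Hu Hs) as [Z1 Z2]. apply (Hbd _ _ Z1 Z2).
        * intros s. eapply is_derive_eq; [apply is_derive_add; [apply is_derive_cst | auto]|apply Rplus_0_l].
        * intros s. eapply is_derive_eq; [apply is_derive_add; [apply is_derive_cst | auto]|apply Rplus_0_l].
        * intros p. rewrite Hal. ring.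
        * intros s Hs. destruct (IH u' s Hu Hs) as [_ IHb]. lra.
      + pose proof (defect_step be al (fun u => A1 u + B1 v') (fun u => A2 u + B2 v')
          (fun u => al (A1 u, A2 u)) 1 M (2 * M * (1 / 2) ^ n * exp (c * Rabs v')) c a Sbe Hc HM Rabs_R1) as G.
        cbv beta in G. rewrite A10, A20, !Rplus_0_l in G. apply G; auto.
        * intros s Hs. destruct (translate_bound s v' a Hs Hv) as [Z1 Z2]. apply (Hbd _ _ Z1 Z2).
        * intros s. eapply is_derive_eq; [apply is_derive_add; [auto | apply is_derive_cst]|apply Rplus_0_r].
        * intros s. eapply is_derive_eq; [apply is_derive_add; [auto | apply is_derive_cst]|].
          rewrite Rmult_1_l. apply Rplus_0_r.
        * intros p. rewrite Hbe. ring.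
        * intros s Hs. destruct (IH s v' Hs Hv) as [IHa _]. lra. }
  assert (Hu : Rabs u <= a) by apply Rmax_l. assert (Hv : Rabs v <= a) by apply Rmax_r.
  split; apply Rminus_diag_uniq;
    [ apply (le_pow_half_zero _ (2 * M * exp (c * Rabs u) * exp (c * Rabs v)))
    | apply (le_pow_half_zero _ (2 * M * exp (c * Rabs v) * exp (c * Rabs u))) ];
    intros n; (eapply Rle_trans; [apply (H n u v Hu Hv)|]); right; ring.
Qed.

Variables U V : R * R -> R.
Hypothesis SU : smooth U.
Hypothesis SV : smooth V.
Hypothesis U0 : U (0, 0) = 0.
Hypothesis V0 : V (0, 0) = 0.
Hypothesis U1 : forall p : R * R, pd1 U p = sin (be p) * / sin (al p + be p).
Hypothesis U2 : forall p : R * R, pd2 U p = cos (be p) * / sin (al p + be p).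
Hypothesis V1 : forall p : R * R, pd1 V p = sin (al p) * / sin (al p + be p).
Hypothesis V2 : forall p : R * R, pd2 V p = (-1 * cos (al p)) * / sin (al p + be p).

(** By [net_translation] the partial velocities of the sum of the two curves are the
    unit fields at the sum, to which the two potentials are dual. *)
Lemma potentials_of_translate u v :
  U (A1 u + B1 v, A2 u + B2 v) = u /\ V (A1 u + B1 v, A2 u + B2 v) = v.
Proof.
  assert (Du : forall (F : R * R -> R) u v, smooth F ->
    is_derive (fun u => F (A1 u + B1 v, A2 u + B2 v)) u
      (pd1 F (A1 u + B1 v, A2 u + B2 v) * cos (al (A1 u + B1 v, A2 u + B2 v))
       + pd2 F (A1 u + B1 v, A2 u + B2 v) * sin (al (A1 u + B1 v, A2 u + B2 v)))).
  { intros F u' v' HF. destruct (net_translation u' v') as [-> _].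
    apply (is_derive_chain F (fun u => A1 u + B1 v') (fun u => A2 u + B2 v')); auto;
      (eapply is_derive_eq; [apply is_derive_add; [auto | apply is_derive_cst]|apply Rplus_0_r]). }
  assert (Dv : forall (F : R * R -> R) u v, smooth F ->
    is_derive (fun v => F (A1 u + B1 v, A2 u + B2 v)) v
      (pd1 F (A1 u + B1 v, A2 u + B2 v) * cos (be (A1 u + B1 v, A2 u + B2 v))
       + pd2 F (A1 u + B1 v, A2 u + B2 v) * (-1 * sin (be (A1 u + B1 v, A2 u + B2 v))))).
  { intros F u' v' HF. destruct (net_translation u' v') as [_ ->].
    apply (is_derive_chain F (fun v => A1 u' + B1 v) (fun v => A2 u' + B2 v)); auto;
      (eapply is_derive_eq; [apply is_derive_add; [apply is_derive_cst | auto]|apply Rplus_0_l]). }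
  split.
  - assert (E1 : forall v u u', U (A1 u + B1 v, A2 u + B2 v) - u = U (A1 u' + B1 v, A2 u' + B2 v) - u').
    { intros v' u' u''. apply (derive0_const (fun u => U (A1 u + B1 v', A2 u + B2 v') - u)).
      intros t. eapply is_derive_eq.
      - apply is_derive_sub; [apply (Du U t v' SU) | apply (is_derive_id (K := R_AbsRing))].
      - real_eq. unfold one; simpl. rewrite U1, U2. pose proof (sin_sum_pos (A1 t + B1 v', A2 t + B2 v')) as Hp.
        set (z := (A1 t + B1 v', A2 t + B2 v')) in *.
        rewrite sin_plus in *. field. lra. }
    assert (E2 : forall u v v', U (A1 u + B1 v, A2 u + B2 v) = U (A1 u + B1 v', A2 u + B2 v')).
    { intros u' v' v''. apply (derive0_const (fun v => U (A1 u' + B1 v, A2 u' + B2 v))).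
      intros t. eapply is_derive_eq; [apply (Dv U u' t SU)|].
      real_eq. rewrite U1, U2. ring. }
    pose proof (E1 v u 0) as H1. rewrite (E2 0 v 0), A10, A20, B10, B20, !Rplus_0_r, U0 in H1. lra.
  - assert (E1 : forall u v v', V (A1 u + B1 v, A2 u + B2 v) - v = V (A1 u + B1 v', A2 u + B2 v') - v').
    { intros u' v' v''. apply (derive0_const (fun v => V (A1 u' + B1 v, A2 u' + B2 v) - v)).
      intros t. eapply is_derive_eq.
      - apply is_derive_sub; [apply (Dv V u' t SV) | apply (is_derive_id (K := R_AbsRing))].
      - real_eq. unfold one; simpl. rewrite V1, V2. pose proof (sin_sum_pos (A1 u' + B1 t, A2 u' + B2 t)) as Hp.
        set (z := (A1 u' + B1 t, A2 u' + B2 t)) in *.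
        rewrite sin_plus in *. field. lra. }
    assert (E2 : forall v u u', V (A1 u + B1 v, A2 u + B2 v) = V (A1 u' + B1 v, A2 u' + B2 v)).
    { intros v' u' u''. apply (derive0_const (fun u => V (A1 u + B1 v', A2 u + B2 v'))).
      intros t. eapply is_derive_eq; [apply (Du V t v' SV)|].
      real_eq. rewrite V1, V2. ring. }
    pose proof (E1 u v 0) as H1. rewrite (E2 0 u 0), A10, A20, B10, B20, !Rplus_0_r, V0 in H1. lra.
Qed.

(** Along the segment from the origin to [p], the defect of the inverse solves a
    linear differential inequality with zero initial value. *)
Lemma translate_of_potentials x y :
  A1 (U (x, y)) + B1 (V (x, y)) = x /\ A2 (U (x, y)) + B2 (V (x, y)) = y.
Proof.
  assert (Dtx : forall t z : R, is_derive (fun t => t * z) t z) by (intros; auto_derive; auto; ring).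
  assert (Stx : forall z, smooth (V := R_NormedModule) (fun t => t * z))
    by (intros z; apply smooth_mult; [apply smooth_id | apply smooth_const]).
  set (dU := fun t => pd1 U (t * x, t * y) * x + pd2 U (t * x, t * y) * y).
  set (dV := fun t => pd1 V (t * x, t * y) * x + pd2 V (t * x, t * y) * y).
  assert (DU : forall t, is_derive (fun t => U (t * x, t * y)) t (dU t)).
  { intros t. apply (is_derive_chain U (fun t => t * x) (fun t => t * y)); auto. }
  assert (DV : forall t, is_derive (fun t => V (t * x, t * y)) t (dV t)).
  { intros t. apply (is_derive_chain V (fun t => t * x) (fun t => t * y)); auto. }
  assert (CD : forall F : R * R -> R, smooth F -> forall t,
    continuous (fun t => pd1 F (t * x, t * y) * x + pd2 F (t * x, t * y) * y) t).
  { intros F SF t. apply (smooth_continuous (V := R_NormedModule)).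
    apply smooth_plus; (apply smooth_mult; [|apply smooth_const]);
      [apply (smooth_comp2 (fun q => pd1 F q)) | apply (smooth_comp2 (fun q => pd2 F q))];
      try apply Stx; apply smooth_dirder, SF. }
  set (z1 := fun t => A1 (U (t * x, t * y)) + B1 (V (t * x, t * y))).
  set (z2 := fun t => A2 (U (t * x, t * y)) + B2 (V (t * x, t * y))).
  assert (Hxy : forall t,
    x = cos (al (t * x, t * y)) * dU t + cos (be (t * x, t * y)) * dV t /\
    y = sin (al (t * x, t * y)) * dU t + (-1 * sin (be (t * x, t * y))) * dV t).
  { intros t. unfold dU, dV. pose proof (sin_sum_pos (t * x, t * y)) as Hp.
    rewrite U1, U2, V1, V2. rewrite sin_plus in *. split; field; lra. }
  assert (Dz : forall t,
    is_derive (fun t => z1 t - t * x) t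
      ((cos (al (z1 t, z2 t)) - cos (al (t * x, t * y))) * dU t
       + (cos (be (z1 t, z2 t)) - cos (be (t * x, t * y))) * dV t) /\
    is_derive (fun t => z2 t - t * y) t
      ((sin (al (z1 t, z2 t)) - sin (al (t * x, t * y))) * dU t
       + (-1 * (sin (be (z1 t, z2 t)) - sin (be (t * x, t * y)))) * dV t)).
  { intros t. destruct (Hxy t) as [Ex Ey].
    destruct (net_translation (U (t * x, t * y)) (V (t * x, t * y))) as [Ea Eb].
    unfold z1, z2. rewrite Ea, Eb. split.
    - eapply is_derive_eq.
      + apply is_derive_sub.
        * apply is_derive_add.
          -- exact (is_derive_comp A1 (fun t => U (t * x, t * y)) t _ _ (DA1 _) (DU t)).
          -- exact (is_derive_comp B1 (fun t => V (t * x, t * y)) t _ _ (DB1 _) (DV t)).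
        * apply Dtx.
      + real_eq. unfold scal; simpl; unfold mult; simpl. lra.
    - eapply is_derive_eq.
      + apply is_derive_sub.
        * apply is_derive_add.
          -- exact (is_derive_comp A2 (fun t => U (t * x, t * y)) t _ _ (DA2 _) (DU t)).
          -- exact (is_derive_comp B2 (fun t => V (t * x, t * y)) t _ _ (DB2 _) (DV t)).
        * apply Dtx.
      + real_eq. unfold scal; simpl; unfold mult; simpl. lra. }
  assert (Cz : forall t, continuous z1 t /\ continuous z2 t).
  { intros t. split; apply (ex_derive_continuous (V := R_NormedModule)).
    - apply (ex_derive_ext (fun t => (z1 t - t * x) + t * x)); [intros; real_eq; ring|].
      exists ((cos (al (z1 t, z2 t)) - cos (al (t * x, t * y))) * dU t
        + (cos (be (z1 t, z2 t)) - cos (be (t * x, t * y))) * dV t + x).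
      apply is_derive_add; [apply Dz | apply Dtx].
    - apply (ex_derive_ext (fun t => (z2 t - t * y) + t * y)); [intros; real_eq; ring|].
      exists ((sin (al (z1 t, z2 t)) - sin (al (t * x, t * y))) * dU t
        + (-1 * (sin (be (z1 t, z2 t)) - sin (be (t * x, t * y)))) * dV t + y).
      apply is_derive_add; [apply Dz | apply Dtx]. }
  assert (Hbd : exists a, 0 < a /\ forall t, Rabs t <= 1 ->
     (Rabs (dU t) <= a /\ Rabs (dV t) <= a) /\ (Rabs (z1 t) <= a /\ Rabs (z2 t) <= a) /\
     (Rabs (t * x) <= a /\ Rabs (t * y) <= a)).
  { destruct (bounded_interval dU (CD U SU)) as [M1 [P1 H1]], (bounded_interval dV (CD V SV)) as [M2 [P2 H2]],
      (bounded_interval z1 (fun t => proj1 (Cz t))) as [M3 [P3 H3]],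
      (bounded_interval z2 (fun t => proj2 (Cz t))) as [M4 [P4 H4]].
    pose proof (Rabs_pos x) as Px. pose proof (Rabs_pos y) as Py.
    exists (M1 + M2 + M3 + M4 + Rabs x + Rabs y + 1). split; [lra|]. intros t Ht.
    specialize (H1 t Ht). specialize (H2 t Ht). specialize (H3 t Ht). specialize (H4 t Ht).
    rewrite !Rabs_mult.
    pose proof (Rmult_le_compat_r _ _ _ Px Ht). pose proof (Rmult_le_compat_r _ _ _ Py Ht). lra. }
  destruct Hbd as [a [Pa Hbd]].
  destruct (smooth_lipschitz_square al a Sal) as [L1 [PL1 HL1]].
  destruct (smooth_lipschitz_square be a Sbe) as [L2 [PL2 HL2]].
  set (L := L1 + L2 + 1).
  set (c := 4 * (L * a)).
  assert (HL : 0 < L) by (unfold L; lra).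
  assert (HLM : 0 < L * a) by (apply Rmult_lt_0_compat; auto).
  assert (Hc : 0 < c) by (unfold c; lra).
  assert (H : forall n t, Rabs t <= 1 ->
    Rabs (z1 t - t * x) <= 2 * a * (1 / 2) ^ n * exp (c * Rabs t) /\
    Rabs (z2 t - t * y) <= 2 * a * (1 / 2) ^ n * exp (c * Rabs t)).
  { induction n as [|n IH]; intros t Ht.
    - destruct (Hbd t Ht) as (_ & [J1 J2] & [I1 I2]).
      assert (1 <= exp (c * Rabs t)) by (apply exp_ge_1, Rmult_le_pos; [lra | apply Rabs_pos]).
      assert (2 * a <= 2 * a * exp (c * Rabs t)) by (rewrite <- (Rmult_1_r (2 * a)) at 1; apply Rmult_le_compat_l; lra).
      simpl pow. rewrite Rmult_1_r.
      split; (eapply Rle_trans; [apply Rabs_triang|]); rewrite Rabs_Ropp; lra.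
    - assert (Hstep : forall s, Rabs s <= 1 -> forall p q : R,
        Rabs p <= Rabs (al (z1 s, z2 s) - al (s * x, s * y)) ->
        Rabs q <= Rabs (be (z1 s, z2 s) - be (s * x, s * y)) ->
        Rabs (p * dU s + q * dV s) <= 4 * (L * a) * a * (1 / 2) ^ n * exp (c * Rabs s)).
      { intros s Hs p q Hp Hq. destruct (IH s Hs) as [IH1 IH2].
        destruct (Hbd s Hs) as ([HdUs HdVs] & [J1 J2] & [I1 I2]).
        pose proof (HL1 (z1 s) (z2 s) (s * x) (s * y) J1 J2 I1 I2) as Hl1.
        pose proof (HL2 (z1 s) (z2 s) (s * x) (s * y) J1 J2 I1 I2) as Hl2.
        set (d := Rabs (z1 s - s * x) + Rabs (z2 s - s * y)) in *.
        assert (Hd : 0 <= d)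
          by (unfold d; pose proof (Rabs_pos (z1 s - s * x)); pose proof (Rabs_pos (z2 s - s * y)); lra).
        eapply Rle_trans; [apply Rabs_triang|]. rewrite !Rabs_mult.
        pose proof (Rabs_pos p). pose proof (Rabs_pos q). pose proof (Rabs_pos (dU s)). pose proof (Rabs_pos (dV s)).
        assert (Rabs p * Rabs (dU s) <= (L1 * d) * a) by (apply Rmult_le_compat; lra).
        assert (Rabs q * Rabs (dV s) <= (L2 * d) * a) by (apply Rmult_le_compat; lra).
        assert (0 <= d * a) by (apply Rmult_le_pos; lra).
        apply Rle_trans with (L * a * d); [unfold L; lra|].
        apply Rle_trans with (L * a * (4 * a * (1 / 2) ^ n * exp (c * Rabs s)));
          [apply Rmult_le_compat_l; unfold d; lra | lra]. }
      assert (Hz0 : z1 0 - 0 * x = 0 /\ z2 0 - 0 * y = 0).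
      { unfold z1, z2. rewrite !Rmult_0_l, U0, V0, A10, A20, B10, B20. lra. }
      replace (2 * a * (1 / 2) ^ S n) with (4 * (L * a) * a * (1 / 2) ^ n / c)
        by (unfold c; simpl; field; lra).
      split.
      + eapply (exp_growth (fun t => z1 t - t * x)) with (a := 1); auto.
        * apply Hz0.
        * intros s _. apply (proj1 (Dz s)).
        * intros s Hs. apply Hstep; auto; apply cos_lipschitz.
      + eapply (exp_growth (fun t => z2 t - t * y)) with (a := 1); auto.
        * apply Hz0.
        * intros s _. apply (proj2 (Dz s)).
        * intros s Hs. apply Hstep; auto; [apply sin_lipschitz|].
          rewrite Rabs_mult, (Rabs_left (-1)) by lra.
          eapply Rle_trans; [|apply sin_lipschitz]. lra. }
  assert (Hfin : z1 1 = 1 * x /\ z2 1 = 1 * y).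
  { split; apply Rminus_diag_uniq; apply (le_pow_half_zero _ (2 * a * exp (c * Rabs 1))); intros n;
      (eapply Rle_trans; [apply (H n 1); rewrite Rabs_R1; lra|]); right; ring. }
  unfold z1, z2 in Hfin. rewrite !Rmult_1_l in Hfin. exact Hfin.
Qed.

End Translation.

(** A net with unit fields at angles [al] and [- be] and constant angles along
    the transverse curves is a translation net: its inverse chart is the sum of
    the two integral curves through the origin. *)
Lemma net_chart : exists w1 w2 : R -> R, smooth1 w1 /\ smooth1 w2 /\
  diffeo_R2 (flat_chart w1 w2) /\
  forall u v, al (flat_chart w1 w2 (u, v)) = w1 u /\ be (flat_chart w1 w2 (u, v)) = w2 v.
Proof.
  assert (Snsb : smooth (fun p => -1 * sin (be p)))
    by (apply smooth_mult; [apply smooth_const | apply smooth_sin, Sbe]).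
  destruct (integral_curve (fun p => cos (al p)) (fun p => sin (al p))
              (smooth_cos _ Sal) (smooth_sin _ Sal) (fun p => Rabs_cos_le_1 _) (fun p => Rabs_sin_le_1 _))
    as [A1 [A2 [A10 [A20 [DA1 DA2]]]]].
  destruct (integral_curve (fun p => cos (be p)) (fun p => -1 * sin (be p))
              (smooth_cos _ Sbe) Snsb (fun p => Rabs_cos_le_1 _) (fun p => Rabs_opp_sin_le_1 _))
    as [B1 [B2 [B10 [B20 [DB1 DB2]]]]].
  destruct net_potentials as [U [V [[SU [U0 [U1 U2]]] [SV [V0 [V1 V2]]]]]].
  set (w1 := fun t => al (A1 t, A2 t)). set (w2 := fun t => be (B1 t, B2 t)).
  assert (S1 : smooth1 w1).
  { apply (smooth1_along_curve (fun p => cos (al p)) (fun p => sin (al p))); auto.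
    - apply smooth_cos, Sal.
    - apply smooth_sin, Sal. }
  assert (S2 : smooth1 w2).
  { apply (smooth1_along_curve (fun p => cos (be p)) (fun p => -1 * sin (be p))); auto.
    apply smooth_cos, Sbe. }
  pose proof (RInt_from_0 _ A1 A10 (smooth1_continuous _ (smooth1_cos_comp w1 S1)) DA1) as EA1.
  pose proof (RInt_from_0 _ A2 A20 (smooth1_continuous _ (smooth1_sin_comp w1 S1)) DA2) as EA2.
  pose proof (RInt_from_0 _ B1 B10 (smooth1_continuous _ (smooth1_cos_comp w2 S2)) DB1) as EB1.
  assert (EB2 : forall t, RInt (fun t => sin (w2 t)) 0 t = - B2 t).
  { refine (RInt_from_0 _ (fun t => - B2 t) _ (smooth1_continuous _ (smooth1_sin_comp w2 S2)) _).
    - rewrite B20. ring.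
    - intros t. eapply is_derive_eq; [exact (is_derive_opp (V := R_NormedModule) B2 t _ (DB2 t))|].
      unfold opp; simpl. unfold w2. ring. }
  assert (HZ : forall u v, flat_chart w1 w2 (u, v) = (A1 u + B1 v, A2 u + B2 v)).
  { intros u v. unfold flat_chart. simpl fst; simpl snd.
    rewrite EA1, EB1, EA2, EB2. f_equal. ring. }
  exists w1, w2. split; [exact S1|]. split; [exact S2|]. split.
  - split; [apply flat_chart_smooth; auto|].
    exists (fun p => (U p, V p)). split; [split; assumption|]. split.
    + intros [u v]. rewrite HZ.
      destruct (potentials_of_translate A1 A2 B1 B2 A10 A20 B10 B20 DA1 DA2 DB1 DB2
                 U V SU SV U0 V0 U1 U2 V1 V2 u v) as [-> ->]. reflexivity.
    + intros [x y]. rewrite HZ.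
      destruct (translate_of_potentials A1 A2 B1 B2 A10 A20 B10 B20 DA1 DA2 DB1 DB2
                 U V SU SV U0 V0 U1 U2 V1 V2 x y) as [-> ->]. reflexivity.
  - intros u v. rewrite HZ.
    apply (net_translation A1 A2 B1 B2 A10 A20 B10 B20 DA1 DA2 DB1 DB2).
Qed.

End Net.

(** * Split quaternions and curves of split quaternions *)

Definition q1 : R4 := (1, 0, 0, 0).
Definition qj : R4 := (0, 0, 1, 0).

Definition qadd (z w : R4) : R4 := (x0 z + x0 w, x1 z + x1 w, x2 z + x2 w, x3 z + x3 w).
Definition qscal (t : R) (z : R4) : R4 := (t * x0 z, t * x1 z, t * x2 z, t * x3 z).

Lemma R4_ext (z w : R4) : x0 z = x0 w -> x1 z = x1 w -> x2 z = x2 w -> x3 z = x3 w -> z = w.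
Proof.
  destruct z as [[[z0 z1] z2] z3], w as [[[w0 w1] w2] w3].
  unfold x0, x1, x2, x3; simpl. congruence.
Qed.

(** [z -> k z k], the automorphism of the algebra that reverses [i] and [j]. *)
Definition tau (z : R4) : R4 := (x0 z, - x1 z, - x2 z, x3 z).
Definition reflect3 (z : R4) : R4 := (x0 z, x1 z, x2 z, - x3 z).

Ltac qunfold := unfold tau, reflect3, qmul, qconj, qadd, qscal, inner, q0, q1, qi, qj, qk, x0, x1, x2, x3 in *;
  cbn [fst snd] in *.
Ltac qring := intros; apply R4_ext;
  unfold tau, reflect3, qmul, qconj, qadd, qscal, inner, q0, q1, qi, qj, qk, x0, x1, x2, x3;
  cbn [fst snd]; ring.

Lemma qmul_assoc x y z : qmul x (qmul y z) = qmul (qmul x y) z.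
Proof. qring. Qed.
Lemma qmul_1_l z : qmul q1 z = z.
Proof. qring. Qed.
Lemma qmul_1_r z : qmul z q1 = z.
Proof. qring. Qed.
Lemma qmul_add_l x y z : qmul (qadd x y) z = qadd (qmul x z) (qmul y z).
Proof. qring. Qed.
Lemma qmul_add_r x y z : qmul z (qadd x y) = qadd (qmul z x) (qmul z y).
Proof. qring. Qed.
Lemma qmul_scal_l t x z : qmul (qscal t x) z = qscal t (qmul x z).
Proof. qring. Qed.
Lemma qmul_scal_r t x z : qmul z (qscal t x) = qscal t (qmul z x).
Proof. qring. Qed.
Lemma qconj_mul x y : qconj (qmul x y) = qmul (qconj y) (qconj x).
Proof. qring. Qed.
Lemma qconj_invol x : qconj (qconj x) = x.
Proof. qring. Qed.
Lemma qconj_add x y : qconj (qadd x y) = qadd (qconj x) (qconj y).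
Proof. qring. Qed.
Lemma qconj_scal t x : qconj (qscal t x) = qscal t (qconj x).
Proof. qring. Qed.

Lemma inner_sym z w : inner z w = inner w z.
Proof. unfold inner; ring. Qed.
Lemma inner_add_l x y z : inner (qadd x y) z = inner x z + inner y z.
Proof. qunfold; ring. Qed.
Lemma inner_scal_l t y z : inner (qscal t y) z = t * inner y z.
Proof. qunfold; ring. Qed.
Lemma inner_add_r x y z : inner z (qadd x y) = inner z x + inner z y.
Proof. qunfold; ring. Qed.
Lemma inner_scal_r t y z : inner z (qscal t y) = t * inner z y.
Proof. qunfold; ring. Qed.

Lemma qmul_qconj z : qmul z (qconj z) = qscal (- inner z z) q1.
Proof. qring. Qed.
Lemma qconj_qmul z : qmul (qconj z) z = qscal (- inner z z) q1.
Proof. qring. Qed.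

Lemma in_H31_conj_r z : in_H31 z -> qmul z (qconj z) = q1.
Proof. intros H. rewrite qmul_qconj, H. qring. Qed.
Lemma in_H31_conj_l z : in_H31 z -> qmul (qconj z) z = q1.
Proof. intros H. rewrite qconj_qmul, H. qring. Qed.

(** The norm is multiplicative, in its polarized form. *)
Lemma inner_mul_l z x y : inner (qmul z x) (qmul z y) = - inner z z * inner x y.
Proof. qunfold; ring. Qed.
Lemma inner_mul_r z x y : inner (qmul x z) (qmul y z) = - inner z z * inner x y.
Proof. qunfold; ring. Qed.
Lemma inner_conj x y : inner (qconj x) (qconj y) = inner x y.
Proof. qunfold; ring. Qed.

Lemma in_H31_conj z : in_H31 z -> in_H31 (qconj z).
Proof. unfold in_H31. intros Hz. rewrite inner_conj. exact Hz. Qed.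

Ltac split4 := split; [|split; [|split]].
Tactic Notation "components" uconstr(lem) constr(f) :=
  first [apply R4_ext | split4];
  [ apply (lem (fun q => x0 (f q))) | apply (lem (fun q => x1 (f q)))
  | apply (lem (fun q => x2 (f q))) | apply (lem (fun q => x3 (f q))) ].

Definition is_vel (c : R -> R4) (t : R) (v : R4) : Prop :=
  is_derive (fun s => x0 (c s)) t (x0 v) /\ is_derive (fun s => x1 (c s)) t (x1 v) /\
  is_derive (fun s => x2 (c s)) t (x2 v) /\ is_derive (fun s => x3 (c s)) t (x3 v).

Lemma is_vel_velocity c t v : is_vel c t v -> velocity c t = v.
Proof.
  intros (H0 & H1 & H2 & H3). apply R4_ext; apply is_derive_unique; assumption.
Qed.

Lemma is_vel_eq c t v w : is_vel c t v -> v = w -> is_vel c t w.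
Proof. intros H <-. exact H. Qed.

Lemma is_vel_ext c d t v : (forall s, c s = d s) -> is_vel c t v -> is_vel d t v.
Proof.
  intros E H. replace d with c; [exact H|].
  apply functional_extensionality, E.
Qed.

Lemma smooth_curve_at_is_vel c t : smooth_curve_at c t -> is_vel c t (velocity c t).
Proof.
  intros (H0 & H1 & H2 & H3).
  split4; apply Derive_correct;
    [exact (H0 1%nat) | exact (H1 1%nat) | exact (H2 1%nat) | exact (H3 1%nat)].
Qed.

Lemma smooth_curve_is_vel c t : smooth_curve c -> is_vel c t (velocity c t).
Proof. intros H. apply smooth_curve_at_is_vel, H. Qed.

Lemma is_vel_const z t : is_vel (fun _ => z) t q0.
Proof. split4; apply is_derive_cst. Qed.

Lemma is_vel_conj c t v : is_vel c t v -> is_vel (fun s => qconj (c s)) t (qconj v).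
Proof.
  intros (H0 & H1 & H2 & H3). split4; auto;
    apply (is_derive_opp (V := R_NormedModule)); assumption.
Qed.

Lemma is_vel_mul c d t v w : is_vel c t v -> is_vel d t w ->
  is_vel (fun s => qmul (c s) (d s)) t (qadd (qmul v (d t)) (qmul (c t) w)).
Proof.
  intros (H0 & H1 & H2 & H3) (K0 & K1 & K2 & K3).
  assert (M := fun (f g : R -> R) a b (Hf : is_derive f t a) (Hg : is_derive g t b) =>
    is_derive_mul f g t a b Hf Hg).
  assert (A := fun (f g : R -> R) a b (Hf : is_derive f t a) (Hg : is_derive g t b) =>
    is_derive_add f g t a b Hf Hg).
  assert (B := fun (f g : R -> R) a b (Hf : is_derive f t a) (Hg : is_derive g t b) =>
    is_derive_sub f g t a b Hf Hg).
  split4.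
  - eapply is_derive_eq; [exact (A _ _ _ _ (A _ _ _ _ (B _ _ _ _ (M _ _ _ _ H0 K0) (M _ _ _ _ H1 K1)) (M _ _ _ _ H2 K2)) (M _ _ _ _ H3 K3))|].
    real_eq. qunfold. ring.
  - eapply is_derive_eq; [exact (A _ _ _ _ (B _ _ _ _ (A _ _ _ _ (M _ _ _ _ H0 K1) (M _ _ _ _ H1 K0)) (M _ _ _ _ H2 K3)) (M _ _ _ _ H3 K2))|].
    real_eq. qunfold. ring.
  - eapply is_derive_eq; [exact (A _ _ _ _ (B _ _ _ _ (A _ _ _ _ (M _ _ _ _ H0 K2) (M _ _ _ _ H2 K0)) (M _ _ _ _ H1 K3)) (M _ _ _ _ H3 K1))|].
    real_eq. qunfold. ring.
  - eapply is_derive_eq; [exact (B _ _ _ _ (A _ _ _ _ (A _ _ _ _ (M _ _ _ _ H0 K3) (M _ _ _ _ H3 K0)) (M _ _ _ _ H1 K2)) (M _ _ _ _ H2 K1))|].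
    real_eq. qunfold. ring.
Qed.

Lemma is_vel_comp c (f : R -> R) t v l : is_vel c (f t) v -> is_derive f t l ->
  is_vel (fun s => c (f s)) t (qscal l v).
Proof.
  intros (H0 & H1 & H2 & H3) Hf.
  split4; [ apply (is_derive_comp (fun s => x0 (c s)) f) | apply (is_derive_comp (fun s => x1 (c s)) f)
          | apply (is_derive_comp (fun s => x2 (c s)) f) | apply (is_derive_comp (fun s => x3 (c s)) f) ];
    assumption.
Qed.

Lemma is_derive_inner c d t v w : is_vel c t v -> is_vel d t w ->
  is_derive (fun s => inner (c s) (d s)) t (inner v (d t) + inner (c t) w).
Proof.
  intros (H0 & H1 & H2 & H3) (K0 & K1 & K2 & K3).
  apply (is_derive_ext (fun s => -1 * (x0 (c s) * x0 (d s)) - x1 (c s) * x1 (d s)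
                        + x2 (c s) * x2 (d s) + x3 (c s) * x3 (d s)));
    [intros s; real_eq; unfold inner; ring|].
  eapply is_derive_eq.
  - apply is_derive_add; [apply is_derive_add; [apply is_derive_sub; [apply is_derive_scal|]|]|];
      apply is_derive_mul; eassumption.
  - real_eq. unfold inner. ring.
Qed.

Lemma inner_const_vel c d t v w k : (forall s, inner (c s) (d s) = k) ->
  is_vel c t v -> is_vel d t w -> inner v (d t) + inner (c t) w = 0.
Proof.
  intros Hk Hc Hd. pose proof (is_derive_inner c d t v w Hc Hd) as H.
  rewrite <- (is_derive_unique _ _ _ H), (Derive_ext _ (fun _ => k) _ Hk).
  apply Derive_const.
Qed.

Lemma is_vel_0_const c : (forall t, is_vel c t q0) -> forall s t, c s = c t.
Proof.
  intros H s t.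
  components derive0_const c;
    intros r; apply (H r).
Qed.

(** * Smooth maps into the split quaternions *)

Section SmoothMaps.
Context {V : NormedModule R_AbsRing}.
Implicit Types f g : V -> R4.

Lemma smooth4_mul f g : smooth4 f -> smooth4 g -> smooth4 (fun p => qmul (f p) (g p)).
Proof.
  intros (F0 & F1 & F2 & F3) (G0 & G1 & G2 & G3). split4;
    unfold qmul, x0, x1, x2, x3 in *; cbn [fst snd] in *;
    repeat first [apply smooth_minus | apply smooth_plus | apply smooth_mult]; assumption.
Qed.

Lemma smooth4_conj f : smooth4 f -> smooth4 (fun p => qconj (f p)).
Proof. intros (F0 & F1 & F2 & F3). split4; auto; apply smooth_opp; assumption. Qed.

Lemma smooth4_scal t f : smooth4 f -> smooth4 (fun p => qscal t (f p)).
Proof.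
  intros (F0 & F1 & F2 & F3). split4; (apply smooth_mult; [apply smooth_const | assumption]).
Qed.

Lemma smooth4_const z : smooth4 (fun _ : V => z).
Proof. split4; apply smooth_const. Qed.

Lemma smooth_inner f g : smooth4 f -> smooth4 g -> smooth (fun p => inner (f p) (g p)).
Proof.
  intros (F0 & F1 & F2 & F3) (G0 & G1 & G2 & G3). unfold inner.
  repeat first [apply smooth_minus | apply smooth_plus]; apply smooth_mult; auto.
  apply smooth_opp; auto.
Qed.

Lemma smooth4_diff4 f X : smooth4 f -> smooth4 (fun p => diff4 f p X).
Proof.
  intros (F0 & F1 & F2 & F3). components smooth_dirder f;
    assumption.
Qed.

Lemma diff4_is_vel f p X : smooth4 f ->
  is_vel (fun t : R => f (plus p (scal t X))) 0 (diff4 f p X).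
Proof.
  intros (F0 & F1 & F2 & F3). components smooth_is_derive f;
    assumption.
Qed.

Lemma line_at_0_R4 f (p X : V) : f (plus p (scal (0 : R) X)) = f p.
Proof.
  f_equal. replace (scal (0 : R) X) with (zero : V) by (symmetry; exact (scal_zero_l X)).
  apply plus_zero_r.
Qed.

Lemma dirder_inner f g p X : smooth4 f -> smooth4 g ->
  dirder (fun q => inner (f q) (g q)) p X = inner (diff4 f p X) (g p) + inner (f p) (diff4 g p X).
Proof.
  intros Hf Hg. apply is_derive_unique.
  rewrite <- (line_at_0_R4 f p X), <- (line_at_0_R4 g p X).
  apply is_derive_inner; apply diff4_is_vel; assumption.
Qed.

Lemma inner_const_diff4 f g k p X : smooth4 f -> smooth4 g -> (forall q, inner (f q) (g q) = k) ->
  inner (diff4 f p X) (g p) + inner (f p) (diff4 g p X) = 0.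
Proof.
  intros Hf Hg Hk. rewrite <- dirder_inner by assumption.
  unfold dirder. rewrite (Derive_ext _ (fun _ => k)); [apply Derive_const | intros; apply Hk].
Qed.

Lemma smooth4_comp2 (F : R * R -> R4) (h1 h2 : V -> R) :
  smooth4 F -> smooth h1 -> smooth h2 -> smooth4 (fun p => F (h1 p, h2 p)).
Proof.
  intros (F0 & F1 & F2 & F3) H1 H2. components smooth_comp2 F;
    assumption.
Qed.

Lemma smooth4_curve (c : R -> R4) (h : V -> R) :
  smooth_curve c -> smooth h -> smooth4 (fun p => c (h p)).
Proof.
  intros Hc Hh. components smooth_comp_R c;
    auto; intros t; apply (Hc t).
Qed.
End SmoothMaps.

Lemma smooth_curve_iff (c : R -> R4) : smooth_curve c <-> smooth4 (V := R_NormedModule) c.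
Proof.
  split.
  - intros H. apply (smooth4_curve (V := R_NormedModule) c (fun t => t) H), smooth_id.
  - intros (F0 & F1 & F2 & F3) t. apply smooth1_iff in F0, F1, F2, F3.
    split4; [apply (F0 t) | apply (F1 t) | apply (F2 t) | apply (F3 t)].
Qed.

Lemma is_vel_chain (f : R * R -> R4) (c1 c2 : R -> R) t l1 l2 : smooth4 f ->
  is_derive c1 t l1 -> is_derive c2 t l2 ->
  is_vel (fun s => f (c1 s, c2 s)) t
    (qadd (qscal l1 (diff4 f (c1 t, c2 t) (1, 0))) (qscal l2 (diff4 f (c1 t, c2 t) (0, 1)))).
Proof.
  intros (F0 & F1 & F2 & F3) H1 H2.
  assert (H : forall F : R * R -> R, smooth F -> is_derive (fun s => F (c1 s, c2 s)) t
    (l1 * pd1 F (c1 t, c2 t) + l2 * pd2 F (c1 t, c2 t))).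
  { intros F HF. rewrite (Rmult_comm l1), (Rmult_comm l2). apply is_derive_chain; auto. }
  components H f; assumption.
Qed.

Lemma diff4_partials (f : R * R -> R4) p X : smooth4 f ->
  diff4 f p X = qadd (qscal (fst X) (diff4 f p (1, 0))) (qscal (snd X) (diff4 f p (0, 1))).
Proof.
  intros (F0 & F1 & F2 & F3).
  components dirder_partials f;
    assumption.
Qed.

Lemma diff4_schwarz (f : R * R -> R4) p : smooth4 f ->
  diff4 (fun q => diff4 f q (0, 1)) p (1, 0) = diff4 (fun q => diff4 f q (1, 0)) p (0, 1).
Proof.
  intros (F0 & F1 & F2 & F3).
  components smooth_schwarz f;
    assumption.
Qed.

Lemma diff4_unique (f : R * R -> R4) x y v w : smooth4 f ->
  is_vel (fun s => f (s, y)) x v -> is_vel (fun s => f (x, s)) y w ->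
  diff4 f (x, y) (1, 0) = v /\ diff4 f (x, y) (0, 1) = w.
Proof.
  intros (F0 & F1 & F2 & F3) (H0 & H1 & H2 & H3) (K0 & K1 & K2 & K3). split.
  - components pd1_unique f; assumption.
  - components pd2_unique f; assumption.
Qed.

(** * Linear isometries of the ambient space *)

Definition linear4 (L : R4 -> R4) : Prop :=
  forall z w t, L (qadd z (qscal t w)) = qadd (L z) (qscal t (L w)).

Lemma smooth4_id : smooth4 (fun z : R4 => z).
Proof.
  assert (C0 : forall z : R4, continuous (fun z : R4 => fst z) z)
    by (intros [w d]; apply continuous_fst).
  assert (C1 : forall z : R4, continuous (fun z : R4 => fst (fst z)) z).
  { intros z. apply (continuous_comp (fun z : R4 => fst z) (fun w : R * R * R => fst w)); auto.
    destruct z as [[w c] d]. apply continuous_fst. }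
  split4; intros n; (apply Ck_linear; [intros; reflexivity|]); intros z.
  - apply (continuous_comp (fun z : R4 => fst (fst z)) (fun w : R * R => fst w)); auto.
    destruct z as [[[a b] c] d]. apply continuous_fst.
  - apply (continuous_comp (fun z : R4 => fst (fst z)) (fun w : R * R => snd w)); auto.
    destruct z as [[[a b] c] d]. apply continuous_snd.
  - apply (continuous_comp (fun z : R4 => fst z) (fun w : R * R * R => snd w)); auto.
    destruct z as [[w c] d].
    exact (continuous_snd (V := R_UniformSpace)
             (U := prod_UniformSpace R_UniformSpace R_UniformSpace) w c).
  - destruct z as [w d].
    exact (continuous_snd (V := R_UniformSpace)
             (U := prod_UniformSpace (prod_UniformSpace R_UniformSpace R_UniformSpace) R_UniformSpace) w d).
Qed.

Lemma linear4_expand L z : linear4 L ->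
  L z = qadd (qadd (qscal (x0 z) (L q1)) (qscal (x1 z) (L qi)))
             (qadd (qscal (x2 z) (L qj)) (qscal (x3 z) (L qk))).
Proof.
  intros H.
  assert (H0 : L q0 = q0).
  { replace q0 with (qadd q1 (qscal (-1) q1)) by qring. rewrite H. qring. }
  replace z with (qadd (qadd (qadd (qadd q0 (qscal (x0 z) q1)) (qscal (x1 z) qi)) (qscal (x2 z) qj))
                    (qscal (x3 z) qk)) at 1 by qring.
  rewrite !H, H0. qring.
Qed.

Lemma smooth4_lincomb {V : NormedModule R_AbsRing} (h0 h1 h2 h3 : V -> R) b0 b1 b2 b3 :
  smooth h0 -> smooth h1 -> smooth h2 -> smooth h3 ->
  smooth4 (fun p => qadd (qadd (qscal (h0 p) b0) (qscal (h1 p) b1))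
                         (qadd (qscal (h2 p) b2) (qscal (h3 p) b3))).
Proof.
  intros. split4; repeat apply smooth_plus;
    (apply smooth_mult; [assumption | apply smooth_const]).
Qed.

Lemma linear4_smooth {V : NormedModule R_AbsRing} L (f : V -> R4) :
  linear4 L -> smooth4 f -> smooth4 (fun p => L (f p)).
Proof.
  intros HL (F0 & F1 & F2 & F3).
  replace (fun p => L (f p)) with
    (fun p => qadd (qadd (qscal (x0 (f p)) (L q1)) (qscal (x1 (f p)) (L qi)))
                   (qadd (qscal (x2 (f p)) (L qj)) (qscal (x3 (f p)) (L qk)))).
  - apply smooth4_lincomb; assumption.
  - apply functional_extensionality; intros p. symmetry. apply linear4_expand, HL.
Qed.

Lemma linear4_is_vel L c t v : linear4 L -> is_vel c t v -> is_vel (fun s => L (c s)) t (L v).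
Proof.
  intros HL (H0 & H1 & H2 & H3). rewrite (linear4_expand L v HL).
  apply (is_vel_ext (fun s => qadd (qadd (qscal (x0 (c s)) (L q1)) (qscal (x1 (c s)) (L qi)))
                   (qadd (qscal (x2 (c s)) (L qj)) (qscal (x3 (c s)) (L qk)))));
    [intros; symmetry; apply linear4_expand, HL|].
  assert (Hm : forall (f : R -> R) l b, is_derive f t l -> is_derive (fun s => f s * b) t (l * b)).
  { intros f l b Hf. eapply is_derive_eq; [apply (is_derive_mul f (fun _ => b) t l 0 Hf), is_derive_cst|].
    real_eq. cbv beta. ring. }
  split4; repeat apply is_derive_add; apply Hm; assumption.
Qed.

Lemma linear4_diff4 {V : NormedModule R_AbsRing} L (f : V -> R4) p X : linear4 L -> smooth4 f ->
  diff4 (fun q => L (f q)) p X = L (diff4 f p X).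
Proof.
  intros HL Hf.
  exact (is_vel_velocity _ _ _ (linear4_is_vel L _ _ _ HL (diff4_is_vel f p X Hf))).
Qed.

Definition linear_isometry (L : R4 -> R4) : Prop :=
  linear4 L /\ (forall z w, inner (L z) (L w) = inner z w) /\
  exists M, linear4 M /\ (forall z, M (L z) = z) /\ (forall z, L (M z) = z).

Lemma linear_isometry_comp L L' : linear_isometry L -> linear_isometry L' ->
  linear_isometry (fun z => L' (L z)).
Proof.
  intros (HL & IL & M & HM & ML & LM) (HL' & IL' & M' & HM' & ML' & LM'). split; [|split].
  - intros z w t. rewrite HL, HL'. reflexivity.
  - intros z w. rewrite IL', IL. reflexivity.
  - exists (fun z => M (M' z)). split; [|split].
    + intros z w t. rewrite HM', HM. reflexivity.
    + intros z. rewrite ML', ML. reflexivity.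
    + intros z. rewrite LM, LM'. reflexivity.
Qed.

Lemma linear_isometry_H31 L : linear_isometry L -> isometry_H31 L.
Proof.
  intros (HL & IL & M & HM & ML & LM).
  assert (SL : smooth4 L) by (apply (linear4_smooth L (fun z => z) HL), smooth4_id).
  assert (SM : smooth4 M) by (apply (linear4_smooth M (fun z => z) HM), smooth4_id).
  split; [exact SL|]. split; [|split].
  - intros z Hz. unfold in_H31. rewrite IL. exact Hz.
  - exists M. split; [exact SM|]. split.
    + intros z Hz. unfold in_H31. rewrite <- IL, LM. exact Hz.
    + intros z _. auto.
  - assert (HD : forall z X, diff4 L z X = L X).
    { intros z X. etransitivity; [exact (linear4_diff4 L (fun z => z) z X HL smooth4_id)|].
      assert (D : forall a b : R, is_derive (fun t => a + t * b) 0 b)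
        by (intros; auto_derive; auto; ring).
      f_equal. apply R4_ext;
        [ exact (is_derive_unique _ _ _ (D (x0 z) (x0 X))) | exact (is_derive_unique _ _ _ (D (x1 z) (x1 X)))
        | exact (is_derive_unique _ _ _ (D (x2 z) (x2 X))) | exact (is_derive_unique _ _ _ (D (x3 z) (x3 X))) ]. }
    intros z X Y _ _ _. rewrite !HD. apply IL.
Qed.

(** * Adapted frames *)

Definition adapted (G X Y : R4) : Prop :=
  in_H31 G /\ inner G X = 0 /\ inner G Y = 0 /\
  inner X X = -1 /\ inner X Y = 0 /\ inner Y Y = 1.

(** [conj G X] and [conj G Y] are orthonormal and imaginary, so their product is
    imaginary and completes the frame. The sign turns [i], [k] at [1] into [j]. *)
Definition normal (G X Y : R4) : R4 := qscal (-1) (qmul (qmul X (qconj G)) Y).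

Lemma qconj_tangent_sum G X : qadd (qmul (qconj X) G) (qmul (qconj G) X) = qscal (-2 * inner G X) q1.
Proof. qring. Qed.

Lemma qconj_tangent_sum_r G X : qadd (qmul X (qconj G)) (qmul G (qconj X)) = qscal (-2 * inner G X) q1.
Proof. qring. Qed.

Lemma qadd_scal_0 z w : qadd z w = q0 -> z = qscal (-1) w.
Proof.
  intros H. replace z with (qadd (qadd z w) (qscal (-1) w)) by qring. rewrite H. qring.
Qed.

Lemma qconj_tangent_l G X : inner G X = 0 -> qmul (qconj X) G = qscal (-1) (qmul (qconj G) X).
Proof.
  intros H. apply qadd_scal_0. rewrite qconj_tangent_sum, H. qring.
Qed.

Lemma qconj_tangent_r G X : inner G X = 0 -> qmul G (qconj X) = qscal (-1) (qmul X (qconj G)).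
Proof.
  intros H. apply qadd_scal_0.
  replace (qadd (qmul G (qconj X)) (qmul X (qconj G))) with
    (qadd (qmul X (qconj G)) (qmul G (qconj X))) by qring.
  rewrite qconj_tangent_sum_r, H. qring.
Qed.

Lemma qconj_tangent G X : in_H31 G -> inner G X = 0 ->
  qconj X = qscal (-1) (qmul (qmul (qconj G) X) (qconj G)).
Proof.
  intros HG H. rewrite <- (qmul_1_r (qconj X)), <- (in_H31_conj_r G HG), qmul_assoc.
  rewrite (qconj_tangent_l G X H), qmul_scal_l. reflexivity.
Qed.

Lemma inner_1_r z : inner z q1 = - x0 z.
Proof. qunfold; ring. Qed.

Lemma inner_unit_l G z w : in_H31 G -> inner (qmul (qconj G) z) (qmul (qconj G) w) = inner z w.
Proof. intros H. rewrite inner_mul_l, (in_H31_conj G H). ring. Qed.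

Section Adapted.
Variables G X Y : R4.
Hypothesis HF : adapted G X Y.
Notation N := (normal G X Y).

Lemma frame_conjX_Y : qmul (qconj X) Y = qmul (qconj G) N.
Proof.
  destruct HF as (HG & GX & GY & XX & XY & YY).
  rewrite (qconj_tangent G X HG GX). unfold normal.
  rewrite qmul_scal_l, qmul_scal_r, !qmul_assoc. reflexivity.
Qed.

Lemma frame_X_conjY : qmul X (qconj Y) = qmul N (qconj G).
Proof.
  destruct HF as (HG & GX & GY & XX & XY & YY).
  rewrite (qconj_tangent G Y HG GY). unfold normal.
  rewrite qmul_scal_l, qmul_scal_r, !qmul_assoc. reflexivity.
Qed.

Lemma normal_G : inner N G = 0.
Proof.
  destruct HF as (HG & GX & GY & XX & XY & YY).
  rewrite <- (inner_unit_l G) by assumption.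
  rewrite <- frame_conjX_Y, (in_H31_conj_l G HG), inner_1_r.
  rewrite <- XY. qunfold; ring.
Qed.

Lemma normal_X : inner N X = 0.
Proof.
  destruct HF as (HG & GX & GY & XX & XY & YY).
  rewrite <- (inner_unit_l G) by assumption.
  replace (qmul (qconj G) X) with (qscal (-1) (qmul (qconj X) G))
    by (rewrite (qconj_tangent_l G X GX); qring).
  rewrite <- frame_conjX_Y, inner_scal_r, inner_mul_l, (inner_sym Y), GY. ring.
Qed.

Lemma normal_Y : inner N Y = 0.
Proof.
  destruct HF as (HG & GX & GY & XX & XY & YY).
  unfold normal. rewrite inner_scal_l.
  replace (inner (qmul (qmul X (qconj G)) Y) Y) with (inner (qmul (qmul X (qconj G)) Y) (qmul q1 Y))
    by (rewrite qmul_1_l; reflexivity).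
  rewrite inner_mul_r, inner_1_r.
  replace (x0 (qmul X (qconj G))) with (- inner G X) by (qunfold; ring). rewrite GX. ring.
Qed.

Lemma normal_N : inner N N = 1.
Proof.
  destruct HF as (HG & GX & GY & XX & XY & YY).
  unfold normal. rewrite inner_scal_l, inner_scal_r, inner_mul_r, inner_mul_r, inner_conj, HG, XX, YY.
  ring.
Qed.

Lemma frame_conjY_X : qmul (qconj Y) X = qscal (-1) (qmul (qconj G) N).
Proof.
  rewrite <- (qconj_invol (qmul (qconj Y) X)), qconj_mul, qconj_invol, frame_conjX_Y.
  rewrite qconj_mul, qconj_invol. apply qconj_tangent_l.
  rewrite inner_sym. apply normal_G.
Qed.

Lemma frame_Y_conjX : qmul Y (qconj X) = qscal (-1) (qmul N (qconj G)).
Proof.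
  rewrite <- (qconj_invol (qmul Y (qconj X))), qconj_mul, qconj_invol, frame_X_conjY.
  rewrite qconj_mul, qconj_invol. apply qconj_tangent_r.
  rewrite inner_sym. apply normal_G.
Qed.

(** Cramer's rule for two orthonormal imaginary vectors and their cross product. *)
Lemma imaginary_expand (P Q w : R4) : x0 P = 0 -> x0 Q = 0 ->
  inner P P = -1 -> inner P Q = 0 -> inner Q Q = 1 ->
  let C := qscal (-1) (qmul P Q) in
  w = qadd (qadd (qscal (x0 w) q1) (qscal (- inner w P) P))
           (qadd (qscal (inner w C) C) (qscal (inner w Q) Q)).
Proof.
  destruct P as [[[p0 p1] p2] p3], Q as [[[r0 r1] r2] r3], w as [[[w0 w1] w2] w3].
  intros P0 Q0 PP PQ QQ. cbv zeta. qunfold. subst p0 r0.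
  set (c1 := p2 * r3 - p3 * r2). set (c2 := p1 * r3 - p3 * r1). set (c3 := p2 * r1 - p1 * r2).
  set (wP := - w1 * p1 + w2 * p2 + w3 * p3). set (wQ := - w1 * r1 + w2 * r2 + w3 * r3).
  set (wC := - w1 * c1 + w2 * c2 + w3 * c3).
  assert (D : forall z y, - ((- p1 * p1 + p2 * p2 + p3 * p3) * (- r1 * r1 + r2 * r2 + r3 * r3)
      - (- p1 * r1 + p2 * r2 + p3 * r3) * (- p1 * r1 + p2 * r2 + p3 * r3)) * z = y -> z = y).
  { intros z y <-.
    replace (- p1 * p1 + p2 * p2 + p3 * p3) with (-1) by lra.
    replace (- p1 * r1 + p2 * r2 + p3 * r3) with 0 by lra.
    replace (- r1 * r1 + r2 * r2 + r3 * r3) with 1 by lra. ring. }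
  assert (E : forall c p r y, y = wC * c
      - (wP * (- r1 * r1 + r2 * r2 + r3 * r3) - wQ * (- p1 * r1 + p2 * r2 + p3 * r3)) * p
      - (wQ * (- p1 * p1 + p2 * p2 + p3 * p3) - wP * (- p1 * r1 + p2 * r2 + p3 * r3)) * r ->
      y = - wP * p + (wC * c + wQ * r)).
  { intros c p r y ->.
    replace (- p1 * p1 + p2 * p2 + p3 * p3) with (-1) by lra.
    replace (- p1 * r1 + p2 * r2 + p3 * r3) with 0 by lra.
    replace (- r1 * r1 + r2 * r2 + r3 * r3) with 1 by lra. ring. }
  assert (E1 : w1 = - wP * p1 + (wC * c1 + wQ * r1))
    by (apply E, D; unfold wP, wQ, wC, c1, c2, c3; ring).
  assert (E2 : w2 = - wP * p2 + (wC * c2 + wQ * r2))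
    by (apply E, D; unfold wP, wQ, wC, c1, c2, c3; ring).
  assert (E3 : w3 = - wP * p3 + (wC * c3 + wQ * r3))
    by (apply E, D; unfold wP, wQ, wC, c1, c2, c3; ring).
  assert (C0 : - p1 * r1 + p2 * r2 + p3 * r3 = 0) by lra.
  apply R4_ext; qunfold.
  all: replace (0 * 0 - p1 * r1 + p2 * r2 + p3 * r3) with 0 by lra.
  - ring.
  - etransitivity; [exact E1|]. unfold wP, wQ, wC, c1, c2, c3. ring.
  - etransitivity; [exact E2|]. unfold wP, wQ, wC, c1, c2, c3. ring.
  - etransitivity; [exact E3|]. unfold wP, wQ, wC, c1, c2, c3. ring.
Qed.

Lemma frame_expand z :
  z = qadd (qadd (qscal (- inner z G) G) (qscal (- inner z X) X))
           (qadd (qscal (inner z N) N) (qscal (inner z Y) Y)).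
Proof.
  destruct HF as (HG & GX & GY & XX & XY & YY).
  assert (Hcancel : forall a b, qmul (qconj G) a = qmul (qconj G) b -> a = b).
  { intros a b E. rewrite <- (qmul_1_l a), <- (qmul_1_l b), <- (in_H31_conj_r G HG), <- !qmul_assoc, E.
    reflexivity. }
  apply Hcancel. rewrite !qmul_add_r, !qmul_scal_r, (in_H31_conj_l G HG).
  rewrite <- (inner_unit_l G z G HG), <- (inner_unit_l G z X HG), <- (inner_unit_l G z N HG),
    <- (inner_unit_l G z Y HG), (in_H31_conj_l G HG).
  assert (HN : qmul (qconj G) N = qscal (-1) (qmul (qmul (qconj G) X) (qmul (qconj G) Y))).
  { unfold normal. rewrite qmul_scal_r, !qmul_assoc. reflexivity. }
  rewrite HN, inner_1_r, Ropp_involutive.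
  assert (H0 : forall W, inner G W = 0 -> x0 (qmul (qconj G) W) = 0).
  { intros W HW. replace (x0 (qmul (qconj G) W)) with (- inner G W) by (qunfold; ring). rewrite HW. ring. }
  apply imaginary_expand; rewrite ?inner_unit_l; auto.
Qed.

Lemma inner_expand z w :
  inner z w = - inner z G * inner w G - inner z X * inner w X
              + inner z N * inner w N + inner z Y * inner w Y.
Proof.
  rewrite (frame_expand z) at 1. rewrite !inner_add_l, !inner_scal_l.
  rewrite (inner_sym G w), (inner_sym X w), (inner_sym N w), (inner_sym Y w). ring.
Qed.

Lemma inner_GG : inner G G = -1.
Proof. apply HF. Qed.

(** The minus signs compensate the negative squares of [G] and [X]. *)
Definition frame_coord (z : R4) : R4 := (- inner z G, - inner z X, inner z N, inner z Y).

Lemma frame_coord_isometry : linear_isometry frame_coord.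
Proof.
  destruct HF as (HG & GX & GY & XX & XY & YY).
  split; [|split].
  - intros z w t. unfold frame_coord. rewrite !inner_add_l, !inner_scal_l. qring.
  - intros z w. rewrite (inner_expand z w). unfold frame_coord, inner at 1. unfold x0, x1, x2, x3.
    cbn [fst snd]. ring.
  - exists (fun w => qadd (qadd (qscal (x0 w) G) (qscal (x1 w) X))
                          (qadd (qscal (x2 w) N) (qscal (x3 w) Y))).
    split; [|split].
    + intros z w t. qring.
    + intros z. symmetry. exact (frame_expand z).
    + intros z. unfold frame_coord. rewrite !inner_add_l, !inner_scal_l.
      rewrite normal_N, normal_X, normal_Y, normal_G, inner_GG, XX, XY, YY, GX, GY.
      rewrite (inner_sym X G), (inner_sym Y G), (inner_sym Y X), (inner_sym G N), (inner_sym X N), (inner_sym Y N).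
      rewrite normal_X, normal_Y, normal_G, XY, GX, GY. qring.
Qed.

Lemma frame_coord_G : frame_coord G = q1.
Proof.
  destruct HF as (HG & GX & GY & XX & XY & YY). unfold frame_coord.
  rewrite inner_GG, GX, GY, (inner_sym G N), normal_G. qring.
Qed.

Lemma frame_coord_X : frame_coord X = qi.
Proof.
  destruct HF as (HG & GX & GY & XX & XY & YY). unfold frame_coord.
  rewrite (inner_sym X G), GX, XX, XY, (inner_sym X N), normal_X. qring.
Qed.

Lemma frame_coord_Y : frame_coord Y = qk.
Proof.
  destruct HF as (HG & GX & GY & XX & XY & YY). unfold frame_coord.
  rewrite (inner_sym Y G), (inner_sym Y X), GY, XY, YY, (inner_sym Y N), normal_Y. qring.
Qed.

End Adapted.

(** * The Gauss and Codazzi equations of a flat surface *)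

Section Flat.
Variable G : R * R -> R4.
Hypothesis SG : smooth4 G.
Hypothesis HG : forall p, in_H31 (G p).
Notation Gx := (fun p : R * R => diff4 G p (1, 0)).
Notation Gy := (fun p : R * R => diff4 G p (0, 1)).
Hypothesis HXX : forall p : R * R, inner (diff4 G p (1, 0)) (diff4 G p (1, 0)) = -1.
Hypothesis HXY : forall p : R * R, inner (diff4 G p (1, 0)) (diff4 G p (0, 1)) = 0.
Hypothesis HYY : forall p : R * R, inner (diff4 G p (0, 1)) (diff4 G p (0, 1)) = 1.

Definition flat_normal (p : R * R) : R4 := normal (G p) (diff4 G p (1, 0)) (diff4 G p (0, 1)).
Notation N := flat_normal.

Definition sff_xx (p : R * R) : R := inner (diff4 Gx p (1, 0)) (N p).
Definition sff_xy (p : R * R) : R := inner (diff4 Gx p (0, 1)) (N p).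
Definition sff_yy (p : R * R) : R := inner (diff4 Gy p (0, 1)) (N p).

Lemma flat_adapted p : adapted (G p) (diff4 G p (1, 0)) (diff4 G p (0, 1)).
Proof.
  assert (H : forall X, inner (G p) (diff4 G p X) = 0).
  { intros X. pose proof (inner_const_diff4 G G (-1) p X SG SG HG) as E.
    rewrite (inner_sym (diff4 G p X)) in E. lra. }
  repeat split; auto.
Qed.

Lemma SGx : smooth4 Gx. Proof. apply smooth4_diff4, SG. Qed.
Lemma SGy : smooth4 Gy. Proof. apply smooth4_diff4, SG. Qed.
Lemma SN : smooth4 N.
Proof.
  apply smooth4_scal, smooth4_mul; [|exact SGy].
  apply smooth4_mul; [exact SGx | apply smooth4_conj, SG].
Qed.

Lemma flat_mixed p : diff4 Gy p (1, 0) = diff4 Gx p (0, 1).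
Proof. exact (diff4_schwarz G p SG). Qed.

Lemma smooth_sff : smooth sff_xx /\ smooth sff_xy /\ smooth sff_yy.
Proof.
  repeat split; apply smooth_inner; try exact SN; apply smooth4_diff4; first [exact SGx | exact SGy].
Qed.

Lemma flat_G_N p : inner (N p) (G p) = 0.
Proof. apply normal_G, flat_adapted. Qed.
Lemma flat_Gx_N p : inner (N p) (diff4 G p (1, 0)) = 0.
Proof. apply normal_X, flat_adapted. Qed.
Lemma flat_Gy_N p : inner (N p) (diff4 G p (0, 1)) = 0.
Proof. apply normal_Y, flat_adapted. Qed.
Lemma flat_N_N p : inner (N p) (N p) = 1.
Proof. apply normal_N, flat_adapted. Qed.
Lemma flat_Gx_G p : inner (diff4 G p (1, 0)) (G p) = 0.
Proof. rewrite inner_sym. apply (flat_adapted p). Qed.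
Lemma flat_Gy_G p : inner (diff4 G p (0, 1)) (G p) = 0.
Proof. rewrite inner_sym. apply (flat_adapted p). Qed.

Lemma flat_expand p z :
  z = qadd (qadd (qscal (- inner z (G p)) (G p)) (qscal (- inner z (diff4 G p (1, 0))) (diff4 G p (1, 0))))
           (qadd (qscal (inner z (N p)) (N p)) (qscal (inner z (diff4 G p (0, 1))) (diff4 G p (0, 1)))).
Proof. apply (frame_expand _ _ _ (flat_adapted p)). Qed.

Lemma flat_Gxx p : diff4 Gx p (1, 0) = qadd (qscal (-1) (G p)) (qscal (sff_xx p) (N p)).
Proof.
  rewrite (flat_expand p (diff4 Gx p (1, 0))).
  pose proof (inner_const_diff4 Gx G 0 p (1, 0) SGx SG flat_Gx_G) as E1.
  pose proof (inner_const_diff4 Gx Gx (-1) p (1, 0) SGx SGx HXX) as E2.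
  pose proof (inner_const_diff4 Gx Gy 0 p (1, 0) SGx SGy HXY) as E3.
  pose proof (inner_const_diff4 Gx Gx (-1) p (0, 1) SGx SGx HXX) as E4.
  cbv beta in *. rewrite flat_mixed in E3. rewrite HXX in E1.
  rewrite (inner_sym (diff4 G p (1, 0)) (diff4 Gx p (1, 0))) in E2.
  rewrite (inner_sym (diff4 G p (1, 0)) (diff4 Gx p (0, 1))) in E3, E4.
  fold (sff_xx p).
  replace (inner (diff4 Gx p (1, 0)) (G p)) with 1 by lra.
  replace (inner (diff4 Gx p (1, 0)) (diff4 G p (1, 0))) with 0 by lra.
  replace (inner (diff4 Gx p (1, 0)) (diff4 G p (0, 1))) with 0 by lra.
  qring.
Qed.

Lemma flat_Gxy p : diff4 Gx p (0, 1) = qscal (sff_xy p) (N p).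
Proof.
  rewrite (flat_expand p (diff4 Gx p (0, 1))).
  pose proof (inner_const_diff4 Gx G 0 p (0, 1) SGx SG flat_Gx_G) as E1.
  pose proof (inner_const_diff4 Gx Gx (-1) p (0, 1) SGx SGx HXX) as E2.
  pose proof (inner_const_diff4 Gy Gy 1 p (1, 0) SGy SGy HYY) as E3.
  cbv beta in *. rewrite flat_mixed in E3. rewrite HXY in E1.
  rewrite (inner_sym (diff4 G p (1, 0)) (diff4 Gx p (0, 1))) in E2.
  rewrite (inner_sym (diff4 G p (0, 1)) (diff4 Gx p (0, 1))) in E3.
  fold (sff_xy p).
  replace (inner (diff4 Gx p (0, 1)) (G p)) with 0 by lra.
  replace (inner (diff4 Gx p (0, 1)) (diff4 G p (1, 0))) with 0 by lra.
  replace (inner (diff4 Gx p (0, 1)) (diff4 G p (0, 1))) with 0 by lra.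
  qring.
Qed.

Lemma flat_Gyy p : diff4 Gy p (0, 1) = qadd (G p) (qscal (sff_yy p) (N p)).
Proof.
  rewrite (flat_expand p (diff4 Gy p (0, 1))).
  pose proof (inner_const_diff4 Gy G 0 p (0, 1) SGy SG flat_Gy_G) as E1.
  pose proof (inner_const_diff4 Gy Gy 1 p (0, 1) SGy SGy HYY) as E2.
  pose proof (inner_const_diff4 Gx Gy 0 p (0, 1) SGx SGy HXY) as E3.
  pose proof (inner_const_diff4 Gy Gy 1 p (1, 0) SGy SGy HYY) as E4.
  cbv beta in *. rewrite flat_mixed in E4. rewrite HYY in E1.
  rewrite (inner_sym (diff4 G p (0, 1)) (diff4 Gy p (0, 1))) in E2.
  rewrite (inner_sym (diff4 G p (0, 1)) (diff4 Gx p (0, 1))) in E4.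
  rewrite (inner_sym (diff4 G p (1, 0)) (diff4 Gy p (0, 1))) in E3.
  fold (sff_yy p).
  replace (inner (diff4 Gy p (0, 1)) (G p)) with (-1) by lra.
  replace (inner (diff4 Gy p (0, 1)) (diff4 G p (1, 0))) with 0 by lra.
  replace (inner (diff4 Gy p (0, 1)) (diff4 G p (0, 1))) with 0 by lra.
  qring.
Qed.

Lemma inner_G_dN p X : inner (G p) (diff4 N p X) = - inner (diff4 G p X) (N p).
Proof. pose proof (inner_const_diff4 N G 0 p X SN SG flat_G_N). rewrite (inner_sym (G p)), (inner_sym _ (N p)). lra. Qed.

Lemma inner_N_dN p X : inner (N p) (diff4 N p X) = 0.
Proof.
  pose proof (inner_const_diff4 N N 1 p X SN SN flat_N_N) as E.
  rewrite (inner_sym _ (N p)) in E. lra.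
Qed.

Lemma inner_G_dN1 p : inner (G p) (diff4 N p (1, 0)) = 0.
Proof. rewrite inner_G_dN, inner_sym, flat_Gx_N. ring. Qed.
Lemma inner_G_dN2 p : inner (G p) (diff4 N p (0, 1)) = 0.
Proof. rewrite inner_G_dN, inner_sym, flat_Gy_N. ring. Qed.

(** Both sides are the normal component of the same third derivative of [G]: the
    remaining terms vanish because the derivatives of the normal are tangent. *)
Lemma codazzi_x p : pd2 sff_xx p = pd1 sff_xy p.
Proof.
  unfold sff_xx, sff_xy. rewrite !dirder_inner; try exact SN; try (apply smooth4_diff4, SGx).
  cbv beta. rewrite flat_Gxx, flat_Gxy, !inner_add_l, !inner_scal_l, inner_G_dN2, !inner_N_dN.
  rewrite (diff4_schwarz Gx p SGx). ring.
Qed.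

Lemma codazzi_y p : pd2 sff_xy p = pd1 sff_yy p.
Proof.
  unfold sff_yy, sff_xy. rewrite !dirder_inner; try exact SN; try (apply smooth4_diff4, SGx);
    try (apply smooth4_diff4, SGy).
  cbv beta. rewrite flat_Gyy, flat_Gxy, !inner_add_l, !inner_scal_l, inner_G_dN1, !inner_N_dN.
  rewrite (diff4_schwarz Gy p SGy).
  replace (fun q => diff4 Gy q (1, 0)) with (fun q => diff4 Gx q (0, 1)); [ring|].
  apply functional_extensionality; intros q. symmetry. apply flat_mixed.
Qed.

(** Differentiating the two vanishing products of [G_xx] and [G_xy] with [G_y] and
    exchanging third derivatives equates [inner G_xx G_yy] with [inner G_xy G_xy]. *)
Lemma gauss p : sff_xx p * sff_yy p = sff_xy p * sff_xy p - 1.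
Proof.
  assert (E1 : forall q, inner (diff4 Gx q (1, 0)) (diff4 G q (0, 1)) = 0).
  { intros q. rewrite flat_Gxx, inner_add_l, !inner_scal_l, flat_Gy_N, inner_sym, flat_Gy_G. ring. }
  assert (E2 : forall q, inner (diff4 Gx q (0, 1)) (diff4 G q (0, 1)) = 0).
  { intros q. rewrite flat_Gxy, !inner_scal_l, flat_Gy_N. ring. }
  assert (S1 : smooth4 (fun q => diff4 Gx q (1, 0))) by apply smooth4_diff4, SGx.
  assert (S2 : smooth4 (fun q => diff4 Gx q (0, 1))) by apply smooth4_diff4, SGx.
  pose proof (inner_const_diff4 _ Gy 0 p (0, 1) S1 SGy E1) as H1.
  pose proof (inner_const_diff4 _ Gy 0 p (1, 0) S2 SGy E2) as H2.
  cbv beta in *. rewrite flat_mixed in H2. rewrite <- (diff4_schwarz Gx p SGx) in H1.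
  assert (H : inner (diff4 Gx p (1, 0)) (diff4 Gy p (0, 1))
              = inner (diff4 Gx p (0, 1)) (diff4 Gx p (0, 1))) by lra.
  rewrite flat_Gxx, flat_Gxy, flat_Gyy in H.
  rewrite !inner_add_l, !inner_add_r, !inner_scal_l, !inner_scal_r in H.
  rewrite flat_N_N, (inner_sym (G p) (N p)), flat_G_N, (HG p) in H. lra.
Qed.
End Flat.

(** * Asymptotic angles *)

Lemma pd_zero_const (F : R * R -> R) : smooth F ->
  (forall p : R * R, pd1 F p = 0) -> (forall p : R * R, pd2 F p = 0) -> forall p, F p = F (0, 0).
Proof.
  intros HF H1 H2 [x y].
  transitivity (F (x, 0)).
  - apply (derive0_const (fun t => F (x, t))). intros t. 
    eapply is_derive_eq; [apply is_derive_pd2, HF | apply H2].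
  - apply (derive0_const (fun t => F (t, 0))). intros t.
    eapply is_derive_eq; [apply is_derive_pd1, HF | apply H1].
Qed.

(** A smooth map from the plane to the unit circle lifts to the line: the lift
    is a potential of the pulled back angular form. *)
Lemma angle_lift (c s : R * R -> R) x : smooth c -> smooth s ->
  (forall p, c p * c p + s p * s p = 1) -> cos x = c (0, 0) -> sin x = s (0, 0) ->
  exists chi : R * R -> R, smooth chi /\ chi (0, 0) = x /\
    forall p, cos (chi p) = c p /\ sin (chi p) = s p.
Proof.
  intros Sc Ss H1 Hc0 Hs0.
  assert (HD : forall p X : R * R, c p * dirder c p X + s p * dirder s p X = 0).
  { intros p X.
    assert (E : dirder (fun q => c q * c q + s q * s q) p X = 0).
    { unfold dirder. rewrite (Derive_ext _ (fun _ => 1)); [apply Derive_const | intros; apply H1]. }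
    rewrite dirder_plus, !dirder_mult in E; try assumption; try (apply smooth_mult; assumption). lra. }
  assert (S1 : forall X : R * R, smooth (fun p => c p * dirder s p X - s p * dirder c p X)).
  { intros X. apply smooth_minus; apply smooth_mult; auto; apply smooth_dirder; assumption. }
  destruct (poincare (fun p => c p * pd1 s p - s p * pd1 c p)
                     (fun p => c p * pd2 s p - s p * pd2 c p) (S1 (1, 0)) (S1 (0, 1)))
    as [U [SU [U0 [UX UY]]]].
  - intros p.
    assert (Sd : forall X : R * R, smooth (fun q => dirder s q X)) by (intros; apply smooth_dirder, Ss).
    assert (Cd : forall X : R * R, smooth (fun q => dirder c q X)) by (intros; apply smooth_dirder, Sc).
    rewrite !dirder_minus, !dirder_mult; auto; try (apply smooth_mult; auto).
    rewrite (smooth_schwarz s p Ss), (smooth_schwarz c p Sc).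
    pose proof (HD p (1, 0)) as E1. pose proof (HD p (0, 1)) as E2. pose proof (H1 p) as E.
    set (c1 := pd1 c p) in *. set (s1 := pd1 s p) in *.
    set (c2 := pd2 c p) in *. set (s2 := pd2 s p) in *.
    set (k := c p) in *. set (l := s p) in *. cbv beta. fold k l c1 c2 s1 s2.
    assert (HJ : c2 * s1 = c1 * s2).
    { transitivity ((k * k + l * l) * (c2 * s1)); [rewrite E; ring|].
      transitivity ((k * k + l * l) * (c1 * s2)); [|rewrite E; ring].
      apply Rminus_diag_uniq.
      transitivity ((k * s1 - l * c1) * (k * c2 + l * s2) - (k * s2 - l * c2) * (k * c1 + l * s1)); [ring|].
      rewrite E1, E2. ring. }
    lra.
  - set (chi := fun p => x + U p).
    assert (Schi : smooth chi) by (apply smooth_plus; [apply smooth_const | exact SU]).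
    assert (Dchi : forall p : R * R, pd1 chi p = c p * pd1 s p - s p * pd1 c p /\
                                     pd2 chi p = c p * pd2 s p - s p * pd2 c p).
    { intros p. unfold chi. rewrite !dirder_plus, !dirder_const, UX, UY; try exact SU; try apply smooth_const.
      split; ring. }
    assert (SF : smooth (fun p => c p * cos (chi p) + s p * sin (chi p)))
      by (apply smooth_plus; apply smooth_mult; auto; [apply smooth_cos | apply smooth_sin]; auto).
    assert (SH : smooth (fun p => s p * cos (chi p) - c p * sin (chi p)))
      by (apply smooth_minus; apply smooth_mult; auto; [apply smooth_cos | apply smooth_sin]; auto).
    assert (Hz : forall p X : R * R, dirder chi p X = c p * dirder s p X - s p * dirder c p X ->
      dirder (fun p => c p * cos (chi p) + s p * sin (chi p)) p X = 0 /\
      dirder (fun p => s p * cos (chi p) - c p * sin (chi p)) p X = 0).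
    { intros p X E.
      assert (Sco := smooth_cos _ Schi). assert (Ssi := smooth_sin _ Schi).
      rewrite dirder_plus, dirder_minus, !dirder_mult, dirder_cos, dirder_sin; auto;
        try (apply smooth_mult; auto).
      pose proof (HD p X) as ED. pose proof (H1 p) as EE. rewrite E.
      set (dc := dirder c p X) in *. set (ds := dirder s p X) in *.
      set (k := c p) in *. set (l := s p) in *. set (a := cos (chi p)). set (b := sin (chi p)).
      split.
      - transitivity (a * (k * (k * dc + l * ds)) + b * (l * (k * dc + l * ds))
          + (a * dc + b * ds) * (1 - (k * k + l * l))); [ring|]. rewrite ED, EE. ring.
      - transitivity (a * (l * (k * dc + l * ds)) - b * (k * (k * dc + l * ds))
          + (a * ds - b * dc) * (1 - (k * k + l * l))); [ring|]. rewrite ED, EE. ring. }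
    exists chi. split; [exact Schi|]. split; [unfold chi; rewrite U0; ring|].
    intros p.
    pose proof (pd_zero_const _ SF (fun p => proj1 (Hz p (1, 0) (proj1 (Dchi p))))
                  (fun p => proj1 (Hz p (0, 1) (proj2 (Dchi p)))) p) as E1.
    pose proof (pd_zero_const _ SH (fun p => proj2 (Hz p (1, 0) (proj1 (Dchi p))))
                  (fun p => proj2 (Hz p (0, 1) (proj2 (Dchi p)))) p) as E2.
    assert (E0 : chi (0, 0) = x) by (unfold chi; rewrite U0; ring).
    cbv beta in E1, E2. rewrite E0, Hc0, Hs0 in E1, E2. rewrite H1 in E1.
    pose proof (sin2_cos2_mult (chi p)) as ET.
    set (a := cos (chi p)) in *. set (b := sin (chi p)) in *. set (k := c p) in *. set (l := s p) in *.
    assert (E2' : l * a - k * b = 0) by lra.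
    split.
    + transitivity (a * (k * a + l * b) + b * (k * b - l * a) + 0); [|].
      * rewrite E1. replace (k * b - l * a) with 0 by lra. ring.
      * transitivity (k * (b * b + a * a)); [ring | rewrite ET; ring].
    + transitivity (b * (k * a + l * b) + a * (l * a - k * b) + 0).
      * rewrite E1, E2'. ring.
      * transitivity (l * (b * b + a * a)); [ring | rewrite ET; ring].
Qed.

Lemma smooth1_atan : smooth1 atan.
Proof.
  apply (smooth1_of_Derive atan (fun x => / (1 + x * x))).
  - intros t. eapply is_derive_eq; [apply is_derive_atan|]. unfold Rsqr. reflexivity.
  - apply smooth1_iff, smooth_inv.
    + apply smooth_plus; [apply smooth_const | apply smooth_mult; apply smooth_id].
    + intros p. pose proof (Rle_0_sqr p) as H. unfold Rsqr in H.
      intros E. change (1 + p * p = 0) in E. lra.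
Qed.

(** The angle is normalized for its later use, where [1 / 2 * (s0 + x)] is to lie in
    [[0, PI)]. *)
Lemma unit_circle_angle c s s0 : c * c + s * s = 1 -> 0 < s0 < PI ->
  exists x, cos x = c /\ sin x = s /\ 0 <= s0 + x < 2 * PI.
Proof.
  intros H Hs0.
  assert (Hc : -1 <= c <= 1) by nra.
  assert (Hx : exists x, cos x = c /\ sin x = s /\ - PI <= x <= PI).
  { pose proof (acos_bound c) as Hb. pose proof (cos_acos c Hc) as Ec.
    assert (Es : sin (acos c) = sqrt (1 - c²)) by (apply sin_acos; exact Hc).
    assert (Hsq : 1 - c² = s * s) by (unfold Rsqr; lra).
    rewrite Hsq in Es. destruct (Rle_dec 0 s).
    - exists (acos c). rewrite Ec, Es, sqrt_square by lra. lra.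
    - exists (- acos c). rewrite cos_neg, sin_neg, Ec, Es.
      replace (s * s) with ((- s) * (- s)) by ring. rewrite sqrt_square by lra. lra. }
  destruct Hx as (x & Hcx & Hsx & Hbx).
  destruct (Rle_dec 0 (s0 + x)).
  - exists x. lra.
  - exists (x + 2 * PI). rewrite cos_plus, sin_plus, cos_2PI, sin_2PI. lra.
Qed.

(** A symmetric form of determinant -1 is, up to the unit normalization of its
    two null directions at angles [al] and [- be], determined by these angles:
    [e = 2 sin al sin be / S], [m = sin (al - be) / S], [g = - 2 cos al cos be / S]
    with [S = sin (al + be)]. In these terms the Codazzi equations say that each
    angle is constant along the other null direction. *)
Lemma asymptotic_angles (e m g : R * R -> R) : smooth e -> smooth m -> smooth g ->
  (forall p : R * R, pd2 e p = pd1 m p) -> (forall p : R * R, pd2 m p = pd1 g p) ->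
  (forall p, e p * g p = m p * m p - 1) ->
  exists al be : R * R -> R, smooth al /\ smooth be /\
    (forall p, 0 < al p + be p < PI) /\ 0 <= al (0, 0) < PI /\
    (forall p, e p * cos (al p) + m p * sin (al p) = sin (al p) /\
               m p * cos (al p) + g p * sin (al p) = - cos (al p) /\
               e p * cos (be p) - m p * sin (be p) = sin (be p) /\
               m p * cos (be p) - g p * sin (be p) = cos (be p)) /\
    (forall p : R * R, pd1 al p * cos (be p) = pd2 al p * sin (be p)) /\
    (forall p : R * R, pd1 be p * cos (al p) = - pd2 be p * sin (al p)).
Proof.
  intros Se Sm Sg C1 C2 Gs.
  set (tau := fun p => 1 / 2 * (e p + g p)).
  assert (Stau : smooth tau) by (apply smooth_mult; [apply smooth_const | apply smooth_plus; auto]).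
  set (s := fun p => PI / 2 + atan (tau p)).
  assert (Ss : smooth s).
  { apply smooth_plus; [apply smooth_const|]. apply smooth_comp_R; [apply smooth1_atan | exact Stau]. }
  assert (Hs : forall p, 0 < s p < PI) by (intros p; unfold s; pose proof (atan_bound (tau p)); lra).
  assert (HS : forall p, 0 < sin (s p)) by (intros p; apply sin_gt_0; apply Hs).
  assert (HC : forall p, cos (s p) = - tau p * sin (s p)).
  { intros p. unfold s. rewrite cos_plus, sin_plus, cos_PI2, sin_PI2.
    assert (Hc : 0 < cos (atan (tau p))) by (pose proof (atan_bound (tau p)); apply cos_gt_0; lra).
    pose proof (tan_atan (tau p)) as Ht. unfold tan in Ht.
    replace (sin (atan (tau p))) with (tau p * cos (atan (tau p))); [ring|].
    rewrite <- Ht at 1. field. lra. }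
  set (kc := fun p => 1 / 2 * (e p - g p) * sin (s p)).
  set (ks := fun p => m p * sin (s p)).
  assert (Skc : smooth kc).
  { apply smooth_mult; [apply smooth_mult; [apply smooth_const | apply smooth_minus; auto]|].
    apply smooth_sin, Ss. }
  assert (Sks : smooth ks) by (apply smooth_mult; [exact Sm | apply smooth_sin, Ss]).
  assert (H1 : forall p, kc p * kc p + ks p * ks p = 1).
  { intros p. rewrite <- (sin2_cos2_mult (s p)), HC. unfold kc, ks, tau.
    transitivity (sin (s p) * sin (s p) * (1 / 4 * (e p + g p) * (e p + g p) - e p * g p + m p * m p));
      [field | rewrite Gs; field]. }
  destruct (unit_circle_angle (kc (0, 0)) (ks (0, 0)) (s (0, 0)) (H1 _) (Hs _)) as (x & Hcx & Hsx & Hx).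
  destruct (angle_lift kc ks x Skc Sks H1 Hcx Hsx) as (chi & Schi & Echi & Hchi).
  set (al := fun p => 1 / 2 * (s p + chi p)). set (be := fun p => 1 / 2 * (s p - chi p)).
  assert (Sal : smooth al) by (apply smooth_mult; [apply smooth_const | apply smooth_plus; auto]).
  assert (Sbe : smooth be) by (apply smooth_mult; [apply smooth_const | apply smooth_minus; auto]).
  assert (Esum : forall p, s p = al p + be p) by (intros; unfold al, be; field).
  assert (Edif : forall p, chi p = al p - be p) by (intros; unfold al, be; field).
  assert (Ee : forall p, e p * sin (al p + be p) = 2 * sin (al p) * sin (be p)).
  { intros p. destruct (Hchi p) as [Hc _]. pose proof (HC p) as HCp. unfold kc, tau in *.
    rewrite <- Esum. rewrite Edif, cos_minus in Hc. rewrite (Esum p) in HCp at 1. rewrite cos_plus in HCp. lra. }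
  assert (Eg : forall p, g p * sin (al p + be p) = - 2 * cos (al p) * cos (be p)).
  { intros p. destruct (Hchi p) as [Hc _]. pose proof (HC p) as HCp. unfold kc, tau in *.
    rewrite <- Esum. rewrite Edif, cos_minus in Hc. rewrite (Esum p) in HCp at 1. rewrite cos_plus in HCp. lra. }
  assert (Em : forall p, m p * sin (al p + be p) = sin (al p - be p)).
  { intros p. destruct (Hchi p) as [_ Hc]. unfold ks in Hc. rewrite <- Esum, <- Edif. auto. }
  assert (HSp : forall p, 0 < sin (al p + be p)) by (intros; rewrite <- Esum; apply HS).
  exists al, be. split; [exact Sal|]. split; [exact Sbe|]. split; [|split; [|split]].
  - intros p. rewrite <- Esum. apply Hs.
  - unfold al. rewrite Echi. lra.
  - intros p. specialize (Ee p). specialize (Eg p). specialize (Em p). specialize (HSp p).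
    rewrite sin_minus in Em. rewrite sin_plus in *.
    pose proof (sin2_cos2_mult (al p)) as Ta. pose proof (sin2_cos2_mult (be p)) as Tb.
    set (a := sin (al p)) in *. set (a' := cos (al p)) in *.
    set (b := sin (be p)) in *. set (b' := cos (be p)) in *.
    assert (Hcan : forall y z, y * (a * b' + a' * b) = z * (a * b' + a' * b) -> y = z)
      by (intros y z E; apply (Rmult_eq_reg_r (a * b' + a' * b)); [exact E | lra]).
    repeat split; apply Hcan.
    + transitivity (e p * (a * b' + a' * b) * a' + m p * (a * b' + a' * b) * a); [ring|].
      rewrite Ee, Em. ring.
    + transitivity (m p * (a * b' + a' * b) * a' + g p * (a * b' + a' * b) * a); [ring|].
      rewrite Eg, Em. ring.
    + transitivity (e p * (a * b' + a' * b) * b' - m p * (a * b' + a' * b) * b); [ring|].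
      rewrite Ee, Em. ring.
    + transitivity (m p * (a * b' + a' * b) * b' - g p * (a * b' + a' * b) * b); [ring|].
      rewrite Eg, Em. ring.
  - assert (HD : forall (F K : R * R -> R) (p X : R * R), smooth F ->
      (forall q, F q * sin (al q + be q) = K q) ->
      dirder F p X * sin (al p + be p) ^ 2 = dirder K p X * sin (al p + be p)
        - K p * ((dirder al p X + dirder be p X) * cos (al p + be p))).
    { intros F K p X SF E.
      replace (dirder K p X) with (dirder (fun q => F q * sin (al q + be q)) p X)
        by (apply Derive_ext; intros; apply E).
      rewrite dirder_mult, dirder_sin, dirder_plus, <- (E p) by smoothness. ring. }
    assert (De : forall p X : R * R, dirder e p X * sin (al p + be p) ^ 2
       = 2 * sin (be p) ^ 2 * dirder al p X + 2 * sin (al p) ^ 2 * dirder be p X).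
    { intros p X.
      rewrite (HD e (fun q => 2 * (sin (al q) * sin (be q)))) by (auto; intros; rewrite Ee; ring).
      rewrite !dirder_mult, dirder_const, !dirder_sin by smoothness.
      rewrite sin_plus, cos_plus.
      transitivity (2 * sin (be p) ^ 2 * (sin (al p) * sin (al p) + cos (al p) * cos (al p)) * dirder al p X
        + 2 * sin (al p) ^ 2 * (sin (be p) * sin (be p) + cos (be p) * cos (be p)) * dirder be p X); [ring|].
      rewrite !sin2_cos2_mult. ring. }
    assert (Dg : forall p X : R * R, dirder g p X * sin (al p + be p) ^ 2
       = 2 * cos (be p) ^ 2 * dirder al p X + 2 * cos (al p) ^ 2 * dirder be p X).
    { intros p X.
      rewrite (HD g (fun q => -2 * (cos (al q) * cos (be q)))) by (auto; intros; rewrite Eg; ring).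
      rewrite !dirder_mult, dirder_const, !dirder_cos by smoothness.
      rewrite sin_plus, cos_plus.
      transitivity (2 * cos (be p) ^ 2 * (sin (al p) * sin (al p) + cos (al p) * cos (al p)) * dirder al p X
        + 2 * cos (al p) ^ 2 * (sin (be p) * sin (be p) + cos (be p) * cos (be p)) * dirder be p X); [ring|].
      rewrite !sin2_cos2_mult. ring. }
    assert (Dm : forall p X : R * R, dirder m p X * sin (al p + be p) ^ 2
       = 2 * sin (be p) * cos (be p) * dirder al p X - 2 * sin (al p) * cos (al p) * dirder be p X).
    { intros p X. rewrite (HD m (fun q => sin (al q - be q))) by auto.
      rewrite dirder_sin, dirder_minus by smoothness.
      rewrite sin_plus, cos_plus, sin_minus, cos_minus.
      transitivity (2 * sin (be p) * cos (be p) * (sin (al p) * sin (al p) + cos (al p) * cos (al p)) * dirder al p X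
        - 2 * sin (al p) * cos (al p) * (sin (be p) * sin (be p) + cos (be p) * cos (be p)) * dirder be p X); [ring|].
      rewrite !sin2_cos2_mult. ring. }
    assert (Hnet : forall p : R * R, pd1 al p * cos (be p) = pd2 al p * sin (be p) /\
                                     pd1 be p * cos (al p) = - pd2 be p * sin (al p)).
    { intros p.
      pose proof (De p (0, 1)) as E1. pose proof (Dm p (1, 0)) as E2.
      pose proof (Dm p (0, 1)) as E3. pose proof (Dg p (1, 0)) as E4.
      rewrite (C1 p) in E1. rewrite (C2 p) in E3. rewrite E1 in E2. rewrite E3 in E4.
      pose proof (HSp p) as HSpp. rewrite sin_plus in HSpp.
      set (a := sin (al p)) in *. set (a' := cos (al p)) in *.
      set (b := sin (be p)) in *. set (b' := cos (be p)) in *.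
      set (ax := pd1 al p) in *. set (ay := pd2 al p) in *.
      set (bx := pd1 be p) in *. set (by_ := pd2 be p) in *.
      (* With [X] and [Y] the two defects, the Codazzi equations are the linear
         system [b X + a Y = 0], [b' X - a' Y = 0] of determinant [- S]. *)
      set (X := b * ay - b' * ax). set (Y := a * by_ + a' * bx).
      assert (L1 : b * X + a * Y = 0) by (unfold X, Y; lra).
      assert (L2 : b' * X - a' * Y = 0) by (unfold X, Y; lra).
      assert (HX : X = 0).
      { apply (Rmult_eq_reg_r (a * b' + a' * b)); [|lra].
        transitivity (a' * (b * X + a * Y) + a * (b' * X - a' * Y)); [ring|]. rewrite L1, L2. ring. }
      assert (HY : Y = 0).
      { apply (Rmult_eq_reg_r (a * b' + a' * b)); [|lra].
        transitivity (b' * (b * X + a * Y) - b * (b' * X - a' * Y)); [ring|]. rewrite L1, L2. ring. }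
      unfold X in HX. unfold Y in HY. split; lra. }
    split; intros p; [exact (proj1 (Hnet p)) | exact (proj2 (Hnet p))].
Qed.

(** * Factorization into two asymptotic curves *)

(** What a flat surface yields before any choice of unit normals. The signs in
    [sd_log2] make [PI - w2] the angle of [a2]. *)
Record split_data (a1 a2 : R -> R4) (w1 w2 : R -> R) : Prop := {
  sd_smooth1 : smooth_curve a1;
  sd_smooth2 : smooth_curve a2;
  sd_H31_1 : forall u, in_H31 (a1 u);
  sd_H31_2 : forall v, in_H31 (a2 v);
  sd_base1 : a1 0 = q1;
  sd_base2 : a2 0 = q1;
  sd_angle1 : smooth1 w1;
  sd_angle2 : smooth1 w2;
  sd_log1 : forall u, qmul (qconj (a1 u)) (velocity a1 u) = (0, cos (w1 u), 0, sin (w1 u));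
  sd_log2 : forall v, qmul (qconj (a2 v)) (velocity a2 v) = (0, - cos (w2 v), 0, sin (w2 v));
  sd_sum : forall u v, 0 < w1 u + w2 v < PI;
  sd_diffeo : diffeo_R2 (flat_chart w1 w2)
}.

Lemma flat_chart_0 w1 w2 : flat_chart w1 w2 (0, 0) = (0, 0).
Proof. unfold flat_chart. simpl. rewrite !RInt_start. f_equal; ring. Qed.

Section Factorization.
Variable G : R * R -> R4.
Hypothesis SG : smooth4 G.
Hypothesis HG : forall p, in_H31 (G p).
Notation Gx := (fun p : R * R => diff4 G p (1, 0)).
Notation Gy := (fun p : R * R => diff4 G p (0, 1)).
Hypothesis HXX : forall p : R * R, inner (diff4 G p (1, 0)) (diff4 G p (1, 0)) = -1.
Hypothesis HXY : forall p : R * R, inner (diff4 G p (1, 0)) (diff4 G p (0, 1)) = 0.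
Hypothesis HYY : forall p : R * R, inner (diff4 G p (0, 1)) (diff4 G p (0, 1)) = 1.
Hypothesis G0 : G (0, 0) = q1.
Hypothesis Gx0 : diff4 G (0, 0) (1, 0) = qi.
Hypothesis Gy0 : diff4 G (0, 0) (0, 1) = qk.
Notation N := (flat_normal G).

Variables al be : R * R -> R.
Hypothesis Rel : forall p,
  sff_xx G p * cos (al p) + sff_xy G p * sin (al p) = sin (al p) /\
  sff_xy G p * cos (al p) + sff_yy G p * sin (al p) = - cos (al p) /\
  sff_xx G p * cos (be p) - sff_xy G p * sin (be p) = sin (be p) /\
  sff_xy G p * cos (be p) - sff_yy G p * sin (be p) = cos (be p).
Variables w1 w2 : R -> R.
Hypothesis S1 : smooth1 w1.
Hypothesis S2 : smooth1 w2.
Hypothesis Hw : forall u v, al (flat_chart w1 w2 (u, v)) = w1 u /\ be (flat_chart w1 w2 (u, v)) = w2 v.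

Notation Z u v := (flat_chart w1 w2 (u, v)).

Lemma is_vel_u (f : R * R -> R4) u v : smooth4 f ->
  is_vel (fun u => f (Z u v)) u
    (qadd (qscal (cos (w1 u)) (diff4 f (Z u v) (1, 0))) (qscal (sin (w1 u)) (diff4 f (Z u v) (0, 1)))).
Proof.
  intros Hf. destruct (flat_chart_smooth w1 w2 S1 S2) as [[Sx Sy] Hd].
  destruct (Hd (u, v)) as (E1 & E2 & E3 & E4). cbn [fst snd] in *.
  apply (is_vel_chain f (fun u => fst (Z u v)) (fun u => snd (Z u v))); [exact Hf| |].
  - rewrite <- E1. apply (is_derive_pd1 (fun q => fst (flat_chart w1 w2 q))), Sx.
  - rewrite <- E3. apply (is_derive_pd1 (fun q => snd (flat_chart w1 w2 q))), Sy.
Qed.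

Lemma is_vel_v (f : R * R -> R4) u v : smooth4 f ->
  is_vel (fun v => f (Z u v)) v
    (qadd (qscal (cos (w2 v)) (diff4 f (Z u v) (1, 0))) (qscal (- sin (w2 v)) (diff4 f (Z u v) (0, 1)))).
Proof.
  intros Hf. destruct (flat_chart_smooth w1 w2 S1 S2) as [[Sx Sy] Hd].
  destruct (Hd (u, v)) as (E1 & E2 & E3 & E4). cbn [fst snd] in *.
  apply (is_vel_chain f (fun v => fst (Z u v)) (fun v => snd (Z u v))); [exact Hf| |].
  - rewrite <- E2. apply (is_derive_pd2 (fun q => fst (flat_chart w1 w2 q))), Sx.
  - rewrite <- E4. apply (is_derive_pd2 (fun q => snd (flat_chart w1 w2 q))), Sy.
Qed.

Lemma Gx_u u v : is_vel (fun u => diff4 G (Z u v) (1, 0)) u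
  (qadd (qscal (- cos (w1 u)) (G (Z u v))) (qscal (sin (w1 u)) (N (Z u v)))).
Proof.
  eapply is_vel_eq; [exact (is_vel_u Gx u v (SGx G SG))|].
  rewrite (flat_Gxx G SG HG HXX HXY HYY), (flat_Gxy G SG HG HXX HXY HYY).
  destruct (Rel (Z u v)) as (R1 & R2 & R3 & R4). destruct (Hw u v) as [Ea Eb]. rewrite Ea, Eb in *.
  transitivity (qadd (qscal (- cos (w1 u)) (G (Z u v)))
    (qscal (sff_xx G (Z u v) * cos (w1 u) + sff_xy G (Z u v) * sin (w1 u)) (N (Z u v))));
    [qring | rewrite R1; reflexivity].
Qed.

Lemma Gy_u u v : is_vel (fun u => diff4 G (Z u v) (0, 1)) u
  (qadd (qscal (sin (w1 u)) (G (Z u v))) (qscal (- cos (w1 u)) (N (Z u v)))).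
Proof.
  eapply is_vel_eq; [exact (is_vel_u Gy u v (SGy G SG))|].
  rewrite (flat_mixed G SG), (flat_Gyy G SG HG HXX HXY HYY), (flat_Gxy G SG HG HXX HXY HYY).
  destruct (Rel (Z u v)) as (R1 & R2 & R3 & R4). destruct (Hw u v) as [Ea Eb]. rewrite Ea, Eb in *.
  transitivity (qadd (qscal (sin (w1 u)) (G (Z u v)))
    (qscal (sff_xy G (Z u v) * cos (w1 u) + sff_yy G (Z u v) * sin (w1 u)) (N (Z u v))));
    [qring | rewrite R2; reflexivity].
Qed.

Lemma Gx_v u v : is_vel (fun v => diff4 G (Z u v) (1, 0)) v
  (qadd (qscal (- cos (w2 v)) (G (Z u v))) (qscal (sin (w2 v)) (N (Z u v)))).
Proof.
  eapply is_vel_eq; [exact (is_vel_v Gx u v (SGx G SG))|].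
  rewrite (flat_Gxx G SG HG HXX HXY HYY), (flat_Gxy G SG HG HXX HXY HYY).
  destruct (Rel (Z u v)) as (R1 & R2 & R3 & R4). destruct (Hw u v) as [Ea Eb]. rewrite Ea, Eb in *.
  transitivity (qadd (qscal (- cos (w2 v)) (G (Z u v)))
    (qscal (sff_xx G (Z u v) * cos (w2 v) - sff_xy G (Z u v) * sin (w2 v)) (N (Z u v))));
    [qring | rewrite R3; reflexivity].
Qed.

Lemma Gy_v u v : is_vel (fun v => diff4 G (Z u v) (0, 1)) v
  (qadd (qscal (- sin (w2 v)) (G (Z u v))) (qscal (cos (w2 v)) (N (Z u v)))).
Proof.
  eapply is_vel_eq; [exact (is_vel_v Gy u v (SGy G SG))|].
  rewrite (flat_mixed G SG), (flat_Gyy G SG HG HXX HXY HYY), (flat_Gxy G SG HG HXX HXY HYY).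
  destruct (Rel (Z u v)) as (R1 & R2 & R3 & R4). destruct (Hw u v) as [Ea Eb]. rewrite Ea, Eb in *.
  transitivity (qadd (qscal (- sin (w2 v)) (G (Z u v)))
    (qscal (sff_xy G (Z u v) * cos (w2 v) - sff_yy G (Z u v) * sin (w2 v)) (N (Z u v))));
    [qring | rewrite R4; reflexivity].
Qed.

(** Along the first family [G_x] and [G_y] turn towards the normal at exactly the rate
    at which left translation by [conj G] turns the frame, because [conj G_y G_x] is
    [conj G] times the normal up to sign; along the second family the same holds for
    right translation. *)
Lemma left_frame_const u u' v :
  qmul (qconj (G (Z u v))) (diff4 G (Z u v) (1, 0)) = qmul (qconj (G (Z u' v))) (diff4 G (Z u' v) (1, 0)) /\
  qmul (qconj (G (Z u v))) (diff4 G (Z u v) (0, 1)) = qmul (qconj (G (Z u' v))) (diff4 G (Z u' v) (0, 1)).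
Proof.
  split.
  - apply (is_vel_0_const (fun u => qmul (qconj (G (Z u v))) (diff4 G (Z u v) (1, 0)))). intros t.
    eapply is_vel_eq; [exact (is_vel_mul _ _ t _ _ (is_vel_conj _ _ _ (is_vel_u G t v SG)) (Gx_u t v))|].
    cbv beta.
    pose proof (flat_adapted G SG HG HXX HXY HYY (Z t v)) as F.
    pose proof (frame_conjY_X _ _ _ F) as YX.
    destruct F as (FG & _ & _ & XX & _ & _).
    rewrite qconj_add, !qconj_scal, qmul_add_l, qmul_add_r, !qmul_scal_l, !qmul_scal_r.
    rewrite YX, (in_H31_conj_l _ FG), qconj_qmul, XX. fold (N (Z t v)).
    generalize (qmul (qconj (G (Z t v))) (N (Z t v))). qring.
  - apply (is_vel_0_const (fun u => qmul (qconj (G (Z u v))) (diff4 G (Z u v) (0, 1)))). intros t.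
    eapply is_vel_eq; [exact (is_vel_mul _ _ t _ _ (is_vel_conj _ _ _ (is_vel_u G t v SG)) (Gy_u t v))|].
    cbv beta.
    pose proof (flat_adapted G SG HG HXX HXY HYY (Z t v)) as F.
    pose proof (frame_conjX_Y _ _ _ F) as XY.
    destruct F as (FG & _ & _ & _ & _ & YY).
    rewrite qconj_add, !qconj_scal, qmul_add_l, qmul_add_r, !qmul_scal_l, !qmul_scal_r.
    rewrite XY, (in_H31_conj_l _ FG), qconj_qmul, YY. fold (N (Z t v)).
    generalize (qmul (qconj (G (Z t v))) (N (Z t v))). qring.
Qed.

Lemma right_frame_const u v v' :
  qmul (diff4 G (Z u v) (1, 0)) (qconj (G (Z u v))) = qmul (diff4 G (Z u v') (1, 0)) (qconj (G (Z u v'))) /\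
  qmul (diff4 G (Z u v) (0, 1)) (qconj (G (Z u v))) = qmul (diff4 G (Z u v') (0, 1)) (qconj (G (Z u v'))).
Proof.
  split.
  - apply (is_vel_0_const (fun v => qmul (diff4 G (Z u v) (1, 0)) (qconj (G (Z u v))))). intros t.
    eapply is_vel_eq; [exact (is_vel_mul _ _ t _ _ (Gx_v u t) (is_vel_conj _ _ _ (is_vel_v G u t SG)))|].
    cbv beta.
    pose proof (flat_adapted G SG HG HXX HXY HYY (Z u t)) as F.
    pose proof (frame_X_conjY _ _ _ F) as XY.
    destruct F as (FG & _ & _ & XX & _ & _).
    rewrite qconj_add, !qconj_scal, qmul_add_l, qmul_add_r, !qmul_scal_l, !qmul_scal_r.
    rewrite XY, (in_H31_conj_r _ FG), qmul_qconj, XX. fold (N (Z u t)).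
    generalize (qmul (N (Z u t)) (qconj (G (Z u t)))). qring.
  - apply (is_vel_0_const (fun v => qmul (diff4 G (Z u v) (0, 1)) (qconj (G (Z u v))))). intros t.
    eapply is_vel_eq; [exact (is_vel_mul _ _ t _ _ (Gy_v u t) (is_vel_conj _ _ _ (is_vel_v G u t SG)))|].
    cbv beta.
    pose proof (flat_adapted G SG HG HXX HXY HYY (Z u t)) as F.
    pose proof (frame_Y_conjX _ _ _ F) as YX.
    destruct F as (FG & _ & _ & _ & _ & YY).
    rewrite qconj_add, !qconj_scal, qmul_add_l, qmul_add_r, !qmul_scal_l, !qmul_scal_r.
    rewrite YX, (in_H31_conj_r _ FG), qmul_qconj, YY. fold (N (Z u t)).
    generalize (qmul (N (Z u t)) (qconj (G (Z u t)))). qring.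
Qed.

Lemma Z00 : Z 0 0 = (0, 0). Proof. apply flat_chart_0. Qed.

Lemma cancel_l z w : in_H31 z -> qmul z (qmul (qconj z) w) = w.
Proof. intros H. rewrite qmul_assoc, (in_H31_conj_r z H). apply qmul_1_l. Qed.

Lemma cancel_r z w : in_H31 z -> qmul (qmul w (qconj z)) z = w.
Proof. intros H. rewrite <- qmul_assoc, (in_H31_conj_l z H). apply qmul_1_r. Qed.

(** By [left_frame_const] the points [(u, v)] and [(0, v)] have the same left translated
    frame, hence move along the second family with the same left logarithmic derivative;
    so [G (Z u v) conj (G (Z 0 v))] does not depend on [v]. *)
Lemma factorization u v : G (Z u v) = qmul (G (Z u 0)) (G (Z 0 v)).
Proof.
  assert (H : qmul (G (Z u v)) (qconj (G (Z 0 v))) = qmul (G (Z u 0)) (qconj (G (Z 0 0)))).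
  { apply (is_vel_0_const (fun v => qmul (G (Z u v)) (qconj (G (Z 0 v))))). intros t.
    eapply is_vel_eq; [exact (is_vel_mul _ _ t _ _ (is_vel_v G u t SG) (is_vel_conj _ _ _ (is_vel_v G 0 t SG)))|].
    cbv beta.
    destruct (left_frame_const u 0 t) as [EP EQ].
    destruct (flat_adapted G SG HG HXX HXY HYY (Z 0 t)) as (_ & GX & GY & _).
    assert (Hc : forall X X0, inner (G (Z 0 t)) X0 = 0 ->
      qmul (qconj (G (Z u t))) X = qmul (qconj (G (Z 0 t))) X0 ->
      qadd (qmul X (qconj (G (Z 0 t)))) (qmul (G (Z u t)) (qconj X0)) = q0).
    { intros X X0 H0 E. rewrite <- (cancel_l (G (Z u t)) X (HG _)), E, <- qmul_assoc, <- qmul_add_r.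
      rewrite (qconj_tangent (G (Z 0 t)) X0 (HG _) H0).
      generalize (qmul (qmul (qconj (G (Z 0 t))) X0) (qconj (G (Z 0 t)))) (G (Z u t)). qring. }
    rewrite qconj_add, !qconj_scal, qmul_add_l, qmul_add_r, !qmul_scal_l, !qmul_scal_r.
    transitivity (qadd (qscal (cos (w2 t)) (qadd (qmul (diff4 G (Z u t) (1, 0)) (qconj (G (Z 0 t))))
                                                 (qmul (G (Z u t)) (qconj (diff4 G (Z 0 t) (1, 0))))))
                       (qscal (- sin (w2 t)) (qadd (qmul (diff4 G (Z u t) (0, 1)) (qconj (G (Z 0 t))))
                                                 (qmul (G (Z u t)) (qconj (diff4 G (Z 0 t) (0, 1))))))).
    - generalize (qmul (diff4 G (Z u t) (1, 0)) (qconj (G (Z 0 t))))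
        (qmul (diff4 G (Z u t) (0, 1)) (qconj (G (Z 0 t))))
        (qmul (G (Z u t)) (qconj (diff4 G (Z 0 t) (1, 0))))
        (qmul (G (Z u t)) (qconj (diff4 G (Z 0 t) (0, 1)))). qring.
    - rewrite (Hc _ _ GX EP), (Hc _ _ GY EQ). qring. }
  rewrite Z00, G0 in H.
  rewrite <- (cancel_r (G (Z 0 v)) (G (Z u v)) (HG _)), H. f_equal.
  qring.
Qed.

Hypothesis Hsum : forall p, 0 < al p + be p < PI.
Hypothesis Hdiffeo : diffeo_R2 (flat_chart w1 w2).

Lemma factorization_split_data :
  split_data (fun u => G (Z u 0)) (fun v => qconj (G (Z 0 v))) w1 w2.
Proof.
  destruct (flat_chart_smooth w1 w2 S1 S2) as [[Sx Sy] _].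
  assert (SZ : smooth4 (fun p : R * R => G (flat_chart w1 w2 p)))
    by (apply (smooth4_comp2 G (fun p => fst (flat_chart w1 w2 p)) (fun p => snd (flat_chart w1 w2 p))); auto).
  assert (SA : smooth_curve (fun u => G (Z u 0))).
  { apply smooth_curve_iff.
    apply (smooth4_comp2 (fun p : R * R => G (flat_chart w1 w2 p)) (fun t => t) (fun _ => 0));
      [exact SZ | exact smooth_id | apply smooth_const]. }
  assert (SB : smooth_curve (fun v => G (Z 0 v))).
  { apply smooth_curve_iff.
    apply (smooth4_comp2 (fun p : R * R => G (flat_chart w1 w2 p)) (fun _ => 0) (fun t => t));
      [exact SZ | apply smooth_const | exact smooth_id]. }
  constructor; auto.
  - apply smooth_curve_iff, smooth4_conj, smooth_curve_iff, SB.
  - intros v. apply in_H31_conj, HG.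
  - rewrite Z00. exact G0.
  - rewrite Z00, G0. qring.
  - intros u. rewrite (is_vel_velocity _ _ _ (is_vel_u G u 0 SG)).
    destruct (left_frame_const u 0 0) as [EP EQ].
    rewrite qmul_add_r, !qmul_scal_r, EP, EQ, Z00, G0, Gx0, Gy0. qring.
  - intros v. rewrite (is_vel_velocity _ _ _ (is_vel_conj _ _ _ (is_vel_v G 0 v SG))).
    rewrite qconj_invol.
    destruct (right_frame_const 0 v 0) as [EP EQ].
    transitivity (qconj (qmul (qadd (qscal (cos (w2 v)) (diff4 G (Z 0 v) (1, 0)))
                 (qscal (- sin (w2 v)) (diff4 G (Z 0 v) (0, 1)))) (qconj (G (Z 0 v)))));
      [rewrite qconj_mul, qconj_invol; reflexivity|].
    rewrite qmul_add_l, !qmul_scal_l, EP, EQ, Z00, G0, Gx0, Gy0. qring.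
  - intros u v. destruct (Hw u v) as [<- <-]. apply Hsum.
Qed.
End Factorization.

(** * Fronts and their asymptotic lifts *)

Lemma smooth_curve_velocity c : smooth_curve c -> smooth_curve (velocity c).
Proof.
  intros H t. split4; apply smooth1_Derive; intros r; apply (H r).
Qed.

Lemma qmul_sandwich_vel a b t v : is_vel a t v ->
  is_vel (fun s => qmul (qmul (a s) b) (qconj (a s))) t
    (qadd (qmul (qmul v b) (qconj (a t))) (qmul (qmul (a t) b) (qconj v))).
Proof.
  intros H. eapply is_vel_eq.
  - exact (is_vel_mul _ _ t _ _ (is_vel_mul _ _ t _ _ H (is_vel_const b t)) (is_vel_conj _ _ _ H)).
  - f_equal. f_equal. transitivity (qadd (qmul v b) q0); [f_equal|]; qring.
Qed.

Lemma in_H31_log a v : in_H31 a -> inner a v = 0 ->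
  let w := qmul (qconj a) v in x0 w = 0 /\ v = qmul a w.
Proof.
  intros H Hv w. split.
  - unfold w. replace (x0 (qmul (qconj a) v)) with (- inner a v) by (qunfold; ring). rewrite Hv. ring.
  - unfold w. rewrite qmul_assoc, (in_H31_conj_r a H), qmul_1_l. reflexivity.
Qed.

Lemma H31_velocity_orth a t v : (forall s, in_H31 (a s)) -> is_vel a t v -> inner (a t) v = 0.
Proof.
  intros H Hv. pose proof (inner_const_vel a a t v v (-1) H Hv Hv) as E.
  rewrite (inner_sym v) in E. lra.
Qed.

(** The logarithmic derivative acts on the moving frame by commutators. *)
Lemma frame_velocity a t v b : (forall s, in_H31 (a s)) -> is_vel a t v ->
  let w := qmul (qconj (a t)) v in
  is_vel (fun s => qmul (qmul (a s) b) (qconj (a s))) t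
    (qmul (qmul (a t) (qadd (qmul w b) (qscal (-1) (qmul b w)))) (qconj (a t))).
Proof.
  intros H Hv w. eapply is_vel_eq; [apply qmul_sandwich_vel, Hv|].
  destruct (in_H31_log (a t) v (H t) (H31_velocity_orth a t v H Hv)) as [W0 Ev]. fold w in W0, Ev.
  rewrite Ev. rewrite qconj_mul.
  replace (qconj w) with (qscal (-1) w).
  - rewrite qmul_add_r, qmul_add_l, !qmul_scal_r, !qmul_scal_l, !qmul_scal_r, !qmul_assoc. reflexivity.
  - clear - W0. destruct w as [[[w0 w1] w2] w3]. unfold x0 in W0; cbn [fst snd] in W0. subst w0. qring.
Qed.

Lemma inner_sandwich a z w : in_H31 a ->
  inner (qmul (qmul a z) (qconj a)) (qmul (qmul a w) (qconj a)) = inner z w.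
Proof.
  intros H. rewrite inner_mul_r, inner_mul_l, inner_conj, H. ring.
Qed.

Lemma sandwich_mul a z w : in_H31 a ->
  qmul (qmul (qmul a z) (qconj a)) (qmul (qmul a w) (qconj a)) = qmul (qmul a (qmul z w)) (qconj a).
Proof.
  intros H. rewrite !qmul_assoc, <- (qmul_assoc (qmul a z) (qconj a) a), (in_H31_conj_l a H), qmul_1_r.
  reflexivity.
Qed.

(** For a front with lift [a] this is [a j conj a], the third vector of the frame; both
    velocities of a Legendrian curve are multiples of it. *)
Definition front_tangent (gamma nu : R -> R4) (u : R) : R4 := qscal (-1) (qmul (gamma u) (nu u)).
Definition front_cos (gamma nu : R -> R4) (u : R) : R :=
  - (1 / 2) * inner (velocity nu u) (front_tangent gamma nu u).
Definition front_sin (gamma nu : R -> R4) (u : R) : R :=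
  1 / 2 * inner (velocity gamma u) (front_tangent gamma nu u).

Section Lift.
Variables gamma nu a : R -> R4.
Hypothesis Ha : asymptotic_lift gamma nu a.

Lemma lift_fst u : gamma u = qmul (qmul (a u) qi) (qconj (a u)).
Proof. destruct Ha as (_ & _ & _ & H). specialize (H u). unfold proj in H. congruence. Qed.
Lemma lift_snd u : nu u = qmul (qmul (a u) qk) (qconj (a u)).
Proof. destruct Ha as (_ & _ & _ & H). specialize (H u). unfold proj in H. congruence. Qed.
Lemma lift_H31 u : in_H31 (a u).
Proof. apply Ha. Qed.

Lemma lift_tangent u : front_tangent gamma nu u = qmul (qmul (a u) qj) (qconj (a u)).
Proof.
  unfold front_tangent. rewrite lift_fst, lift_snd, (sandwich_mul _ _ _ (lift_H31 u)).
  rewrite <- qmul_scal_l, <- qmul_scal_r. do 2 f_equal. qring.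
Qed.

Lemma lift_velocities u : let w := qmul (qconj (a u)) (velocity a u) in
  x0 w = 0 /\
  velocity gamma u = qmul (qmul (a u) (0, 0, 2 * x3 w, -2 * x2 w)) (qconj (a u)) /\
  velocity nu u = qmul (qmul (a u) (0, -2 * x2 w, -2 * x1 w, 0)) (qconj (a u)).
Proof.
  intros w.
  assert (Hv : is_vel a u (velocity a u)) by (apply smooth_curve_is_vel, Ha).
  destruct (in_H31_log (a u) (velocity a u) (lift_H31 u) (H31_velocity_orth a u _ lift_H31 Hv)) as [W0 _].
  fold w in W0. split; [exact W0|]. split.
  - apply is_vel_velocity.
    apply (is_vel_ext (fun s => qmul (qmul (a s) qi) (qconj (a s)))); [intros; symmetry; apply lift_fst|].
    eapply is_vel_eq; [exact (frame_velocity a u _ qi lift_H31 Hv)|]. fold w.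
    do 2 f_equal. clear - W0. destruct w as [[[w0 w1] w2] w3]. unfold x0 in W0; cbn [fst snd] in W0. subst w0. qring.
  - apply is_vel_velocity.
    apply (is_vel_ext (fun s => qmul (qmul (a s) qk) (qconj (a s)))); [intros; symmetry; apply lift_snd|].
    eapply is_vel_eq; [exact (frame_velocity a u _ qk lift_H31 Hv)|]. fold w.
    do 2 f_equal. clear - W0. destruct w as [[[w0 w1] w2] w3]. unfold x0 in W0; cbn [fst snd] in W0. subst w0. qring.
Qed.

Lemma lift_front_cos u : front_cos gamma nu u = x1 (qmul (qconj (a u)) (velocity a u)).
Proof.
  destruct (lift_velocities u) as (_ & _ & E). unfold front_cos. rewrite E, lift_tangent.
  rewrite (inner_sandwich _ _ _ (lift_H31 u)).
  generalize (qmul (qconj (a u)) (velocity a u)). intros w. qunfold. field.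
Qed.

Lemma lift_front_sin u : front_sin gamma nu u = x3 (qmul (qconj (a u)) (velocity a u)).
Proof.
  destruct (lift_velocities u) as (_ & E & _). unfold front_sin. rewrite E, lift_tangent.
  rewrite (inner_sandwich _ _ _ (lift_H31 u)).
  generalize (qmul (qconj (a u)) (velocity a u)). intros w. qunfold. field.
Qed.

Lemma lift_tangent_unit u : inner (front_tangent gamma nu u) (front_tangent gamma nu u) = 1.
Proof.
  rewrite lift_tangent, (inner_sandwich _ _ _ (lift_H31 u)). qunfold. ring.
Qed.

Hypothesis Horth : forall u, inner (velocity gamma u) (nu u) = 0.

(** The logarithmic derivative of a lift is determined by the front, hence the
    same for all lifts. *)
Lemma lift_log u : qmul (qconj (a u)) (velocity a u) = (0, front_cos gamma nu u, 0, front_sin gamma nu u).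
Proof.
  destruct (lift_velocities u) as (W0 & E & _).
  pose proof (Horth u) as H. rewrite E, lift_snd, (inner_sandwich _ _ _ (lift_H31 u)) in H.
  rewrite lift_front_cos, lift_front_sin.
  generalize dependent (qmul (qconj (a u)) (velocity a u)). intros w W0 _ H.
  apply R4_ext; auto.
  unfold inner, qk, x0, x1, x2, x3 in H. cbn [fst snd] in H. unfold x0, x1, x2, x3. cbn [fst snd]. lra.
Qed.

Lemma lift_velocity_gamma u :
  velocity gamma u = qscal (2 * front_sin gamma nu u) (front_tangent gamma nu u).
Proof.
  destruct (lift_velocities u) as (_ & E & _). rewrite E, lift_log, lift_tangent.
  rewrite <- qmul_scal_l, <- qmul_scal_r. do 2 f_equal. qring.
Qed.

Lemma lift_velocity_nu u :
  velocity nu u = qscal (-2 * front_cos gamma nu u) (front_tangent gamma nu u).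
Proof.
  destruct (lift_velocities u) as (_ & _ & E). rewrite E, lift_log, lift_tangent.
  rewrite <- qmul_scal_l, <- qmul_scal_r. do 2 f_equal. qring.
Qed.

Lemma lift_metricS u :
  metricS gamma nu u = 4 * (front_cos gamma nu u ^ 2 + front_sin gamma nu u ^ 2).
Proof.
  unfold metricS. rewrite lift_velocity_gamma, lift_velocity_nu.
  rewrite !inner_scal_l, !inner_scal_r, lift_tangent_unit. ring.
Qed.

Lemma lift_singular u : velocity gamma u = q0 <-> front_sin gamma nu u = 0.
Proof.
  rewrite lift_velocity_gamma. split; intros H.
  - assert (E : inner (qscal (2 * front_sin gamma nu u) (front_tangent gamma nu u)) (front_tangent gamma nu u) = 0)
      by (rewrite H; qunfold; ring).
    rewrite inner_scal_l, lift_tangent_unit in E. lra.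
  - rewrite H. qring.
Qed.

Hypothesis Sg : smooth_curve gamma.
Hypothesis Sn : smooth_curve nu.

Lemma lift_geod_curv u th : front_cos gamma nu u = cos th -> front_sin gamma nu u = sin th ->
  geod_curv gamma nu u = cot th.
Proof.
  intros Ec Es. unfold geod_curv, cot.
  destruct (excluded_middle_informative (velocity gamma u = q0)) as [H|H];
    destruct (Req_EM_T (sin th) 0) as [H'|H'].
  - reflexivity.
  - exfalso. apply lift_singular in H. congruence.
  - exfalso. apply H, lift_singular. congruence.
  - f_equal.
    pose proof (inner_const_vel _ _ u _ _ 0 Horth
      (smooth_curve_is_vel _ u (smooth_curve_velocity _ Sg)) (smooth_curve_is_vel _ u Sn)) as E.
    rewrite lift_velocity_nu in E. rewrite (lift_velocity_gamma u) in E |- *.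
    rewrite !inner_scal_l, !inner_scal_r, lift_tangent_unit, Ec, Es in *.
    replace (inner (velocity (velocity gamma) u) (nu u)) with (4 * cos th * sin th) by lra.
    field. exact H'.
Qed.

End Lift.

(** Conversely, a curve with logarithmic derivative in the plane of [i] and [k]
    projects to a Legendrian curve. *)
Section Project.
Variable a : R -> R4.
Variable th : R -> R.
Hypothesis Sa : smooth_curve a.
Hypothesis Ha : forall u, in_H31 (a u).
Hypothesis Hlog : forall u, qmul (qconj (a u)) (velocity a u) = (0, cos (th u), 0, sin (th u)).

Definition lift_gamma (u : R) : R4 := fst (proj (a u)).
Definition lift_nu (u : R) : R4 := snd (proj (a u)).

Lemma project_lift : asymptotic_lift lift_gamma lift_nu a.
Proof.
  split; [exact Sa|]. split; [|split; [exact Ha|]].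
  - intros u E. pose proof (Hlog u) as H. rewrite E in H.
    pose proof (sin2_cos2_mult (th u)) as T.
    assert (H1 := f_equal x1 H). assert (H3 := f_equal x3 H).
    unfold qmul, q0, x0, x1, x2, x3 in H1, H3. cbn [fst snd] in H1, H3.
    replace (sin (th u)) with 0 in T by lra. replace (cos (th u)) with 0 in T by lra. lra.
  - intros u. reflexivity.
Qed.

Lemma project_cos u : front_cos lift_gamma lift_nu u = cos (th u).
Proof. rewrite (lift_front_cos _ _ _ project_lift), Hlog. reflexivity. Qed.
Lemma project_sin u : front_sin lift_gamma lift_nu u = sin (th u).
Proof. rewrite (lift_front_sin _ _ _ project_lift), Hlog. reflexivity. Qed.

Lemma project_orth u : inner (velocity lift_gamma u) (lift_nu u) = 0.
Proof.
  destruct (lift_velocities _ _ _ project_lift u) as (_ & E & _).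
  rewrite E, Hlog. unfold lift_nu, proj. cbn [snd]. rewrite (inner_sandwich _ _ _ (Ha u)).
  qunfold. ring.
Qed.

Lemma project_smooth : smooth_curve lift_gamma /\ smooth_curve lift_nu.
Proof.
  pose proof (proj1 (smooth_curve_iff a) Sa) as S.
  split; apply smooth_curve_iff; (apply smooth4_mul; [apply smooth4_mul; [exact S | apply smooth4_const] | apply smooth4_conj, S]).
Qed.

Lemma project_metricS u : metricS lift_gamma lift_nu u = 4.
Proof.
  rewrite (lift_metricS _ _ _ project_lift project_orth), project_cos, project_sin.
  pose proof (sin2_cos2_mult (th u)). lra.
Qed.

Lemma project_legendrian : legendrian lift_gamma lift_nu.
Proof.
  split; [apply project_smooth|]. split; [apply project_smooth|]. split; [|split; [|apply project_orth]].
  - intros u. unfold lift_gamma, lift_nu, proj. cbn [fst snd]. pose proof (Ha u) as H.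
    split; [|split].
    + split; [|split].
      * generalize (a u). intros z. qunfold. ring.
      * rewrite (inner_sandwich _ _ _ H). qunfold. ring.
      * generalize dependent (a u). intros [[[z0 z1] z2] z3] H.
        unfold in_H31 in H. qunfold.
        match goal with |- 0 < ?x => replace x with (z0 * z0 + z1 * z1 + z2 * z2 + z3 * z3) by ring end.
        pose proof (Rle_0_sqr z0). pose proof (Rle_0_sqr z1). pose proof (Rle_0_sqr z2). pose proof (Rle_0_sqr z3).
        unfold Rsqr in *. lra.
    + split.
      * generalize (a u). intros z. qunfold. ring.
      * rewrite (inner_sandwich _ _ _ H). qunfold. ring.
    + rewrite (inner_sandwich _ _ _ H). qunfold. ring.
  - intros u E. injection E as E1 E2.
    pose proof (project_metricS u) as M. unfold metricS in M.
    assert (Z1 : inner (velocity lift_gamma u) (velocity lift_gamma u) = 0).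
    { replace (velocity lift_gamma u) with q0 by (symmetry; apply R4_ext; unfold q0, x0, x1, x2, x3; cbn [fst snd]; assumption).
      qunfold; ring. }
    assert (Z2 : inner (velocity lift_nu u) (velocity lift_nu u) = 0).
    { replace (velocity lift_nu u) with q0 by (symmetry; apply R4_ext; unfold q0, x0, x1, x2, x3; cbn [fst snd]; assumption).
      qunfold; ring. }
    lra.
Qed.

Lemma project_geod_curv u : geod_curv lift_gamma lift_nu u = cot (th u).
Proof.
  destruct project_smooth.
  apply (lift_geod_curv _ _ _ project_lift project_orth); auto; [apply project_cos | apply project_sin].
Qed.

Lemma project_singular u : velocity lift_gamma u = q0 <-> sin (th u) = 0.
Proof. rewrite (lift_singular _ _ _ project_lift project_orth), project_sin. reflexivity. Qed.

Hypothesis Sth : smooth1 th.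

Lemma project_angle : angle_function a th.
Proof.
  exists (fun s => s), a, th. split; [apply smooth1_iff, smooth_id|].
  split; [intros; rewrite Derive_id; lra|].
  split; [intros; split; [apply Sa | apply Sth]|].
  split; [auto|]. exact Hlog.
Qed.

Lemma project_positive : (exists p, forall u, cot (th u) <> p) ->
  (forall u, sin (th u) = 0 -> cos (th u) = -1) ->
  ((exists u, sin (th u) = 0) \/ forall u, 0 < sin (th u)) ->
  positive_unit_normal lift_gamma lift_nu.
Proof.
  intros [p Hp] Hsing Hcase. split; [exact project_legendrian|]. split.
  - exists p. intros [u E]. apply (Hp u). rewrite <- E. symmetry. apply project_geod_curv.
  - exists a, th. split; [exact project_lift|]. split; [exact project_angle|]. split.
    + intros Hreg u. destruct Hcase as [[u0 H0]|H]; auto.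
      exfalso. apply (Hreg u0), project_singular, H0.
    + intros _ u E. apply Hsing, project_singular, E.
Qed.

End Project.

(** * Branches of the inverse cotangent *)

Lemma cot_Fin t : sin t <> 0 -> cot t = Fin (cos t / sin t).
Proof. intros H. unfold cot. destruct (Req_EM_T (sin t) 0); [contradiction | reflexivity]. Qed.

Lemma cot_Inf t : sin t = 0 -> cot t = Inf.
Proof. intros H. unfold cot. destruct (Req_EM_T (sin t) 0); [reflexivity | contradiction]. Qed.

Lemma cot_eq_sin x y : cot x = cot y -> sin (x - y) = 0.
Proof.
  unfold cot. rewrite sin_minus.
  destruct (Req_EM_T (sin x) 0) as [Hx|Hx], (Req_EM_T (sin y) 0) as [Hy|Hy]; intros E; try discriminate.
  - rewrite Hx, Hy. ring.
  - injection E as E. 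
    transitivity (sin x * sin y * (cos y / sin y - cos x / sin x)); [field; auto | rewrite E; ring].
Qed.

Lemma atan_cot_0_PI t : 0 < t < PI -> PI / 2 - atan (cos t / sin t) = t.
Proof.
  intros H.
  replace (cos t / sin t) with (tan (PI / 2 - t)).
  - rewrite atan_tan by lra. ring.
  - unfold tan. rewrite cos_shift, sin_shift. reflexivity.
Qed.

Lemma cot_lt x y : 0 < x < PI -> 0 < y < PI -> x < y -> cos y / sin y < cos x / sin x.
Proof.
  intros Hx Hy H.
  pose proof (sin_gt_0 x ltac:(lra) ltac:(lra)). pose proof (sin_gt_0 y ltac:(lra) ltac:(lra)).
  pose proof (sin_gt_0 (y - x) ltac:(lra) ltac:(lra)) as Hd. rewrite sin_minus in Hd.
  apply Rminus_gt_0_lt.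
  replace (cos x / sin x - cos y / sin y) with ((sin y * cos x - cos y * sin x) * / (sin x * sin y))
    by (field; lra).
  apply Rmult_lt_0_compat; [lra|]. apply Rinv_0_lt_compat, Rmult_lt_0_compat; assumption.
Qed.

Definition acot_pos (p : RP1) : R :=
  match p with Fin r => PI / 2 - atan r | Inf => 0 end.

Lemma acot_pos_cot t : 0 < t < PI -> acot_pos (cot t) = t.
Proof.
  intros H. pose proof (sin_gt_0 t ltac:(lra) ltac:(lra)).
  rewrite cot_Fin by lra. apply atan_cot_0_PI, H.
Qed.

Lemma continuous_acot r : continuous (fun r => PI / 2 - atan r) r.
Proof.
  apply (ex_derive_continuous (V := R_NormedModule)).
  auto_derive; auto.
Qed.

Lemma is_acot_pos (k : R -> RP1) (w : R -> R) :
  (forall u, k u = cot (w u)) -> (forall u, 0 < w u < PI) ->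
  is_acot (range k) acot_pos /\ forall u, w u = acot_pos (k u).
Proof.
  intros Hk Hw.
  assert (Hp : forall u, w u = acot_pos (k u)) by (intros u; rewrite Hk, acot_pos_cot; auto).
  assert (HI : ~ range k Inf).
  { intros [u E]. rewrite Hk, cot_Fin in E; [discriminate|].
    pose proof (sin_gt_0 (w u) (proj1 (Hw u)) (proj2 (Hw u))). lra. }
  split; [|exact Hp]. split; [|split; [|split]].
  - intros p [u <-]. rewrite <- Hp. symmetry. apply Hk.
  - intros p Hpr P HP. destruct p as [r|]; [|contradiction].
    unfold filtermap, within, RP1_locally. simpl in HP.
    pose proof (continuous_acot r P HP) as H.
    unfold filtermap in H. revert H. apply filter_imp. intros s Hs _. exact Hs.
  - intros _ p [u <-]. rewrite <- Hp. apply Hw.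
  - contradiction.
Qed.

(** The determination with values in [(i, i + PI)]: it jumps only at the slope
    [cot i], which is not attained. *)
Definition acot_from (i : R) (p : RP1) : R :=
  match p with
  | Fin r => if Rlt_dec r (cos i / sin i) then PI / 2 - atan r else PI + (PI / 2 - atan r)
  | Inf => PI
  end.

Lemma acot_from_cot i t : 0 < i < PI -> i < t < i + PI -> acot_from i (cot t) = t.
Proof.
  intros Hi Ht. destruct (Rtotal_order t PI) as [H|[->|H]].
  - pose proof (sin_gt_0 t ltac:(lra) ltac:(lra)). rewrite cot_Fin by lra. simpl.
    pose proof (cot_lt i t ltac:(lra) ltac:(lra) ltac:(lra)).
    destruct (Rlt_dec (cos t / sin t) (cos i / sin i)); [|contradiction].
    apply atan_cot_0_PI. lra.
  - rewrite cot_Inf by apply sin_PI. reflexivity.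
  - assert (Et : t = PI + (t - PI)) by ring.
    pose proof (sin_gt_0 (t - PI) ltac:(lra) ltac:(lra)) as Hs.
    assert (Es : sin t = - sin (t - PI)) by (rewrite sin_minus, sin_PI, cos_PI; ring).
    assert (Ec : cos t = - cos (t - PI)) by (rewrite cos_minus, sin_PI, cos_PI; ring).
    rewrite cot_Fin by lra. simpl.
    replace (cos t / sin t) with (cos (t - PI) / sin (t - PI)) by (rewrite Es, Ec; field; lra).
    pose proof (cot_lt (t - PI) i ltac:(lra) ltac:(lra) ltac:(lra)).
    destruct (Rlt_dec (cos (t - PI) / sin (t - PI)) (cos i / sin i)); [lra|].
    rewrite atan_cot_0_PI by lra. ring.
Qed.

Lemma acot_near_infinity d : 0 < d < PI / 2 -> forall s,
  tan (PI / 2 - d) < Rabs s ->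
  (0 < s -> 0 < PI / 2 - atan s < d) /\ (s < 0 -> PI - d < PI / 2 - atan s < PI).
Proof.
  intros Hd s Hs.
  assert (H : forall r, tan (PI / 2 - d) < r -> 0 < PI / 2 - atan r < d).
  { intros r Hr. apply atan_increasing in Hr. rewrite atan_tan in Hr by lra.
    pose proof (atan_bound r). lra. }
  split; intros H0.
  - rewrite Rabs_pos_eq in Hs by lra. apply H, Hs.
  - rewrite Rabs_left in Hs by lra. apply H in Hs. rewrite atan_opp in Hs. lra.
Qed.

Lemma is_acot_from (k : R -> RP1) (w : R -> R) i : 0 < i < PI ->
  (forall u, k u = cot (w u)) -> (forall u, i < w u < i + PI) -> range k Inf ->
  is_acot (range k) (acot_from i) /\ forall u, w u = acot_from i (k u).
Proof.
  intros Hi Hk Hw HI.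
  assert (Hp : forall u, w u = acot_from i (k u)) by (intros u; rewrite Hk, acot_from_cot; auto).
  split; [|exact Hp]. split; [|split; [|split]].
  - intros p [u <-]. rewrite <- Hp. symmetry. apply Hk.
  - intros p Hpr P HP. unfold filtermap, within. destruct p as [r|]; simpl.
    + simpl in HP. destruct (Rlt_dec r (cos i / sin i)) as [Hr|Hr].
      * assert (L := open_lt (cos i / sin i) r Hr).
        pose proof (continuous_acot r P HP) as H. unfold filtermap in H.
        generalize (filter_and _ _ L H). apply filter_imp. intros s [Hs1 Hs2] _.
        destruct (Rlt_dec s (cos i / sin i)); [exact Hs2 | contradiction].
      * assert (Hne : r <> cos i / sin i).
        { intros E. destruct Hpr as [u Eu]. rewrite Hk in Eu.
          pose proof (sin_gt_0 i ltac:(lra) ltac:(lra)).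
          rewrite E, <- cot_Fin in Eu by lra. apply cot_eq_sin in Eu.
          pose proof (sin_gt_0 (w u - i)). pose proof (Hw u). lra. }
        assert (L := open_gt (cos i / sin i) r ltac:(lra)).
        assert (Hc : continuous (fun r => PI + (PI / 2 - atan r)) r)
          by (apply (ex_derive_continuous (V := R_NormedModule)); auto_derive; auto).
        pose proof (Hc P HP) as H. unfold filtermap in H.
        generalize (filter_and _ _ L H). apply filter_imp. intros s [Hs1 Hs2] _.
        destruct (Rlt_dec s (cos i / sin i)); [lra | exact Hs2].
    + simpl in HP. split; [intros _; exact (locally_singleton _ _ HP)|].
      destruct HP as [eps He].
      pose proof PI_RGT_0 as HPI. pose proof (cond_pos eps) as Heps.
      set (d := Rmin eps (PI / 4)).
      assert (Hd : 0 < d < PI / 2 /\ d <= eps).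
      { unfold d. pose proof (Rmin_l eps (PI / 4)). pose proof (Rmin_r eps (PI / 4)).
        assert (0 < Rmin eps (PI / 4)) by (apply Rmin_glb_lt; lra). lra. }
      exists (Rmax (tan (PI / 2 - d)) (Rabs (cos i / sin i))). intros s Hs _.
      pose proof (Rmax_l (tan (PI / 2 - d)) (Rabs (cos i / sin i))) as M1.
      pose proof (Rmax_r (tan (PI / 2 - d)) (Rabs (cos i / sin i))) as M2.
      destruct (acot_near_infinity d (proj1 Hd) s ltac:(lra)) as [A1 A2].
      apply He. unfold ball; simpl. unfold AbsRing_ball, abs, minus, plus, opp; simpl.
      destruct (Rtotal_order s 0) as [H0|[H0|H0]].
      * specialize (A2 H0). rewrite (Rabs_left s) in Hs by lra.
        pose proof (Rle_abs (- (cos i / sin i))) as B. rewrite Rabs_Ropp in B.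
        destruct (Rlt_dec s (cos i / sin i)); [|lra]. apply Rabs_def1; lra.
      * exfalso. subst s. rewrite Rabs_R0 in Hs. pose proof (Rabs_pos (cos i / sin i)). lra.
      * specialize (A1 H0). rewrite (Rabs_pos_eq s) in Hs by lra.
        pose proof (Rle_abs (cos i / sin i)) as B.
        destruct (Rlt_dec s (cos i / sin i)); [lra|]. apply Rabs_def1; lra.
  - contradiction.
  - intros _. exists (PI - i). split; [lra|]. intros p [u <-]. rewrite <- Hp.
    pose proof (Hw u). lra.
Qed.

(** * From asymptotic curves to admissible pairs *)

Lemma proj_1 : proj q1 = (qi, qk).
Proof. unfold proj. f_equal; qring. Qed.

(** The second front is regular or has a zero of [w2]; in the latter case its curvature
    is infinite there, and the branch of the inverse cotangent is [acot_from]. *)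
Lemma split_construction a1 a2 w1 w2 : split_data a1 a2 w1 w2 ->
  (forall u, 0 < w1 u < PI) -> ((exists v, w2 v = 0) \/ forall v, 0 < w2 v < PI) ->
  construction_data (lift_gamma a1) (lift_nu a1) (lift_gamma a2) (lift_nu a2) a1 a2 w1 w2.
Proof.
  intros D Hw1 Hw2. destruct D as [S1 S2 H1 H2 B1 B2 A1 A2 L1 L2 Hs Hd].
  set (t2 := fun v => PI - w2 v).
  assert (L2' : forall v, qmul (qconj (a2 v)) (velocity a2 v) = (0, cos (t2 v), 0, sin (t2 v))).
  { intros v. rewrite L2. unfold t2. rewrite cos_minus, sin_minus, cos_PI, sin_PI.
    qring. }
  assert (A2' : smooth1 t2) by (apply smooth1_iff, smooth_minus; [apply smooth_const | apply smooth1_iff, A2]).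
  assert (K1 := project_geod_curv a1 w1 S1 H1 L1).
  assert (K2 := project_geod_curv a2 t2 S2 H2 L2').
  assert (P1 : forall u, 0 < sin (w1 u)) by (intros u; apply sin_gt_0; apply Hw1).
  assert (Hb : forall v, - PI < w2 v < PI).
  { intros v. pose proof (Hs 0 v). pose proof (Hw1 0). lra. }
  assert (Hz : forall v, sin (t2 v) = 0 -> w2 v = 0).
  { intros v E. unfold t2 in E. rewrite sin_minus, sin_PI, cos_PI in E.
    destruct (Rtotal_order (w2 v) 0) as [H|[H|H]]; auto; exfalso.
    - pose proof (sin_gt_0 (- w2 v)) as G. rewrite sin_neg in G. pose proof (Hb v). lra.
    - pose proof (sin_gt_0 (w2 v)) as G. pose proof (Hb v). lra. }
  assert (Hne : forall u v, cot (w1 u) <> cot (t2 v)).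
  { intros u v E. apply cot_eq_sin in E. unfold t2 in E.
    replace (w1 u - (PI - w2 v)) with ((w1 u + w2 v) - PI) in E by ring.
    rewrite sin_minus, sin_PI, cos_PI in E.
    pose proof (sin_gt_0 (w1 u + w2 v) (proj1 (Hs u v)) (proj2 (Hs u v))). lra. }
  assert (N1 : positive_unit_normal (lift_gamma a1) (lift_nu a1)).
  { apply (project_positive a1 w1 S1 H1 L1 A1).
    - exists Inf. intros u. rewrite cot_Fin by (pose proof (P1 u); lra). discriminate.
    - intros u E. pose proof (P1 u). lra.
    - right. exact P1. }
  assert (N2 : positive_unit_normal (lift_gamma a2) (lift_nu a2)).
  { apply (project_positive a2 t2 S2 H2 L2' A2').
    - exists (cot (w1 0)). intros v E. apply (Hne 0 v). auto.
    - intros v E. unfold t2. rewrite (Hz v E), Rminus_0_r. apply cos_PI.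
    - destruct Hw2 as [[v0 E]|H].
      + left. exists v0. unfold t2. rewrite E, Rminus_0_r. apply sin_PI.
      + right. intros v. unfold t2. apply sin_gt_0; pose proof (H v); lra. }
  assert (V : forall a, a 0 = q1 -> lift_gamma a 0 = qi /\ lift_nu a 0 = qk).
  { intros a E. unfold lift_gamma, lift_nu. rewrite E, proj_1. auto. }
  constructor.
  - split; [exact N1|]. split; [exact N2|].
    split; [apply V, B1|]. split; [apply V, B2|]. split; [apply V, B1|]. split; [apply V, B2|].
    split; [|split].
    + intros u E. apply (project_singular a1 w1 S1 H1 L1) in E. pose proof (P1 u). lra.
    + intros u v. rewrite K1, K2. apply Hne.
    + intros Hreg u v. rewrite K1, K2.
      destruct Hw2 as [[v0 E]|H].
      * exfalso. apply (Hreg v0), (project_singular a2 t2 S2 H2 L2').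
        unfold t2. rewrite E, Rminus_0_r. apply sin_PI.
      * pose proof (H v) as Hv. assert (Ht : 0 < t2 v < PI) by (unfold t2; lra).
        pose proof (sin_gt_0 (t2 v) (proj1 Ht) (proj2 Ht)). pose proof (P1 u).
        rewrite !cot_Fin by lra. simpl. apply cot_lt; auto.
        unfold t2. pose proof (Hs u v). lra.
  - exact (project_metricS a1 w1 S1 H1 L1).
  - exact (project_metricS a2 t2 S2 H2 L2').
  - exact (project_lift a1 w1 S1 H1 L1).
  - exact (project_lift a2 t2 S2 H2 L2').
  - exists acot_pos. exact (is_acot_pos _ w1 K1 Hw1).
  - assert (E : exists psi, is_acot (range (geod_curv (lift_gamma a2) (lift_nu a2))) psi /\
        forall v, t2 v = psi (geod_curv (lift_gamma a2) (lift_nu a2) v)).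
    { destruct Hw2 as [[v0 E]|H].
      - (* The slope [cot (w1 0)] belongs to the first front, so the second one misses it. *)
        exists (acot_from (w1 0)). apply is_acot_from; auto.
        + intros v. unfold t2. pose proof (Hs 0 v). lra.
        + exists v0. rewrite K2. apply cot_Inf. unfold t2. rewrite E, Rminus_0_r. apply sin_PI.
      - exists acot_pos. apply is_acot_pos; auto. intros v. unfold t2. pose proof (H v). lra. }
    destruct E as [psi [E1 E2]]. exists psi. split; [exact E1|].
    intros v. rewrite <- E2. unfold t2. ring.
  - exact Hd.
Qed.

(** * Symmetries of the construction *)

Lemma smooth_comp_plane (f : R * R -> R) (g : R * R -> R * R) : smooth f -> smooth2 g ->
  smooth (fun p : R * R => f (g p)).
Proof.
  intros Hf [G1 G2].
  apply (eq_ind _ smooth (smooth_comp2 f (fun p => fst (g p)) (fun p => snd (g p)) Hf G1 G2)).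
  apply functional_extensionality. intros p. rewrite <- surjective_pairing. reflexivity.
Qed.

Lemma diffeo_comp h k : diffeo_R2 h -> diffeo_R2 k -> diffeo_R2 (fun p => h (k p)).
Proof.
  assert (C : forall h k, smooth2 h -> smooth2 k -> smooth2 (fun p => h (k p))).
  { intros h' k' [H1 H2] K. split.
    - exact (smooth_comp_plane (fun q => fst (h' q)) k' H1 K).
    - exact (smooth_comp_plane (fun q => snd (h' q)) k' H2 K). }
  intros [Sh (h' & Sh' & E1 & E2)] [Sk (k' & Sk' & E3 & E4)]. split; [auto|].
  exists (fun p => k' (h' p)). split; [auto|]. split; intros p.
  - rewrite E1. apply E3.
  - rewrite E4. apply E2.
Qed.

Lemma diffeo_involution h : smooth2 h -> (forall p, h (h p) = p) -> diffeo_R2 h.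
Proof. intros S E. split; [exact S|]. exists h. auto. Qed.

Definition swap (p : R * R) : R * R := (snd p, fst p).
Definition flip1 (p : R * R) : R * R := (- fst p, snd p).
Definition flip2 (p : R * R) : R * R := (fst p, - snd p).

Lemma diffeo_swap : diffeo_R2 swap.
Proof.
  apply diffeo_involution; [split; [apply smooth_snd | apply smooth_fst]|]. intros []; reflexivity.
Qed.
Lemma diffeo_flip1 : diffeo_R2 flip1.
Proof.
  apply diffeo_involution; [split; [apply smooth_opp, smooth_fst | apply smooth_snd]|].
  intros []; unfold flip1; simpl. rewrite Ropp_involutive. reflexivity.
Qed.
Lemma diffeo_flip2 : diffeo_R2 flip2.
Proof.
  apply diffeo_involution; [split; [apply smooth_fst | apply smooth_opp, smooth_snd]|].
  intros []; unfold flip2; simpl. rewrite Ropp_involutive. reflexivity.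
Qed.

Lemma tau_mul z w : tau (qmul z w) = qmul (tau z) (tau w).
Proof. qring. Qed.
Lemma tau_conj z : tau (qconj z) = qconj (tau z).
Proof. qring. Qed.
Lemma linear_tau : linear4 tau.
Proof. unfold linear4. qring. Qed.

Lemma tau_isometry : linear_isometry tau.
Proof.
  split; [exact linear_tau|]. split.
  - intros z w. unfold tau, inner, x0, x1, x2, x3. cbn [fst snd]. ring.
  - exists tau. split; [exact linear_tau|]. split; qring.
Qed.

Lemma reflect3_isometry : linear_isometry reflect3.
Proof.
  assert (L : linear4 reflect3) by (unfold linear4; qring).
  split; [exact L|]. split.
  - intros z w. unfold reflect3, inner, x0, x1, x2, x3. cbn [fst snd]. ring.
  - exists reflect3. split; [exact L|]. split; qring.
Qed.

Definition represents (F : R * R -> R4) (a1 a2 : R -> R4) : Prop :=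
  exists (L : R4 -> R4) (phi : R * R -> R * R), linear_isometry L /\ diffeo_R2 phi /\
    forall u v, L (F (phi (u, v))) = qmul (a1 u) (qconj (a2 v)).

Lemma tau_curve a : smooth_curve a -> smooth_curve (fun t => tau (a t)) /\
  forall t, velocity (fun t => tau (a t)) t = tau (velocity a t).
Proof.
  intros S. split.
  - apply smooth_curve_iff. apply (linear4_smooth (V := R_NormedModule) tau a linear_tau), smooth_curve_iff, S.
  - intros t. apply is_vel_velocity, (linear4_is_vel tau a t _ linear_tau), smooth_curve_is_vel, S.
Qed.

Lemma reverse_curve a : smooth_curve a -> smooth_curve (fun t => a (- t)) /\
  forall t, velocity (fun t => a (- t)) t = qscal (-1) (velocity a (- t)).
Proof.
  intros S. split.
  - apply smooth_curve_iff. apply (smooth4_curve (V := R_NormedModule) a (fun t => - t) S), smooth_opp, smooth_id.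
  - intros t. apply is_vel_velocity, (is_vel_comp a (fun t => - t)).
    + apply smooth_curve_is_vel, S.
    + auto_derive; auto.
Qed.

Lemma tau_H31 z : in_H31 z -> in_H31 (tau z).
Proof. unfold in_H31. intros H. rewrite (proj1 (proj2 tau_isometry)). exact H. Qed.

Lemma RInt_scal_from_0 (k : R) (f : R -> R) x : (forall t, continuous f t) ->
  RInt (fun t => k * f t) 0 x = k * RInt f 0 x.
Proof.
  intros Hf. apply (RInt_scal (V := R_CompleteNormedModule) f 0 x k).
  apply (ex_RInt_continuous (V := R_CompleteNormedModule)). intros; apply Hf.
Qed.

Lemma RInt_reverse (f : R -> R) x : (forall t, continuous f t) ->
  RInt (fun t => f (- t)) 0 x = - RInt f 0 (- x).
Proof.
  intros Hf. apply (RInt_from_0 (fun t => f (- t)) (fun x => - RInt f 0 (- x))).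
  - rewrite Ropp_0, RInt_start. ring.
  - intros t. apply (continuous_comp (fun t => - t) f); [|apply Hf].
    apply (ex_derive_continuous (V := R_NormedModule)). auto_derive; auto.
  - intros t. apply (is_derive_eq _ t (- (- 1 * f (- t)))); [|real_eq; ring].
    apply (is_derive_opp (V := R_NormedModule) (fun t => RInt f 0 (- t))).
    apply (is_derive_comp (fun s => RInt f 0 s) (fun t => - t)).
    + apply is_derive_RInt_continuous, Hf.
    + auto_derive; auto.
Qed.

(** Exchanging the two families, together with the reflection of the plane and of
    the ambient space that restores the orientation. *)
Lemma split_data_swap F a1 a2 w1 w2 : split_data a1 a2 w1 w2 -> represents F a1 a2 ->
  split_data (fun t => tau (a2 t)) (fun t => tau (a1 t)) w2 w1 /\
  represents F (fun t => tau (a2 t)) (fun t => tau (a1 t)).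
Proof.
  intros [S1 S2 H1 H2 B1 B2 A1 A2 L1 L2 Hs Hd] (L & phi & HL & Hphi & HF).
  destruct (tau_curve a1 S1) as [T1 V1], (tau_curve a2 S2) as [T2 V2]. split.
  - constructor; auto; try (intros; apply tau_H31; auto).
    + rewrite B2. qring.
    + rewrite B1. qring.
    + intros u. rewrite V2, <- tau_conj, <- tau_mul, L2. qring.
    + intros u. rewrite V1, <- tau_conj, <- tau_mul, L1. qring.
    + intros u v. rewrite Rplus_comm. apply Hs.
    + replace (flat_chart w2 w1) with (fun p => flip2 (flat_chart w1 w2 (swap p))).
      * apply (diffeo_comp flip2); [apply diffeo_flip2|].
        apply (diffeo_comp (flat_chart w1 w2)); [exact Hd | apply diffeo_swap].
      * apply functional_extensionality. intros [u v]. unfold flip2, flat_chart, swap. simpl. f_equal; ring.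
  - exists (fun z => reflect3 (L z)), (fun p => phi (swap p)). split; [|split].
    + apply linear_isometry_comp; [exact HL | exact reflect3_isometry].
    + apply diffeo_comp; [exact Hphi | apply diffeo_swap].
    + intros u v. unfold swap. cbn [fst snd]. rewrite HF. generalize (a1 v) (a2 u). qring.
Qed.

(** Reversing the second family, together with the reflection of the plane and of
    the ambient space that restores the orientation. *)
Lemma split_data_flip F a1 a2 w1 w2 : split_data a1 a2 w1 w2 -> represents F a1 a2 ->
  split_data (fun t => tau (a1 t)) (fun t => tau (a2 (- t))) (fun u => PI - w1 u) (fun v => - w2 (- v)) /\
  represents F (fun t => tau (a1 t)) (fun t => tau (a2 (- t))).
Proof.
  intros [S1 S2 H1 H2 B1 B2 A1 A2 L1 L2 Hs Hd] (L & phi & HL & Hphi & HF).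
  destruct (tau_curve a1 S1) as [T1 V1].
  destruct (reverse_curve a2 S2) as [S2' V2'], (tau_curve _ S2') as [T2 V2]. split.
  - assert (B1' : smooth1 (fun u => PI - w1 u))
      by (apply smooth1_iff, smooth_minus; [apply smooth_const | apply smooth1_iff, A1]).
    assert (B2' : smooth1 (fun v => - w2 (- v))).
    { apply smooth1_iff, smooth_opp. apply (smooth_comp_R w2 (fun v => - v)); [exact A2|].
      apply smooth_opp, smooth_id. }
    constructor; auto; try (intros; apply tau_H31; auto).
    + rewrite B1. qring.
    + rewrite Ropp_0, B2. qring.
    + intros u. rewrite V1, <- tau_conj, <- tau_mul, L1, cos_minus, sin_minus, cos_PI, sin_PI. qring.
    + intros v. rewrite V2, V2', <- tau_conj, <- tau_mul, qmul_scal_r, L2, cos_neg, sin_neg. qring.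
    + intros u v. pose proof (Hs u (- v)). lra.
    + replace (flat_chart (fun u => PI - w1 u) (fun v => - w2 (- v)))
        with (fun p => flip1 (flat_chart w1 w2 (flip2 p))).
      * apply (diffeo_comp flip1); [apply diffeo_flip1|].
        apply (diffeo_comp (flat_chart w1 w2)); [exact Hd | apply diffeo_flip2].
      * apply functional_extensionality. intros [u v]. unfold flip1, flip2, flat_chart. simpl.
        rewrite (RInt_ext (fun t => cos (PI - w1 t)) (fun t => -1 * cos (w1 t)))
          by (intros; rewrite cos_minus, cos_PI, sin_PI; real_eq; ring).
        rewrite (RInt_ext (fun t => sin (PI - w1 t)) (fun t => sin (w1 t)))
          by (intros; rewrite sin_minus, cos_PI, sin_PI; real_eq; ring).
        rewrite (RInt_ext (fun t => cos (- w2 (- t))) (fun t => cos (w2 (- t))))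
          by (intros; apply cos_neg).
        rewrite (RInt_ext (fun t => sin (- w2 (- t))) (fun t => -1 * sin (w2 (- t))))
          by (intros; rewrite sin_neg; real_eq; ring).
        assert (A2' : smooth1 (fun t => w2 (- t))).
        { apply smooth1_iff, (smooth_comp_R w2 (fun v => - v)); [exact A2 | apply smooth_opp, smooth_id]. }
        rewrite (RInt_scal_from_0 (-1) (fun t => cos (w1 t)) _ (smooth1_continuous _ (smooth1_cos_comp _ A1))),
          (RInt_scal_from_0 (-1) (fun t => sin (w2 (- t))) _ (smooth1_continuous _ (smooth1_sin_comp _ A2'))),
          (RInt_reverse (fun t => cos (w2 t)) _ (smooth1_continuous _ (smooth1_cos_comp _ A2))),
          (RInt_reverse (fun t => sin (w2 t)) _ (smooth1_continuous _ (smooth1_sin_comp _ A2))).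
        f_equal; ring.
  - exists (fun z => tau (L z)), (fun p => phi (flip2 p)). split; [|split].
    + apply linear_isometry_comp; [exact HL | exact tau_isometry].
    + apply diffeo_comp; [exact Hphi | apply diffeo_flip2].
    + intros u v. unfold flip2. cbn [fst snd]. rewrite HF, tau_mul, tau_conj. reflexivity.
Qed.

(** * Every isometric immersion arises *)

Lemma stays_in_interval (w : R -> R) a b t0 : smooth1 w -> (forall t, w t <> a /\ w t <> b) ->
  a < w t0 < b -> forall t, a < w t < b.
Proof.
  intros S H H0 t.
  assert (Hc : continuity w) by (intros s; apply continuity_pt_filterlim, smooth1_continuous, S).
  split; apply Rnot_le_lt; intros Hle.
  - destruct (IVT_gen w t0 t a Hc) as [c [_ E]]; [|exact (proj1 (H c) E)].
    rewrite Rmin_right, Rmax_left; lra.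
  - destruct (IVT_gen w t0 t b Hc) as [c [_ E]]; [|exact (proj2 (H c) E)].
    rewrite Rmin_left, Rmax_right; lra.
Qed.

Lemma sin_zero_bounds x : - PI < x < PI -> sin x = 0 -> x = 0.
Proof.
  intros H E. destruct (Rtotal_order x 0) as [Hx|[Hx|Hx]]; auto; exfalso.
  - pose proof (sin_gt_0 (- x)) as G. rewrite sin_neg in G. lra.
  - pose proof (sin_gt_0 x). lra.
Qed.

(** The ranges of [w1] and [- w2] are disjoint modulo [PI], so at most one of the
    two families is somewhere horizontal; up to the two symmetries it is the
    second one, and the angles lie in the intervals singled out by positivity. *)
Lemma split_data_normalize F a1 a2 w1 w2 : split_data a1 a2 w1 w2 -> represents F a1 a2 ->
  0 <= w1 0 < PI ->
  exists b1 b2 t1 t2, split_data b1 b2 t1 t2 /\ represents F b1 b2 /\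
    (forall u, 0 < t1 u < PI) /\ ((exists v, t2 v = 0) \/ forall v, 0 < t2 v < PI).
Proof.
  intros D HF H0.
  assert (Hs := sd_sum _ _ _ _ D). assert (A1 := sd_angle1 _ _ _ _ D). assert (A2 := sd_angle2 _ _ _ _ D).
  assert (Hb2 : - PI < w2 0 < PI) by (pose proof (Hs 0 0); lra).
  assert (Hnz : forall w : R -> R, (forall t, sin (w t) <> 0) -> forall t, w t <> 0 /\ w t <> PI).
  { intros w H t. split; intros E; apply (H t); rewrite E; [apply sin_0 | apply sin_PI]. }
  assert (Hnz' : forall w : R -> R, (forall t, sin (w t) <> 0) -> forall t, w t <> - PI /\ w t <> 0).
  { intros w H t. split; intros E; apply (H t); rewrite E; [rewrite sin_neg, sin_PI; ring | apply sin_0]. }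
  destruct (classic (exists u, sin (w1 u) = 0)) as [[u0 E0]|N1].
  - assert (N2 : forall v, sin (w2 v) <> 0).
    { intros v E. pose proof (sin_gt_0 _ (proj1 (Hs u0 v)) (proj2 (Hs u0 v))) as G.
      rewrite sin_plus, E0, E in G. lra. }
    destruct (Rtotal_order (w2 0) 0) as [H|[H|H]].
    + assert (R2 := stays_in_interval w2 (- PI) 0 0 A2 (Hnz' w2 N2) ltac:(lra)).
      destruct (split_data_flip F a1 a2 w1 w2 D HF) as [D' HF'].
      destruct (split_data_swap F _ _ _ _ D' HF') as [D'' HF''].
      do 4 eexists. split; [exact D''|]. split; [exact HF''|].
      assert (R2' : forall u, 0 < - w2 (- u) < PI) by (intros u; pose proof (R2 (- u)); lra).
      split; [exact R2'|]. left. exists u0. apply sin_zero_bounds.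
      * pose proof (sd_sum _ _ _ _ D'' 0 u0) as G. pose proof (R2' 0). cbv beta in G. lra.
      * rewrite sin_minus, sin_PI, E0. ring.
    + exfalso. apply (N2 0). rewrite H. apply sin_0.
    + assert (R2 := stays_in_interval w2 0 PI 0 A2 (Hnz w2 N2) ltac:(lra)).
      destruct (split_data_swap F _ _ _ _ D HF) as [D' HF'].
      do 4 eexists. split; [exact D'|]. split; [exact HF'|]. split; [exact R2|].
      left. exists u0. apply sin_zero_bounds; [|exact E0].
      pose proof (Hs u0 0). pose proof (R2 0). lra.
  - assert (N1' : forall u, sin (w1 u) <> 0) by (intros u E; apply N1; exists u; exact E).
    assert (R1 : forall u, 0 < w1 u < PI).
    { apply (stays_in_interval w1 0 PI 0); auto. destruct (Hnz w1 N1' 0). lra. }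
    destruct (classic (exists v, sin (w2 v) = 0)) as [[v0 E0]|N2].
    + exists a1, a2, w1, w2. split; [exact D|]. split; [exact HF|]. split; [exact R1|].
      left. exists v0. apply sin_zero_bounds; [|exact E0].
      pose proof (Hs 0 v0). pose proof (R1 0). lra.
    + assert (N2' : forall v, sin (w2 v) <> 0) by (intros v E; apply N2; exists v; exact E).
      destruct (Rtotal_order (w2 0) 0) as [H|[H|H]].
      * assert (R2 := stays_in_interval w2 (- PI) 0 0 A2 (Hnz' w2 N2') ltac:(lra)).
        destruct (split_data_flip F a1 a2 w1 w2 D HF) as [D' HF'].
        do 4 eexists. split; [exact D'|]. split; [exact HF'|]. split.
        -- intros u. pose proof (R1 u). lra.
        -- right. intros v. pose proof (R2 (- v)). lra.
      * exfalso. apply (N2' 0). rewrite H. apply sin_0.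
      * assert (R2 := stays_in_interval w2 0 PI 0 A2 (Hnz w2 N2') ltac:(lra)).
        exists a1, a2, w1, w2. auto.
Qed.

Lemma dirder_comp (f : R * R -> R) (g : R * R -> R * R) (p X : R * R) : smooth f -> smooth2 g ->
  dirder (fun q => f (g q)) p X =
  dirder f (g p) (dirder (fun q => fst (g q)) p X, dirder (fun q => snd (g q)) p X).
Proof.
  intros Hf [G1 G2]. rewrite (dirder_partials f) by exact Hf.
  transitivity (dirder (fun q : R * R => f (fst (g q), snd (g q))) p X).
  - apply Derive_ext. intros t. rewrite <- surjective_pairing. reflexivity.
  - etransitivity; [exact (dirder_comp2 f (fun q => fst (g q)) (fun q => snd (g q)) p X Hf G1 G2)|].
    assert (H : forall (z : R * R) a b, pd1 f (fst z, snd z) * a + pd2 f (fst z, snd z) * b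
      = a * pd1 f z + b * pd2 f z)
      by (intros [z1 z2] a b; apply (f_equal2 Rplus); apply Rmult_comm).
    apply (H (g p)).
Qed.

Lemma smooth4_comp (f : R * R -> R4) (g : R * R -> R * R) : smooth4 f -> smooth2 g ->
  smooth4 (fun p => f (g p)).
Proof.
  intros (F0 & F1 & F2 & F3) Hg. components smooth_comp_plane f; assumption.
Qed.

Lemma diff4_comp (f : R * R -> R4) (g : R * R -> R * R) (p X : R * R) : smooth4 f -> smooth2 g ->
  diff4 (fun q => f (g q)) p X =
  diff4 f (g p) (dirder (fun q => fst (g q)) p X, dirder (fun q => snd (g q)) p X).
Proof.
  intros (F0 & F1 & F2 & F3) Hg. components dirder_comp f; assumption.
Qed.

Lemma dirder_fst (p X : R * R) : dirder (fun q : R * R => fst q) p X = fst X.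
Proof.
  apply is_derive_unique. assert (D : forall a b : R, is_derive (fun t => a + t * b) 0 b)
    by (intros; auto_derive; auto; ring). exact (D (fst p) (fst X)).
Qed.

Lemma dirder_snd (p X : R * R) : dirder (fun q : R * R => snd q) p X = snd X.
Proof.
  apply is_derive_unique. assert (D : forall a b : R, is_derive (fun t => a + t * b) 0 b)
    by (intros; auto_derive; auto; ring). exact (D (snd p) (snd X)).
Qed.

(** Flat coordinates on the whole plane, and the ambient isometry that normalizes the
    frame at the origin. *)
Lemma flat_coordinates F : isometric_immersion_L2 F -> exists (L : R4 -> R4) (g : R * R -> R * R),
  linear_isometry L /\ diffeo_R2 g /\
  let G := fun p => L (F (g p)) in
  smooth4 G /\ (forall p, in_H31 (G p)) /\
  (forall p : R * R, inner (diff4 G p (1, 0)) (diff4 G p (1, 0)) = -1) /\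
  (forall p : R * R, inner (diff4 G p (1, 0)) (diff4 G p (0, 1)) = 0) /\
  (forall p : R * R, inner (diff4 G p (0, 1)) (diff4 G p (0, 1)) = 1) /\
  G (0, 0) = q1 /\ diff4 G (0, 0) (1, 0) = qi /\ diff4 G (0, 0) (0, 1) = qk.
Proof.
  intros ((SF & HF & _) & h & [[Sh1 Sh2] (g & Sg & Egh & Ehg)] & Hmet).
  set (E := fun p => F (g p)).
  assert (SE : smooth4 E) by (apply (smooth4_comp F g SF Sg)).
  assert (Hin : forall p X Y : R * R, inner (diff4 E p X) (diff4 E p Y) = - fst X * fst Y + snd X * snd Y).
  { intros p X Y.
    assert (DE : forall Y : R * R, diff4 E p Y = diff4 F (g p)
      (dirder (fun q => fst (g q)) p Y, dirder (fun q => snd (g q)) p Y))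
      by (intros Z; exact (diff4_comp F g p Z SF Sg)).
    rewrite !DE. etransitivity; [exact (Hmet _ _ _)|].
    assert (D1 : forall Y : R * R, dirder (fun q => fst (h q)) (g p)
      (dirder (fun q => fst (g q)) p Y, dirder (fun q => snd (g q)) p Y) = fst Y).
    { intros Z. transitivity (dirder (fun q : R * R => fst (h (g q))) p Z);
        [symmetry; exact (dirder_comp (fun q => fst (h q)) g p Z Sh1 Sg)|].
      transitivity (dirder (fun q : R * R => fst q) p Z); [|apply dirder_fst].
      apply Derive_ext. intros t. rewrite Ehg. reflexivity. }
    assert (D2 : forall Y : R * R, dirder (fun q => snd (h q)) (g p)
      (dirder (fun q => fst (g q)) p Y, dirder (fun q => snd (g q)) p Y) = snd Y).
    { intros Z. transitivity (dirder (fun q : R * R => snd (h (g q))) p Z);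
        [symmetry; exact (dirder_comp (fun q => snd (h q)) g p Z Sh2 Sg)|].
      transitivity (dirder (fun q : R * R => snd q) p Z); [|apply dirder_snd].
      apply Derive_ext. intros t. rewrite Ehg. reflexivity. }
    rewrite <- (D1 X), <- (D1 Y), <- (D2 X), <- (D2 Y). reflexivity. }
  assert (EXX : forall p : R * R, inner (diff4 E p (1, 0)) (diff4 E p (1, 0)) = -1)
    by (intros p; rewrite Hin; cbn [fst snd]; ring).
  assert (EXY : forall p : R * R, inner (diff4 E p (1, 0)) (diff4 E p (0, 1)) = 0)
    by (intros p; rewrite Hin; cbn [fst snd]; ring).
  assert (EYY : forall p : R * R, inner (diff4 E p (0, 1)) (diff4 E p (0, 1)) = 1)
    by (intros p; rewrite Hin; cbn [fst snd]; ring).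
  assert (HE : forall p, in_H31 (E p)) by (intros p; apply HF).
  pose proof (flat_adapted E SE HE EXX EXY EYY (0, 0)) as Fr.
  set (L := frame_coord (E (0, 0)) (diff4 E (0, 0) (1, 0)) (diff4 E (0, 0) (0, 1))).
  assert (HL : linear_isometry L) by exact (frame_coord_isometry _ _ _ Fr).
  destruct HL as (LL & LI & LM).
  exists L, g. split; [exact (conj LL (conj LI LM))|].
  split; [split; [exact Sg | exists h; split; [split; assumption | auto]]|].
  assert (D : forall p X : R * R, diff4 (fun p => L (E p)) p X = L (diff4 E p X))
    by (intros; apply linear4_diff4; assumption).
  cbv zeta. change (fun p => L (F (g p))) with (fun p => L (E p)).
  split; [apply linear4_smooth; assumption|].
  split; [intros p; unfold in_H31; rewrite LI; apply HE|].
  split; [intros p; rewrite !D, LI; apply EXX|].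
  split; [intros p; rewrite !D, LI; apply EXY|].
  split; [intros p; rewrite !D, LI; apply EYY|].
  rewrite !D. split; [|split].
  - exact (frame_coord_G _ _ _ Fr).
  - exact (frame_coord_X _ _ _ Fr).
  - exact (frame_coord_Y _ _ _ Fr).
Qed.

Lemma isometric_immersion_split F : isometric_immersion_L2 F ->
  exists a1 a2 w1 w2, split_data a1 a2 w1 w2 /\ represents F a1 a2 /\ 0 <= w1 0 < PI.
Proof.
  intros HF. destruct (flat_coordinates F HF) as (L & g & HL & Hg & SG & HG & XX & XY & YY & G0 & GX0 & GY0).
  set (G := fun p => L (F (g p))) in *.
  destruct (smooth_sff G SG) as (Se & Sm & Sy).
  destruct (asymptotic_angles (sff_xx G) (sff_xy G) (sff_yy G) Se Sm Sy
     (codazzi_x G SG HG XX XY YY) (codazzi_y G SG HG XX XY YY) (gauss G SG HG XX XY YY))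
    as (al & be & Sal & Sbe & Hsum & H0 & Rel & N1 & N2).
  destruct (net_chart al be Sal Sbe Hsum N1 N2) as (w1 & w2 & S1 & S2 & Hd & Hw).
  exists (fun u => G (flat_chart w1 w2 (u, 0))), (fun v => qconj (G (flat_chart w1 w2 (0, v)))), w1, w2.
  split; [|split].
  - exact (factorization_split_data G SG HG XX XY YY G0 GX0 GY0 al be Rel w1 w2 S1 S2 Hw Hsum Hd).
  - exists L, (fun p => g (flat_chart w1 w2 p)). split; [exact HL|]. split; [apply diffeo_comp; assumption|].
    intros u v. rewrite qconj_invol.
    exact (factorization G SG HG XX XY YY G0 al be Rel w1 w2 S1 S2 Hw u v).
  - destruct (Hw 0 0) as [<- _]. rewrite flat_chart_0. exact H0.
Qed.

(** * The angle of a positive unit normal *)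

Lemma sin_zero_cot x y : sin (x - y) = 0 -> cot x = cot y.
Proof.
  intros H. rewrite sin_minus in H. unfold cot.
  pose proof (sin2_cos2_mult x) as Tx. pose proof (sin2_cos2_mult y) as Ty.
  destruct (Req_EM_T (sin x) 0) as [Hx|Hx], (Req_EM_T (sin y) 0) as [Hy|Hy]; try reflexivity.
  - exfalso. rewrite Hx in *. assert (E : cos x * sin y = 0) by lra.
    apply Rmult_integral in E. destruct E as [E|E]; [rewrite E in Tx; lra | contradiction].
  - exfalso. rewrite Hy in *. assert (E : sin x * cos y = 0) by lra.
    apply Rmult_integral in E. destruct E as [E|E]; [contradiction | rewrite E in Ty; lra].
  - f_equal. apply Rminus_diag_uniq.
    transitivity (- (sin x * cos y - cos x * sin y) / (sin x * sin y)); [field; auto|].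
    rewrite H. field. auto.
Qed.

(** Angles that agree modulo [PI] agree modulo [2 PI] if a reference line does not
    separate their unit vectors. *)
Lemma same_angle x y t : sin (x - y) = 0 -> 0 < sin (x - t) -> 0 < sin (y - t) ->
  cos x = cos y /\ sin x = sin y.
Proof.
  intros E Hx Hy.
  assert (Ec : cos (x - y) = 1).
  { pose proof (sin2_cos2_mult (x - y)) as T. rewrite E in T.
    assert (F : sin (x - t) = sin (y - t) * cos (x - y)).
    { replace (x - t) with ((y - t) + (x - y)) by ring. rewrite sin_plus, E. ring. }
    assert (0 < cos (x - y)) by (apply (Rmult_lt_reg_l (sin (y - t))); lra).
    assert (G : (cos (x - y) - 1) * (cos (x - y) + 1) = 0) by lra.
    apply Rmult_integral in G. lra. }
  replace x with (y + (x - y)) by ring. rewrite cos_plus, sin_plus, E, Ec. lra.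
Qed.

Section PositiveAngle.
Variables gamma nu a : R -> R4.
Hypothesis HP : positive_unit_normal gamma nu.
Hypothesis HM : forall u, metricS gamma nu u = 4.
Hypothesis Ha : asymptotic_lift gamma nu a.
Variable psi : RP1 -> R.
Hypothesis Hpsi : is_acot (range (geod_curv gamma nu)) psi.
Notation th u := (psi (geod_curv gamma nu u)).

Lemma legendrian_orth u : inner (velocity gamma u) (nu u) = 0.
Proof. apply HP. Qed.

Lemma front_unit u : front_cos gamma nu u * front_cos gamma nu u + front_sin gamma nu u * front_sin gamma nu u = 1.
Proof.
  pose proof (HM u) as H. rewrite (lift_metricS _ _ _ Ha legendrian_orth) in H. lra.
Qed.

Lemma smooth1_front : smooth1 (front_cos gamma nu) /\ smooth1 (front_sin gamma nu).
Proof.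
  assert (Sa : smooth_curve a) by apply Ha.
  assert (S : smooth4 (V := R_NormedModule) (fun u => qmul (qconj (a u)) (velocity a u))).
  { apply smooth4_mul; [apply smooth4_conj, smooth_curve_iff, Sa|].
    apply smooth_curve_iff, smooth_curve_velocity, Sa. }
  destruct S as (_ & F1 & _ & F3).
  split; apply smooth1_iff.
  - eapply (eq_ind _ smooth F1). apply functional_extensionality. intros u. symmetry. apply (lift_front_cos _ _ _ Ha).
  - eapply (eq_ind _ smooth F3). apply functional_extensionality. intros u. symmetry. apply (lift_front_sin _ _ _ Ha).
Qed.

(** The angle function of the lift in the definition of positivity, which need not
    be the lift [a], has the same cosine and sine: the arc length condition makes
    its reparametrization trivial. *)
Lemma positive_angle_function : exists om : R -> R,
  (forall u, front_cos gamma nu u = cos (om u) /\ front_sin gamma nu u = sin (om u)) /\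
  (regular gamma -> forall u, 0 < sin (om u)) /\
  (~ regular gamma -> forall u, velocity gamma u = q0 -> cos (om u) = -1).
Proof.
  destruct HP as (_ & _ & b & om & Hb & (s & c & t & Ss & Hs & Hsm & Heq & Hlog) & Hpos).
  exists om. split; [|exact Hpos]. intros u.
  assert (Ev : velocity b u = qscal (Derive s u) (velocity c (s u))).
  { apply is_vel_velocity, (is_vel_ext (fun u => c (s u))); [intros; apply Heq|].
    apply is_vel_comp; [apply smooth_curve_at_is_vel, Hsm|].
    apply Derive_correct, smooth1_ex_derive, Ss. }
  pose proof (lift_log _ _ _ Hb legendrian_orth u) as L.
  destruct (Heq u) as [Ec Et].
  rewrite Ev, <- Ec, qmul_scal_r, Hlog, Et in L.
  assert (L1 := f_equal x1 L). assert (L3 := f_equal x3 L).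
  unfold qscal, x0, x1, x2, x3 in L1, L3. cbn [fst snd] in L1, L3.
  pose proof (front_unit u) as E. rewrite <- L1, <- L3 in E.
  pose proof (sin2_cos2_mult (om u)) as T. pose proof (Hs u) as Hpu.
  assert (G : (Derive s u - 1) * (Derive s u + 1) = 0).
  { transitivity (Derive s u * Derive s u * (sin (om u) * sin (om u) + cos (om u) * cos (om u)) - 1);
      [rewrite T; ring | rewrite <- E; ring]. }
  apply Rmult_integral in G. replace (Derive s u) with 1 in L1, L3 by lra.
  rewrite Rmult_1_l in L1, L3. auto.
Qed.

Lemma singular_curvature u : velocity gamma u = q0 <-> geod_curv gamma nu u = Inf.
Proof.
  unfold geod_curv. destruct (excluded_middle_informative (velocity gamma u = q0)); split; intros; auto;
    [contradiction | discriminate].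
Qed.

Lemma cot_th u : cot (th u) = geod_curv gamma nu u.
Proof. apply Hpsi. exists u. reflexivity. Qed.

Lemma regular_th : regular gamma -> forall u, 0 < th u < PI.
Proof.
  intros Hr u. apply Hpsi; [|exists u; reflexivity].
  intros [v E]. apply (Hr v), singular_curvature, E.
Qed.

(** [PI] is the only multiple of [PI] in the interval of values of the branch. *)
Lemma singular_th u : velocity gamma u = q0 -> th u = PI.
Proof.
  intros H. apply singular_curvature in H.
  destruct Hpsi as (_ & _ & _ & HI).
  destruct HI as (c & Hc & Hr); [exists u; exact H|].
  specialize (Hr (geod_curv gamma nu u) (ex_intro _ u eq_refl)).
  assert (E : sin (th u) = 0).
  { pose proof (eq_trans (cot_th u) H) as E.
    destruct (Req_dec (sin (th u)) 0) as [|Hn]; [assumption|]. rewrite (cot_Fin _ Hn) in E. discriminate. }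
  assert (E' : th u - PI = 0); [|lra].
  apply sin_zero_bounds; [lra|]. rewrite sin_minus, E, sin_PI. ring.
Qed.

(** If the curvature is infinite somewhere, the branch has values in an interval
    [(t, t + PI)] whose end direction is not attained. The unit vector of the lift
    therefore stays on one side of this direction, and positivity at a singular point
    decides on which. *)
Lemma th_interval : exists t, (forall u, t < th u < t + PI) /\
  forall u, 0 < front_sin gamma nu u * cos t - front_cos gamma nu u * sin t.
Proof.
  destruct positive_angle_function as (om & Hom & Hreg & Hsing).
  destruct smooth1_front as [Sc Ss].
  assert (Hline : forall u, sin (th u - om u) = 0).
  { intros u. apply cot_eq_sin. rewrite cot_th.
    assert (Sg : smooth_curve gamma) by apply HP. assert (Sn : smooth_curve nu) by apply HP.
    apply (lift_geod_curv _ _ _ Ha legendrian_orth Sg Sn); apply Hom. }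
  destruct (classic (regular gamma)) as [Hr|Hr].
  - exists 0. split.
    + intros u. pose proof (regular_th Hr u). lra.
    + intros u. rewrite cos_0, sin_0. destruct (Hom u) as [_ ->]. pose proof (Hreg Hr u). lra.
  - assert (Hex : exists u0, velocity gamma u0 = q0).
    { apply NNPP. intros H. apply Hr. intros u E. apply H. exists u. exact E. }
    destruct Hex as [u0 H0].
    assert (HI : range (geod_curv gamma nu) Inf) by (exists u0; apply singular_curvature, H0).
    destruct (proj2 (proj2 (proj2 Hpsi)) HI) as (c & Hc & Hrg).
    assert (Hrg' : forall u, PI - c < th u < 2 * PI - c) by (intros u; apply Hrg; exists u; reflexivity).
    exists (PI - c). split; [intros u; pose proof (Hrg' u); lra|].
    set (d := fun u => front_sin gamma nu u * cos (PI - c) - front_cos gamma nu u * sin (PI - c)).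
    assert (Sd : smooth1 d).
    { apply smooth1_iff, smooth_minus; apply smooth_mult; try apply smooth_const; apply smooth1_iff; assumption. }
    assert (Ed : forall u, d u = sin (om u - (PI - c))).
    { intros u. unfold d. destruct (Hom u) as [-> ->]. rewrite (sin_minus (om u)). ring. }
    assert (Hd : forall u, d u <> 0).
    { intros u E. rewrite Ed in E.
      pose proof (sin_gt_0 (th u - (PI - c))) as G. pose proof (Hrg' u).
      replace (th u - (PI - c)) with ((om u - (PI - c)) + (th u - om u)) in G by ring.
      rewrite sin_plus, Hline, E in G. lra. }
    assert (Hd0 : d u0 = sin c).
    { unfold d. destruct (Hom u0) as [E1 E2]. rewrite E1, (Hsing Hr u0 H0).
      rewrite (proj1 (lift_singular _ _ _ Ha legendrian_orth u0) H0).
      rewrite sin_minus, sin_PI, cos_PI. ring. }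
    assert (Hb : forall u, d u <= 1) by (intros u; rewrite Ed; apply SIN_bound).
    intros u. apply (stays_in_interval d 0 2 u0 Sd).
    + intros t. split; [apply Hd | pose proof (Hb t); lra].
    + rewrite Hd0. pose proof (sin_gt_0 c (proj1 Hc) (proj2 Hc)). pose proof (SIN_bound c). lra.
Qed.

Lemma th_front u : front_cos gamma nu u = cos (th u) /\ front_sin gamma nu u = sin (th u).
Proof.
  destruct th_interval as (t & Ht & Hd).
  destruct positive_angle_function as (om & Hom & _).
  specialize (Hd u). specialize (Ht u). destruct (Hom u) as [E1 E2]. rewrite E1, E2 in *.
  apply (same_angle (om u) (th u) t).
  - apply cot_eq_sin. rewrite cot_th. symmetry.
    apply (lift_geod_curv _ _ _ Ha legendrian_orth); auto; apply HP.
  - rewrite sin_minus. lra.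
  - apply sin_gt_0; lra.
Qed.

(** Rotated by [- t] the unit vector stays in the upper half plane, where its angle is
    smooth. *)
Lemma smooth1_th : smooth1 (fun u => th u).
Proof.
  destruct th_interval as (t & Ht & Hd). destruct smooth1_front as [Sc Ss].
  apply smooth1_iff in Sc, Ss. apply smooth1_iff.
  set (C := fun u => front_cos gamma nu u * cos t + front_sin gamma nu u * sin t).
  set (S := fun u => front_sin gamma nu u * cos t - front_cos gamma nu u * sin t).
  assert (SC : smooth (V := R_NormedModule) C)
    by (apply smooth_plus; apply smooth_mult; try assumption; apply smooth_const).
  assert (SS : smooth (V := R_NormedModule) S)
    by (apply smooth_minus; apply smooth_mult; try assumption; apply smooth_const).
  assert (Hth : smooth (V := R_NormedModule) (fun u => t + (PI / 2 - atan (C u * / S u)))).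
  { apply smooth_plus; [apply smooth_const|]. apply smooth_minus; [apply smooth_const|].
    apply (smooth_comp_R atan); [apply smooth1_atan|].
    apply smooth_mult; [exact SC | apply smooth_inv; [exact SS|]].
    intros u. pose proof (Hd u) as Hdu. fold (S u) in Hdu. apply Rgt_not_eq, Hdu. }
  apply (eq_ind _ smooth Hth). apply functional_extensionality. intros u.
  destruct (th_front u) as [E1 E2]. unfold C, S. rewrite E1, E2.
  replace (cos (th u) * cos t + sin (th u) * sin t) with (cos (th u - t)) by (rewrite cos_minus; ring).
  replace (sin (th u) * cos t - cos (th u) * sin t) with (sin (th u - t)) by (rewrite sin_minus; ring).
  pose proof (Ht u). pose proof (atan_cot_0_PI (th u - t) ltac:(lra)) as E. unfold Rdiv in E.
  real_eq. lra.
Qed.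

Lemma th_log u : qmul (qconj (a u)) (velocity a u) = (0, cos (th u), 0, sin (th u)).
Proof.
  destruct (th_front u) as [<- <-]. apply (lift_log _ _ _ Ha legendrian_orth).
Qed.
End PositiveAngle.

(** * The immersion defined by two asymptotic lifts *)

Section Product.
Variables a1 a2 : R -> R4.
Variables w1 w2 : R -> R.
Hypothesis S1 : smooth_curve a1.
Hypothesis S2 : smooth_curve a2.
Hypothesis H1 : forall u, in_H31 (a1 u).
Hypothesis H2 : forall v, in_H31 (a2 v).
Hypothesis L1 : forall u, qmul (qconj (a1 u)) (velocity a1 u) = (0, cos (w1 u), 0, sin (w1 u)).
Hypothesis L2 : forall v, qmul (qconj (a2 v)) (velocity a2 v) = (0, - cos (w2 v), 0, sin (w2 v)).
Hypothesis A1 : smooth1 w1.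
Hypothesis A2 : smooth1 w2.
Hypothesis Hsum : forall u v, 0 < w1 u + w2 v < PI.

Definition sandwich (b : R4) (p : R * R) : R4 := qmul (qmul (a1 (fst p)) b) (qconj (a2 (snd p))).

Lemma smooth4_sandwich b : smooth4 (sandwich b).
Proof.
  apply smooth4_mul; [apply smooth4_mul; [|apply smooth4_const] | apply smooth4_conj].
  - exact (smooth4_curve a1 _ S1 smooth_fst).
  - exact (smooth4_curve a2 _ S2 smooth_snd).
Qed.

Lemma diff4_sandwich b (p X : R * R) : diff4 (sandwich b) p X = sandwich
  (qadd (qscal (fst X) (qmul (0, cos (w1 (fst p)), 0, sin (w1 (fst p))) b))
        (qscal (snd X) (qmul b (0, cos (w2 (snd p)), 0, - sin (w2 (snd p)))))) p.
Proof.
  rewrite (diff4_partials _ p X (smooth4_sandwich b)). destruct p as [u v].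
  set (O1 := (0, cos (w1 u), 0, sin (w1 u)) : R4).
  set (O2 := (0, cos (w2 v), 0, - sin (w2 v)) : R4).
  assert (E1 : velocity a1 u = qmul (a1 u) O1)
    by (unfold O1; rewrite <- L1, cancel_l; auto).
  assert (E2 : qconj (velocity a2 v) = qmul O2 (qconj (a2 v))).
  { rewrite <- (cancel_l (a2 v) (velocity a2 v) (H2 v)), L2, qconj_mul. f_equal. unfold O2. qring. }
  destruct (diff4_unique (sandwich b) u v (qmul (qmul (qmul (a1 u) O1) b) (qconj (a2 v)))
     (qmul (qmul (a1 u) b) (qmul O2 (qconj (a2 v)))) (smooth4_sandwich b)) as [D1 D2].
  - rewrite <- E1. eapply is_vel_eq.
    + exact (is_vel_mul _ _ u _ _ (is_vel_mul _ _ u _ _ (smooth_curve_is_vel a1 u S1) (is_vel_const b u))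
        (is_vel_const (qconj (a2 v)) u)).
    + cbv beta. generalize (velocity a1 u) (a1 u) (a2 v). qring.
  - rewrite <- E2. eapply is_vel_eq.
    + exact (is_vel_mul _ _ v _ _ (is_vel_const (qmul (a1 u) b) v)
        (is_vel_conj _ _ _ (smooth_curve_is_vel a2 v S2))).
    + cbv beta. generalize (qconj (velocity a2 v)) (qmul (a1 u) b) (a2 v). qring.
  - rewrite D1, D2. unfold sandwich. cbn [fst snd]. fold O1 O2.
    rewrite qmul_add_r, qmul_add_l, !qmul_scal_r, !qmul_scal_l, !qmul_assoc. reflexivity.
Qed.

Lemma inner_sandwich2 b c p : inner (sandwich b p) (sandwich c p) = inner b c.
Proof.
  unfold sandwich. rewrite inner_mul_r, inner_mul_l, inner_conj, (H1 (fst p)), (H2 (snd p)). ring.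
Qed.

Notation f := (fun p : R * R => qmul (a1 (fst p)) (qconj (a2 (snd p)))).

Lemma product_sandwich : f = sandwich q1.
Proof.
  apply functional_extensionality. intros p. unfold sandwich. rewrite qmul_1_r. reflexivity.
Qed.

Lemma product_global_parameters : global_characteristic_parameters f w1 w2.
Proof.
  rewrite product_sandwich.
  split; [exact A1|]. split; [exact A2|]. split; [exact Hsum|].
  exists (sandwich qj). split.
  - split; [apply smooth4_sandwich|]. intros p. rewrite !inner_sandwich2.
    split; [qunfold; ring|]. split; [qunfold; ring|].
    intros X. rewrite diff4_sandwich, inner_sandwich2. qunfold. ring.
  - intros u v du dv. cbv zeta. rewrite !diff4_sandwich, !inner_sandwich2. cbn [fst snd].
    rewrite !cos_2a, cos_minus, sin_plus.
    generalize (cos (w1 u)) (sin (w1 u)) (cos (w2 v)) (sin (w2 v)). intros.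
    split; [|split]; qunfold; ring.
Qed.

Hypothesis Hd : diffeo_R2 (flat_chart w1 w2).

Lemma product_isometric_immersion : isometric_immersion_L2 f.
Proof.
  rewrite product_sandwich. split; [split; [apply smooth4_sandwich|split]|].
  - intros p. unfold in_H31. rewrite inner_sandwich2. qunfold. ring.
  - intros [u v] [x y] E.
    assert (Hz : forall b, inner (diff4 (sandwich q1) (u, v) (x, y)) (sandwich b (u, v)) = 0)
      by (intros b; rewrite E; qunfold; ring).
    pose proof (Hz qi) as Ei. pose proof (Hz qk) as Ek.
    rewrite diff4_sandwich, inner_sandwich2 in Ei, Ek. cbn [fst snd] in Ei, Ek.
    pose proof (sin_gt_0 _ (proj1 (Hsum u v)) (proj2 (Hsum u v))) as Hp. rewrite sin_plus in Hp.
    clear - Ei Ek Hp. revert Ei Ek Hp.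
    generalize (cos (w1 u)) (sin (w1 u)) (cos (w2 v)) (sin (w2 v)). intros c1 s1 c2 s2 Ei Ek Hp.
    qunfold.
    assert (E1 : c1 * x + c2 * y = 0) by lra. assert (E2 : s1 * x - s2 * y = 0) by lra.
    f_equal; apply (Rmult_eq_reg_r (s1 * c2 + c1 * s2)); try lra.
    + transitivity (s2 * (c1 * x + c2 * y) + c2 * (s1 * x - s2 * y)); [real_eq; ring | rewrite E1, E2; ring].
    + transitivity (s1 * (c1 * x + c2 * y) - c1 * (s1 * x - s2 * y)); [real_eq; ring | rewrite E1, E2; ring].
  - exists (flat_chart w1 w2). split; [exact Hd|]. intros p X Y.
    destruct (flat_chart_smooth w1 w2 A1 A2) as [[Sx Sy] D]. destruct (D p) as (D1 & D2 & D3 & D4).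
    assert (Ex : forall Z : R * R, dirder (fun q : R * R => fst (flat_chart w1 w2 q)) p Z
        = fst Z * cos (w1 (fst p)) + snd Z * cos (w2 (snd p))).
    { intros Z. etransitivity; [exact (dirder_partials _ p Z Sx)|].
      exact (f_equal2 Rplus (f_equal (Rmult (fst Z)) D1) (f_equal (Rmult (snd Z)) D2)). }
    assert (Ey : forall Z : R * R, dirder (fun q : R * R => snd (flat_chart w1 w2 q)) p Z
        = fst Z * sin (w1 (fst p)) + snd Z * - sin (w2 (snd p))).
    { intros Z. etransitivity; [exact (dirder_partials _ p Z Sy)|].
      exact (f_equal2 Rplus (f_equal (Rmult (fst Z)) D3) (f_equal (Rmult (snd Z)) D4)). }
    rewrite !Ex, !Ey, !diff4_sandwich, inner_sandwich2.
    qunfold. real_eq. ring.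
Qed.

End Product.

Lemma construction_angles gamma1 nu1 gamma2 nu2 a1 a2 w1 w2 :
  construction_data gamma1 nu1 gamma2 nu2 a1 a2 w1 w2 ->
  (smooth1 w1 /\ forall u, qmul (qconj (a1 u)) (velocity a1 u) = (0, cos (w1 u), 0, sin (w1 u))) /\
  (smooth1 w2 /\ forall v, qmul (qconj (a2 v)) (velocity a2 v) = (0, - cos (w2 v), 0, sin (w2 v))) /\
  forall u v, 0 < w1 u + w2 v < PI.
Proof.
  intros [(P1 & P2 & _ & _ & _ & _ & R1 & Hne & Hgt) M1 M2 L1 L2 (c1 & C1 & E1) (c2 & C2 & E2) _].
  set (t1 := fun u => c1 (geod_curv gamma1 nu1 u)). set (t2 := fun v => c2 (geod_curv gamma2 nu2 v)).
  assert (T1 := smooth1_th gamma1 nu1 a1 P1 M1 L1 c1 C1).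
  assert (T2 := smooth1_th gamma2 nu2 a2 P2 M2 L2 c2 C2).
  replace w1 with t1 by (apply functional_extensionality; intros u; symmetry; apply E1).
  replace w2 with (fun v => PI - t2 v) by (apply functional_extensionality; intros v; symmetry; apply E2).
  split; [split; [exact T1 | exact (th_log gamma1 nu1 a1 P1 M1 L1 c1 C1)]|].
  split.
  - split; [apply smooth1_iff, smooth_minus; [apply smooth_const | apply smooth1_iff, T2]|].
    intros v. rewrite (th_log gamma2 nu2 a2 P2 M2 L2 c2 C2). fold (t2 v).
    rewrite cos_minus, sin_minus, cos_PI, sin_PI. qring.
  - assert (B1 : forall u, 0 < t1 u < PI) by exact (regular_th gamma1 nu1 c1 C1 R1).
    assert (Hsin : forall u v, sin (t1 u - t2 v) <> 0).
    { intros u v E. apply (Hne u v). apply sin_zero_cot in E. unfold t1, t2 in E.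
      rewrite (cot_th gamma1 nu1 c1 C1), (cot_th gamma2 nu2 c2 C2) in E. exact E. }
    intros u v. cut (0 < t2 v - t1 u < PI); [lra|].
    destruct (classic (regular gamma2)) as [R2|R2].
    + pose proof (regular_th gamma2 nu2 c2 C2 R2 v) as B2. fold (t2 v) in B2.
      pose proof (Hgt R2 u v) as G.
      rewrite <- (cot_th gamma1 nu1 c1 C1), <- (cot_th gamma2 nu2 c2 C2) in G.
      fold (t1 u) (t2 v) in G. pose proof (B1 u).
      pose proof (sin_gt_0 (t1 u) ltac:(lra) ltac:(lra)). pose proof (sin_gt_0 (t2 v) ltac:(lra) ltac:(lra)).
      rewrite !cot_Fin in G by lra. simpl in G.
      destruct (Rtotal_order (t1 u) (t2 v)) as [Hl|[He|Hl]]; [lra| |].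
      * rewrite He in G. lra.
      * pose proof (cot_lt (t2 v) (t1 u) ltac:(lra) ltac:(lra) Hl). lra.
    + assert (Hex : exists v0, velocity gamma2 v0 = q0).
      { apply NNPP. intros H. apply R2. intros r E. apply H. exists r. exact E. }
      destruct Hex as [v0 H0].
      pose proof (singular_th gamma2 nu2 c2 C2 v0 H0) as Ev0. fold (t2 v0) in Ev0.
      apply (stays_in_interval (fun v => t2 v - t1 u) 0 PI v0).
      * apply smooth1_iff, smooth_minus; [apply smooth1_iff, T2 | apply smooth_const].
      * intros r. split; intros E; apply (Hsin u r).
        -- replace (t1 u - t2 r) with (- (t2 r - t1 u)) by ring. rewrite E, sin_neg, sin_0. ring.
        -- replace (t1 u - t2 r) with (- (t2 r - t1 u)) by ring. rewrite E, sin_neg, sin_PI. ring.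
      * rewrite Ev0. pose proof (B1 u). lra.
Qed.

(** * The correspondence between pairs of fronts and surfaces *)

Theorem theorem22 :
  (forall (gamma1 nu1 gamma2 nu2 a1 a2 : R -> R4) (omega1 omega2 : R -> R),
     construction_data gamma1 nu1 gamma2 nu2 a1 a2 omega1 omega2 ->
     let f := fun p : R * R => qmul (a1 (fst p)) (qconj (a2 (snd p))) in
     isometric_immersion_L2 f /\
     global_characteristic_parameters f omega1 omega2)
  /\
  (forall F : R * R -> R4, isometric_immersion_L2 F ->
     exists (Phi : R4 -> R4) (phi : R * R -> R * R)
            (gamma1 nu1 gamma2 nu2 a1 a2 : R -> R4) (omega1 omega2 : R -> R),
       isometry_H31 Phi /\ diffeo_R2 phi /\
       construction_data gamma1 nu1 gamma2 nu2 a1 a2 omega1 omega2 /\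
       forall u v : R, Phi (F (phi (u, v))) = qmul (a1 u) (qconj (a2 v))).
Proof.
  split.
  - intros gamma1 nu1 gamma2 nu2 a1 a2 w1 w2 D f.
    destruct (construction_angles _ _ _ _ _ _ _ _ D) as ((S1 & L1) & (S2 & L2) & Hs).
    destruct (cd_lift1 _ _ _ _ _ _ _ _ D) as (A1 & _ & H1 & _).
    destruct (cd_lift2 _ _ _ _ _ _ _ _ D) as (A2 & _ & H2 & _).
    split.
    + exact (product_isometric_immersion a1 a2 w1 w2 A1 A2 H1 H2 L1 L2 S1 S2 Hs
               (cd_diffeo _ _ _ _ _ _ _ _ D)).
    + exact (product_global_parameters a1 a2 w1 w2 A1 A2 H1 H2 L1 L2 S1 S2 Hs).
  - intros F HF.
    destruct (isometric_immersion_split F HF) as (b1 & b2 & t1 & t2 & D & Hrep & H0).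
    destruct (split_data_normalize F b1 b2 t1 t2 D Hrep H0)
      as (a1 & a2 & w1 & w2 & D' & (L & phi & HL & Hphi & E) & R1 & R2).
    exists L, phi, (lift_gamma a1), (lift_nu a1), (lift_gamma a2), (lift_nu a2), a1, a2, w1, w2.
    split; [apply linear_isometry_H31, HL|]. split; [exact Hphi|]. split; [|exact E].
    exact (split_construction a1 a2 w1 w2 D' R1 R2).
Qed.
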